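(* Let $d=2$ and let $\alpha_0,\alpha_1:\mathbb R^2\to U(m)$ be two families of matching matrices (same $\varepsilon$). Then $\alpha_0$ and $\alpha_1$ are equivariantly homotopic if and only if each of the four pairs of one-dimensional families of matching matrices $\{\alpha_0(0,k_2)\}_{k_2}$ and $\{\alpha_1(0,k_2)\}_{k_2}$; $\{\alpha_0(1/2,k_2)\}_{k_2}$ and $\{\alpha_1(1/2,k_2)\}_{k_2}$; $\{\alpha_0(k_1,0)\}_{k_1}$ and $\{\alpha_1(k_1,0)\}_{k_1}$; $\{\alpha_0(k_1,1/2)\}_{k_1}$ and $\{\alpha_1(k_1,1/2)\}_{k_1}$ is equivariantly homotopic (as families of matching matrices in dimension $d=1$).
   Context: Fix $m\ge1$; $\varepsilon$ is either the $m\times m$ identity $\mathbf 1$ (bosonic) or, for $m$ even, $J=\begin{pmatrix}0&\mathbf 1\\-\mathbf 1&0\end{pmatrix}$ (fermionic). A family of matching matrices in dimension $d$ is a continuous, $\mathbb Z^d$-periodic map $\alpha:\mathbb R^d\to U(m)$ with $\varepsilon\,\alpha(\mathbf k)=\alpha(-\mathbf k)^t\,\varepsilon$ for all $\mathbf k$. (The four restrictions listed are families of matching matrices in $d=1$ because $0$ and $1/2$ satisfy $x\equiv -x \bmod \mathbb Z$.) Two families $\alpha_0,\alpha_1$ are equivariantly homotopic if there is a map $(t,\mathbf k)\mapsto\alpha_t(\mathbf k)$, continuous in $t\in[0,1]$, with each $\alpha_t$ a family of matching matrices, $\alpha_{t=0}=\alpha_0$, $\alpha_{t=1}=\alpha_1$.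 *)

(* Defs.v *)
(* classical reals (Stdlib Reals).  Complex numbers are pairs of
   reals; m x m complex matrices are functions nat -> nat -> C of which only
   the entries with indices < m are meaningful (compared with mat_eq). *)
From Stdlib Require Import Reals.
Open Scope R_scope.

Definition C : Type := (R * R)%type.
Definition C0 : C := (0, 0).
Definition C1 : C := (1, 0).
Definition Cneg1 : C := (-1, 0).
Definition Cadd (z w : C) : C := (fst z + fst w, snd z + snd w).
Definition Cmul (z w : C) : C :=
  (fst z * fst w - snd z * snd w, fst z * snd w + snd z * fst w).
Definition Cconj (z : C) : C := (fst z, - snd z).

Definition Mat : Type := nat -> nat -> C.

Fixpoint Csum (n : nat) (f : nat -> C) : C :=
  match n with
  | O => C0
  | S n' => Cadd (Csum n' f) (f n')
  end.

Definition mat_eq (m : nat) (A B : Mat) : Prop :=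
  forall i j, (i < m)%nat -> (j < m)%nat -> A i j = B i j.

Definition mmul (m : nat) (A B : Mat) : Mat :=
  fun i j => Csum m (fun k => Cmul (A i k) (B k j)).

Definition mtr (A : Mat) : Mat := fun i j => A j i.
Definition madj (A : Mat) : Mat := fun i j => Cconj (A j i).

Definition mid : Mat := fun i j => if Nat.eqb i j then C1 else C0.

Definition unitary (m : nat) (A : Mat) : Prop :=
  mat_eq m (mmul m (madj A) A) mid /\ mat_eq m (mmul m A (madj A)) mid.

(* J = [[0, 1], [-1, 0]] in blocks of size n = m/2 *)
Definition Jmat (m : nat) : Mat :=
  fun i j =>
    let n := Nat.div2 m in
    if Nat.ltb i n then (if Nat.eqb j (i + n) then C1 else C0)
    else (if Nat.eqb i (j + n) then Cneg1 else C0).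

Inductive statistics : Type := Bosonic | Fermionic.

Definition eps_mat (s : statistics) (m : nat) : Mat :=
  match s with Bosonic => mid | Fermionic => Jmat m end.

Definition admissible (s : statistics) (m : nat) : Prop :=
  (1 <= m)%nat /\ (s = Fermionic -> Nat.Even m).

Definition cont_on {X : Type} (dX : X -> X -> R) (D : X -> Prop) (f : X -> R) : Prop :=
  forall x, D x -> forall e, 0 < e ->
    exists del, 0 < del /\ forall y, D y -> dX x y < del -> Rabs (f y - f x) < e.

Definition mat_cont_on {X : Type} (dX : X -> X -> R) (D : X -> Prop)
  (m : nat) (F : X -> Mat) : Prop :=
  forall i j, (i < m)%nat -> (j < m)%nat ->
    cont_on dX D (fun x => fst (F x i j)) /\ cont_on dX D (fun x => snd (F x i j)).

Definition dist1 (x y : R) : R := Rabs (x - y).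
Definition dist2 (x y : R * R) : R :=
  Rmax (Rabs (fst x - fst y)) (Rabs (snd x - snd y)).
Definition dist3 (x y : R * (R * R)) : R :=
  Rmax (Rabs (fst x - fst y)) (dist2 (snd x) (snd y)).

Definition allR {X : Type} (_ : X) : Prop := True.

Definition family1 (s : statistics) (m : nat) (a : R -> Mat) : Prop :=
  mat_cont_on dist1 allR m a /\
  (forall k, mat_eq m (a (k + 1)) (a k)) /\
  (forall k, unitary m (a k)) /\
  (forall k, mat_eq m (mmul m (eps_mat s m) (a k))
                      (mmul m (mtr (a (- k))) (eps_mat s m))).

Definition family2 (s : statistics) (m : nat) (a : R * R -> Mat) : Prop :=
  mat_cont_on dist2 allR m a /\
  (forall k1 k2, mat_eq m (a (k1 + 1, k2)) (a (k1, k2))) /\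
  (forall k1 k2, mat_eq m (a (k1, k2 + 1)) (a (k1, k2))) /\
  (forall k, unitary m (a k)) /\
  (forall k1 k2, mat_eq m (mmul m (eps_mat s m) (a (k1, k2)))
                          (mmul m (mtr (a (- k1, - k2))) (eps_mat s m))).

Definition unit_interval (t : R) : Prop := 0 <= t <= 1.

Definition eq_homotopic1 (s : statistics) (m : nat) (a0 a1 : R -> Mat) : Prop :=
  exists H : R -> R -> Mat,
    mat_cont_on dist2 (fun p : R * R => unit_interval (fst p)) m
      (fun p => H (fst p) (snd p)) /\
    (forall t, unit_interval t -> family1 s m (H t)) /\
    (forall k, mat_eq m (H 0 k) (a0 k)) /\
    (forall k, mat_eq m (H 1 k) (a1 k)).

Definition eq_homotopic2 (s : statistics) (m : nat) (a0 a1 : R * R -> Mat) : Prop :=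
  exists H : R -> R * R -> Mat,
    mat_cont_on dist3 (fun p : R * (R * R) => unit_interval (fst p)) m
      (fun p => H (fst p) (snd p)) /\
    (forall t, unit_interval t -> family2 s m (H t)) /\
    (forall k, mat_eq m (H 0 k) (a0 k)) /\
    (forall k, mat_eq m (H 1 k) (a1 k)).

(* Main.v *)
(* The determinant of a family is even and periodic, so it has an even periodic logarithm, and
   dividing by its m-th root makes the family SU(m)-valued.  The line homotopies then become
   paths of symmetric matrices of SU(m) at the four fixed points of k |-> - k, up to m-th roots
   of unity.  As 1 is joined to e^(4 i pi / m) by symmetric matrices, only the parities of these
   roots matter, and they can be chosen to agree at the four points.
   A map W supported on one half of the torus acts on families by b(k) |-> eps^-1 W(-k)^t eps
   b(k) W(k), and W may be replaced by any homotopic map.  Short steps along the Cayley transform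
   move b to a at the fixed points; then the mismatch b^-1 a on half an edge, and finally on half
   a cell of the torus, is a map from a square to SU(m) which is trivial where b = a.  It is
   contractible relative to that locus because SU(m) is 2-connected: its first column is a map
   from the square to the sphere of C^m, a piecewise linear approximation of which meets finitely
   many real subspaces of dimension 3 and hence misses a ray through the moment curve of R^4,
   and one concludes by induction on m. *)
Require Import Defs.
From Stdlib Require Import Reals.
From mathcomp Require Import Rstruct.
From mathcomp Require Import all_boot all_order all_algebra.
From mathcomp Require Import all_classical all_reals.
From mathcomp Require Import topology normedtype realfun trigo.
From mathcomp Require Import complex ring lra zify.
Import Order.TTheory GRing.Theory Num.Theory numFieldNormedType.Exports ComplexField.Normc.
Set Implicit Arguments.
Unset Strict Implicit.
Unset Printing Implicit Defensive.
Local Open Scope classical_set_scope.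
Local Open Scope complex_scope.
Local Open Scope ring_scope.
Local Notation "x ^*" := (conjc x) : ring_scope.

(** Why the action of W suffices away from the fixed points: if W is 1 at - k, the new value at k is
    b(k) W(k), so W = b^-1 a on one half installs a there, and the matching relation installs it on
    the other half. At a fixed point k and - k coincide and W acts on both sides at once; there
    symmetric matrices are moved directly, whence the Cayley steps. Why determinants are removed
    beforehand: U(m) is not simply connected, so a mismatch over an edge or a cell need not
    contract, whereas in SU(m) it does, cells having dimension at most 2. The price is the choice of
    an m-th root of a logarithm. Along one line the choices differ by the same root of unity at both
    fixed points, because two logarithms of one function differ by a constant. The contraction can
    be taken relative to the locus where the map is 1, of whatever shape, because each move is cut
    off by a function of the value at the point that vanishes on this locus. *)

Section RealContinuity.
Variables (R : realType) (T : topologicalType).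
Implicit Types (f g : T -> R).

(** * Closure properties of real-valued continuous maps *)

Lemma rcont_cst (c : R) : continuous (fun _ : T => c).
Proof. by move=> x; apply: cvg_cst. Qed.

Lemma rcontD f g : continuous f -> continuous g -> continuous (fun x => f x + g x).
Proof. by move=> cf cg x; apply: cvgD; [exact: cf|exact: cg]. Qed.

Lemma rcontN f : continuous f -> continuous (fun x => - f x).
Proof. by move=> cf x; apply: cvgN; exact: cf. Qed.

Lemma rcontB f g : continuous f -> continuous g -> continuous (fun x => f x - g x).
Proof. by move=> cf cg x; apply: cvgB; [exact: cf|exact: cg]. Qed.

Lemma rcontM f g : continuous f -> continuous g -> continuous (fun x => f x * g x).
Proof. by move=> cf cg x; apply: cvgM; [exact: cf|exact: cg]. Qed.

Lemma rcontV f : (forall x, f x != 0) -> continuous f -> continuous (fun x => (f x)^-1).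
Proof. by move=> f0 cf x; apply: cvgV; [exact: f0|exact: cf]. Qed.

Lemma rcont_norm f : continuous f -> continuous (fun x => `|f x|).
Proof. by move=> cf x; apply: cvg_norm; exact: cf. Qed.

Lemma rcont_min f g : continuous f -> continuous g ->
  continuous (fun x => Num.min (f x) (g x)).
Proof. by move=> cf cg x; apply: continuous_min; [exact: cf|exact: cg]. Qed.

Lemma rcont_max f g : continuous f -> continuous g ->
  continuous (fun x => Num.max (f x) (g x)).
Proof. by move=> cf cg x; apply: continuous_max; [exact: cf|exact: cg]. Qed.

Lemma rcont_sqrt f : continuous f -> continuous (fun x => Num.sqrt (f x)).
Proof.
move=> cf x; apply: (@continuous_comp _ _ _ f (@Num.sqrt R)); first exact: cf.
exact: sqrt_continuous.
Qed.

Lemma rcont_asin f : (forall x, -1 < f x < 1) -> continuous f ->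
  continuous (fun x => asin (f x)).
Proof.
move=> hf cf x; apply: (@continuous_comp _ _ _ f (@asin R)); first exact: cf.
exact: continuous_asin.
Qed.

Lemma rcont_cos f : continuous f -> continuous (fun x => cos (f x)).
Proof.
move=> cf x; apply: (@continuous_comp _ _ _ f (@cos R)); first exact: cf.
exact: continuous_cos.
Qed.

Lemma rcont_sin f : continuous f -> continuous (fun x => sin (f x)).
Proof.
move=> cf x; apply: (@continuous_comp _ _ _ f (@sin R)); first exact: cf.
exact: continuous_sin.
Qed.

(** Off the zeros of [s] one branch is active on a whole neighbourhood; at a zero both branches tend
    to the same value, so whichever is selected nearby is close to it. Piecewise maps below are
    pasted in this way, with a sign function in place of a closed cover. *)
Lemma rcont_glue (s f g : T -> R) : continuous s -> continuous f -> continuous g ->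
  (forall x, s x = 0 -> f x = g x) ->
  continuous (fun x => if 0 <= s x then f x else g x).
Proof.
move=> cs cf cg fg x.
have [s0|s0|s0] := ltgtP (s x) 0.
- apply: (@cvg_trans _ (g y @[y --> x])).
    apply: near_eq_cvg.
    have : \forall y \near x, s y < 0 by apply: (cs x [set z | z < 0]); exact: lt_nbhsl.
    by apply: filterS => y; case: leP.
  by rewrite leNgt s0; exact: cg.
- apply: (@cvg_trans _ (f y @[y --> x])).
    apply: near_eq_cvg.
    have : \forall y \near x, 0 < s y by apply: (cs x [set z | 0 < z]); exact: lt_nbhsr.
    by apply: filterS => y; case: ltgtP.
  by rewrite ltW //; exact: cf.
rewrite /=; apply/cvgrPdist_lt => e e0.
have := cf x => /cvgrPdist_lt /(_ e e0).
have := cg x => /cvgrPdist_lt /(_ e e0).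
by apply: filterS2 => y h1 h2; case: (0 <= s x); case: (0 <= s y) => //;
  rewrite ?(fg x) // -(fg x).
Qed.

Lemma cont_pair (U V : topologicalType) (f : T -> U) (g : T -> V) :
  continuous f -> continuous g -> continuous (fun x => (f x, g x)).
Proof. by move=> cf cg x; apply: cvg_pair; [exact: cf|exact: cg]. Qed.

Lemma cont_comp (U V : topologicalType) (f : T -> U) (g : U -> V) :
  continuous g -> continuous f -> continuous (fun x => g (f x)).
Proof. by move=> cg cf x; apply: (@continuous_comp _ _ _ f g); [exact: cf|exact: cg]. Qed.

Lemma cont_fst (U V : topologicalType) : continuous (fun x : U * V => x.1).
Proof. by move=> x; exact: cvg_fst. Qed.

Lemma cont_snd (U V : topologicalType) : continuous (fun x : U * V => x.2).
Proof. by move=> x; exact: cvg_snd. Qed.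

End RealContinuity.

(** * Uniform continuity on a box *)

Section Heine.
Variable R : realType.

(** Compactness enters as near-covering, applied to the filter of small positive radii. Only [x] is
    confined to the box: [y] may lie outside it, as grid points next to the boundary do. *)
Lemma box_uniform_continuity (f : R * R -> R) (a b e : R) : continuous f -> 0 < e ->
  exists2 d, 0 < d & forall x y : R * R,
    a <= x.1 <= b -> a <= x.2 <= b ->
    `|x.1 - y.1| < d -> `|x.2 - y.2| < d -> `|f x - f y| < e.
Proof.
move=> cf e0.
have cK : compact (`[a, b]%classic `*` `[a, b]%classic : set (R * R)).
  by apply: compact_setX; exact: segment_compact.
move/compact_near_coveringP : cK => cK.
pose P (d : R) (x : R * R) := forall y : R * R,
    `|x.1 - y.1| < d -> `|x.2 - y.2| < d -> `|f x - f y| < e.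
have /(_ _)/= := cK R 0^'+ P _.
case.
  move=> x _.
  have e2 : 0 < e / 2 by rewrite divr_gt0.
  have /cvgrPdist_lt /(_ _ e2) := cf x.
  move=> /nbhs_ballP[r /= r0 hr].
  exists (ball x (r / 2), [set d | d < r / 2]).
    split; first by apply: nbhsx_ballx; rewrite divr_gt0.
    by apply: nbhs_right_lt; rewrite divr_gt0.
  move=> [x' d] [/= [b1 b2]] dr y /= h1 h2.
  have A : `|f x - f x'| < e / 2.
    apply: hr; split; apply: le_ball; [|exact: b1| |exact: b2]; lra.
  have B : `|f x - f y| < e / 2.
    apply: hr; rewrite /ball /= /prod_ball /= /ball /=.
    move: b1 b2; rewrite /ball /= => b1 b2.
    split; [rewrite -(subrKA x'.1)|rewrite -(subrKA x'.2)];
      apply: (le_lt_trans (ler_normD _ _)); lra.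
  rewrite -(subrKA (f x)) (le_lt_trans (ler_normD _ _)) //.
  by rewrite distrC; lra.
move=> d0 /= d0gt h.
exists (d0 / 2); first by rewrite divr_gt0.
move=> x y x1 x2 h1 h2.
apply: (h (d0 / 2)) => //=.
- by rewrite sub0r normrN ger0_norm; lra.
- by rewrite divr_gt0.
Qed.

End Heine.

(** * Continuity of complex and matrix-valued maps *)

Section ComplexContinuity.
Variables (R : realType).
Local Notation C := R[i].

(** Continuity is coordinatewise, in real and imaginary parts, to agree with [mat_cont_on]. *)
Definition ccont (T : topologicalType) (f : T -> C) :=
  continuous (fun x => complex.Re (f x)) /\ continuous (fun x => complex.Im (f x)).

Definition mcont (T : topologicalType) m n (F : T -> 'M[C]_(m, n)) :=
  forall i j, ccont (fun x => F x i j).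

Section Scalar.
Variable T : topologicalType.
Implicit Types f g : T -> C.

Lemma ccont_cst c : ccont (fun _ : T => c).
Proof. by split; apply: rcont_cst. Qed.

Lemma ccontD f g : ccont f -> ccont g -> ccont (fun x => f x + g x).
Proof.
move=> [f1 f2] [g1 g2]; split.
- by under eq_fun do rewrite raddfD; exact: rcontD.
- by under eq_fun do rewrite raddfD; exact: rcontD.
Qed.

Lemma Re_mulc (z w : C) : complex.Re (z * w) =
  complex.Re z * complex.Re w - complex.Im z * complex.Im w.
Proof. by case: z => a b; case: w. Qed.

Lemma Im_mulc (z w : C) : complex.Im (z * w) =
  complex.Re z * complex.Im w + complex.Im z * complex.Re w.
Proof. by case: z => a b; case: w. Qed.

Lemma Re_conj (z : C) : complex.Re z^* = complex.Re z.
Proof. by case: z. Qed.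

Lemma Im_conj (z : C) : complex.Im z^* = - complex.Im z.
Proof. by case: z. Qed.

Lemma ccontM f g : ccont f -> ccont g -> ccont (fun x => f x * g x).
Proof.
move=> [f1 f2] [g1 g2]; split.
- by under eq_fun do rewrite Re_mulc; apply: rcontB; exact: rcontM.
- by under eq_fun do rewrite Im_mulc; apply: rcontD; exact: rcontM.
Qed.

Lemma ccont_conj f : ccont f -> ccont (fun x => (f x)^*).
Proof.
move=> [f1 f2]; split.
- by under eq_fun do rewrite Re_conj.
- by under eq_fun do rewrite Im_conj; exact: rcontN.
Qed.

Lemma ccont_real (f : T -> R) : continuous f -> ccont (fun x => (f x)%:C).
Proof. by move=> cf; split => //=; exact: rcont_cst. Qed.

Lemma ccontN f : ccont f -> ccont (fun x => - f x).
Proof.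
move=> [f1 f2]; split.
- by under eq_fun do rewrite raddfN; exact: rcontN.
- by under eq_fun do rewrite raddfN; exact: rcontN.
Qed.

Definition nsq (z : C) : R := complex.Re z ^+ 2 + complex.Im z ^+ 2.

Lemma nsqE (z : C) : (nsq z)%:C = z * z^*.
Proof.
case: z => a b; apply/eqP; rewrite eq_complex /nsq /=.
by apply/andP; split; apply/eqP; ring.
Qed.

Lemma nsq_ge0 (z : C) : 0 <= nsq z.
Proof. by rewrite addr_ge0 // sqr_ge0. Qed.

Lemma nsq_eq0 (z : C) : (nsq z == 0) = (z == 0).
Proof.
case: z => a b; rewrite /nsq /= paddr_eq0 ?sqr_ge0 // !sqrf_eq0.
by rewrite eq_complex.
Qed.

Lemma cont_nsq f : ccont f -> continuous (fun x => nsq (f x)).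
Proof.
by move=> [f1 f2]; rewrite /nsq; apply: rcontD; under eq_fun do rewrite expr2;
  exact: rcontM.
Qed.

Lemma ccontV f : (forall x, f x != 0) -> ccont f -> ccont (fun x => (f x)^-1).
Proof.
move=> f0 cf.
have -> : (fun x => (f x)^-1) = (fun x => (f x)^* * ((nsq (f x))^-1)%:C).
  apply/funext => x; rewrite (fmorphV (real_complex R)) /= -/(real_complex R _) nsqE invfM mulrCA mulfV ?mulr1 //.
  by rewrite conjc_eq0.
apply: ccontM; first exact: ccont_conj.
apply: ccont_real; apply: rcontV; last exact: cont_nsq.
by move=> x; rewrite nsq_eq0.
Qed.

Lemma ccont_sum (I : Type) (r : seq I) (P : pred I) (F : I -> T -> C) :
  (forall i, ccont (F i)) -> ccont (fun x => \sum_(i <- r | P i) F i x).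
Proof.
move=> cF; elim: r => [|i r IH].
  by under eq_fun do rewrite big_nil; exact: ccont_cst.
under eq_fun do rewrite big_cons.
by case: (P i) => //; exact: ccontD.
Qed.

Lemma ccont_prod (I : Type) (r : seq I) (P : pred I) (F : I -> T -> C) :
  (forall i, ccont (F i)) -> ccont (fun x => \prod_(i <- r | P i) F i x).
Proof.
move=> cF; elim: r => [|i r IH].
  by under eq_fun do rewrite big_nil; exact: ccont_cst.
under eq_fun do rewrite big_cons.
by case: (P i) => //; exact: ccontM.
Qed.

Lemma ccont_glue (s : T -> R) f g : continuous s -> ccont f -> ccont g ->
  (forall x, s x = 0 -> f x = g x) ->
  ccont (fun x => if 0 <= s x then f x else g x).
Proof.
move=> cs [f1 f2] [g1 g2] fg; split.
- rewrite (_ : (fun _ => _) = fun x => if 0 <= s x then complex.Re (f x) else complex.Re (g x)).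
    by apply: rcont_glue => // x /fg ->.
  by apply/funext => x; case: ifP.
- rewrite (_ : (fun _ => _) = fun x => if 0 <= s x then complex.Im (f x) else complex.Im (g x)).
    by apply: rcont_glue => // x /fg ->.
  by apply/funext => x; case: ifP.
Qed.

Lemma ccont_comp (U : topologicalType) (h : U -> T) f :
  ccont f -> continuous h -> ccont (fun x => f (h x)).
Proof.
move=> [f1 f2] ch; split.
- exact: (cont_comp f1 ch).
- exact: (cont_comp f2 ch).
Qed.

End Scalar.

Section Matrix.
Variable T : topologicalType.

Lemma mcont_cst m n (A : 'M[C]_(m, n)) : mcont (fun _ : T => A).
Proof. by move=> i j; exact: ccont_cst. Qed.

Lemma mcontD m n (F G : T -> 'M[C]_(m, n)) :
  mcont F -> mcont G -> mcont (fun x => F x + G x).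
Proof. by move=> cF cG i j; under eq_fun do rewrite mxE; exact: ccontD. Qed.

Lemma mcontN m n (F : T -> 'M[C]_(m, n)) : mcont F -> mcont (fun x => - F x).
Proof. by move=> cF i j; under eq_fun do rewrite mxE; exact: ccontN. Qed.

Lemma mcontB m n (F G : T -> 'M[C]_(m, n)) :
  mcont F -> mcont G -> mcont (fun x => F x - G x).
Proof. by move=> cF cG; apply: mcontD => //; exact: mcontN. Qed.

Lemma mcontZ m n (a : T -> C) (F : T -> 'M[C]_(m, n)) :
  ccont a -> mcont F -> mcont (fun x => a x *: F x).
Proof. by move=> ca cF i j; under eq_fun do rewrite mxE; exact: ccontM. Qed.

Lemma mcontM m n p (F : T -> 'M[C]_(m, n)) (G : T -> 'M[C]_(n, p)) :
  mcont F -> mcont G -> mcont (fun x => F x *m G x).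
Proof.
move=> cF cG i j; under eq_fun do rewrite mxE.
by apply: ccont_sum => k; exact: ccontM.
Qed.

Lemma mcont_tr m n (F : T -> 'M[C]_(m, n)) : mcont F -> mcont (fun x => (F x)^T).
Proof. by move=> cF i j; under eq_fun do rewrite mxE; exact: cF. Qed.

Lemma ccont_det n (F : T -> 'M[C]_n) : mcont F -> ccont (fun x => \det (F x)).
Proof.
move=> cF; rewrite /determinant; apply: ccont_sum => s.
by apply: ccontM; [exact: ccont_cst|apply: ccont_prod => i; exact: cF].
Qed.

Lemma mcont_adjugate n (F : T -> 'M[C]_n) : mcont F -> mcont (fun x => \adj (F x)).
Proof.
move=> cF i j; under eq_fun do rewrite mxE /cofactor.
apply: ccontM; first exact: ccont_cst.
by apply: ccont_det => k l; under eq_fun do rewrite !mxE; exact: cF.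
Qed.

Lemma mcontV n (F : T -> 'M[C]_n) : (forall x, \det (F x) != 0) ->
  mcont F -> mcont (fun x => invmx (F x)).
Proof.
move=> F0 cF.
have -> : (fun x => invmx (F x)) = (fun x => (\det (F x))^-1 *: \adj (F x)).
  by apply/funext => x; rewrite /invmx unitmxE unitfE F0.
by apply: mcontZ; [apply: ccontV => //; exact: ccont_det|exact: mcont_adjugate].
Qed.

Lemma mcont_glue m n (s : T -> R) (F G : T -> 'M[C]_(m, n)) :
  continuous s -> mcont F -> mcont G -> (forall x, s x = 0 -> F x = G x) ->
  mcont (fun x => if 0 <= s x then F x else G x).
Proof.
move=> cs cF cG FG i j.
rewrite (_ : (fun _ => _) = fun x => if 0 <= s x then F x i j else G x i j).
  by apply: ccont_glue => // x /FG ->.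
by apply/funext => x; case: ifP.
Qed.

Lemma mcont_comp (U : topologicalType) m n (h : U -> T) (F : T -> 'M[C]_(m, n)) :
  mcont F -> continuous h -> mcont (fun x => F (h x)).
Proof. by move=> cF ch i j; exact: (ccont_comp (cF i j) ch). Qed.

End Matrix.
End ComplexContinuity.

(** * The unit circle: phases, logarithms, winding *)

Section Circle.
Variable R : realType.
Local Notation C := R[i].
Implicit Types (z w : C) (t : R).

Definition cis (t : R) : C := cos t +i* sin t.

Lemma cis0 : cis 0 = 1.
Proof. by rewrite /cis cos0 sin0. Qed.

Lemma cisD (a b : R) : cis (a + b) = cis a * cis b.
Proof.
rewrite /cis cosD sinD; apply/eqP; rewrite eq_complex /=.
by apply/andP; split; apply/eqP => //; ring.
Qed.

Lemma cisN (a : R) : cis (- a) = (cis a)^*.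
Proof. by rewrite /cis cosN sinN. Qed.

Lemma nsq_cis t : nsq (cis t) = 1.
Proof. by rewrite /nsq /= cos2Dsin2. Qed.

Lemma conj_inv_unit z : nsq z = 1 -> z * z^* = 1.
Proof. by rewrite -nsqE => ->. Qed.

Lemma cis_conj t : cis t * (cis t)^* = 1.
Proof. by rewrite conj_inv_unit // nsq_cis. Qed.

Lemma nsqM z w : nsq (z * w) = nsq z * nsq w.
Proof. by case: z w => [a b] [c d]; rewrite /nsq /=; ring. Qed.

Lemma nsq_conj z : nsq z^* = nsq z.
Proof. by case: z => a b; rewrite /nsq /= sqrrN. Qed.

Lemma cisMn (a : R) n : cis (a *+ n) = cis a ^+ n.
Proof. by elim: n => [|n IH]; rewrite ?mulr0n ?cis0 // mulrS cisD IH exprS. Qed.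

Lemma cis_int (n : int) : cis ((pi *+ 2) * n%:~R) = 1.
Proof.
have P (k : nat) : cis ((pi *+ 2) * k%:R) = 1.
  by rewrite mulr_natr cisMn /cis cos2pi sin2pi expr1n.
case: n => n; first exact: P.
by rewrite NegzE rmorphN mulrN cisN P rmorph1.
Qed.

Lemma cis_eq1 t : cis t = 1 -> exists n : int, t = (pi *+ 2) * n%:~R.
Proof.
move=> ct.
have p0 : 0 < pi *+ 2 :> R by rewrite pmulrn_lgt0 // pi_gt0.
exists (Num.floor (t / (pi *+ 2))).
set n := Num.floor _.
have /andP[l1 l2] := floor_itv (t / (pi *+ 2)).
rewrite -/n in l1 l2.
set u := t - (pi *+ 2) * n%:~R.
have u0 : 0 <= u by rewrite subr_ge0 mulrC -ler_pdivlMr.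
have u1 : u < pi *+ 2.
  by move: l2; rewrite intrD mulr1z ltr_pdivrMr // mulrDl mul1r mulrC /u; lra.
have cu : cis u = 1 by rewrite /u cisD cisN ct cis_int rmorph1 mulr1.
have cosu : cos u = 1 by case: cu.
suff : u = 0 by rewrite /u; lra.
have pg := pi_gt0 R.
have [up|up] := leP u pi.
  apply: cos_inj; [by rewrite in_itv /= u0 up|by rewrite in_itv /= lexx ltW|].
  by rewrite cos0.
have : pi *+ 2 - u = 0.
  apply: cos_inj; [|by rewrite in_itv /= lexx ltW|].
    by rewrite in_itv /=; apply/andP; split; lra.
  by rewrite addrC cosD2pi cosN cosu cos0.
lra.
Qed.

Lemma ccont_cis (T : topologicalType) (f : T -> R) : continuous f ->
  ccont (fun x => cis (f x)).
Proof. by move=> cf; split => /=; [exact: rcont_cos|exact: rcont_sin]. Qed.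

Lemma nsq1_Re_bound z : nsq z = 1 -> -1 <= complex.Re z <= 1.
Proof. rewrite /nsq => h; apply/andP; split; nra. Qed.

Lemma nsq1_Im_bound z : nsq z = 1 -> 0 < complex.Re z -> -1 < complex.Im z < 1.
Proof. rewrite /nsq => h h0; apply/andP; split; nra. Qed.

(** An inverse of [cis] on the open right half plane only, where the argument lies in (- pi / 2, pi
    / 2) and the arcsine is continuous. *)
Definition arg z : R := asin (complex.Im z).

Lemma cis_arg z : nsq z = 1 -> 0 < complex.Re z -> cis (arg z) = z.
Proof.
move=> h h0; have /andP[b1 b2] := nsq1_Im_bound h h0.
case: z h h0 b1 b2 => a b; rewrite /nsq /cis /arg /= => h h0 b1 b2.
rewrite asinK ?in_itv /= ?ltW // cos_asin ?ltW //.
by rewrite -h addrK sqrtr_sqr gtr0_norm.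
Qed.

Lemma cont_arg (T : topologicalType) (f : T -> C) : ccont f ->
  (forall x, nsq (f x) = 1) -> (forall x, 0 < complex.Re (f x)) ->
  continuous (fun x => arg (f x)).
Proof.
move=> [_ cf] f1 f0; apply: rcont_asin => // x.
exact: nsq1_Im_bound.
Qed.

Lemma cis_surj z : nsq z = 1 -> exists t, cis t = z.
Proof.
move=> h; have b := nsq1_Re_bound h.
case: z h b => a b; rewrite /nsq /cis /= => h ab.
have [b0|b0] := leP 0 b.
  by exists (acos a); rewrite acosK ?in_itv //= sin_acos // -h addrC addKr sqrtr_sqr ger0_norm.
exists (- acos a); rewrite cosN sinN acosK ?in_itv //= sin_acos // -h addrC addKr.
by rewrite sqrtr_sqr ltr0_norm // opprK.
Qed.

(** Retraction of the line onto [a, b] when a <= b. Precomposing with it turns data known on an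
    interval into maps on the whole line, so that homotopies can be parametrised by all of R. *)
Definition clamp (a b x : R) : R := Num.max a (Num.min b x).

Lemma clamp_id (a b x : R) : a <= x <= b -> clamp a b x = x.
Proof. by move=> /andP[h1 h2]; rewrite /clamp min_r // max_r. Qed.

Lemma clamp_itv (a b x : R) : a <= b -> a <= clamp a b x <= b.
Proof.
move=> ab; rewrite /clamp le_max lexx /= ge_max ab /=.
by rewrite ge_min lexx.
Qed.

Lemma cont_clamp (T : topologicalType) (a b : R) (f : T -> R) : continuous f ->
  continuous (fun x => clamp a b (f x)).
Proof.
by move=> cf; apply: rcont_max; [exact: rcont_cst|apply: rcont_min => //; exact: rcont_cst].
Qed.

Lemma Re_close_gt0 z w : nsq z = 1 -> nsq w = 1 ->
  `|complex.Re z - complex.Re w| < 1/2 -> `|complex.Im z - complex.Im w| < 1/2 ->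
  0 < complex.Re (z * w^*).
Proof.
case: z w => [a b] [c d]; rewrite /nsq /= => h1 h2.
rewrite !ltr_norml => /andP[h3 h4] /andP[h5 h6]; nra.
Qed.

Lemma inv_natS_lt (d : R) : 0 < d -> exists N : nat, (N.+1%:R)^-1 < d.
Proof.
move=> d0; exists (Num.truncn d^-1).
rewrite -[ltRHS]invrK ltf_pV2 ?posrE ?invr_gt0 ?ltr0n //.
exact: truncnS_gt.
Qed.

(* [f] is written as a telescoping product of quotients, along the segment from the origin,
   each of which stays in the right half plane. *)
Lemma circle_lift (f : R * R -> C) : ccont f -> (forall x, nsq (f x) = 1) ->
  exists phi : R * R -> R, continuous phi /\
    forall x, -1 <= x.1 <= 1 -> -1 <= x.2 <= 1 -> cis (phi x) = f x.
Proof.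
move=> cf f1.
have h2 : 0 < 1 / 2 :> R by rewrite divr_gt0.
have [d1 d10 hd1] := box_uniform_continuity (-1) 1 cf.1 h2.
have [d2 d20 hd2] := box_uniform_continuity (-1) 1 cf.2 h2.
have [N hN] : exists N : nat, (N.+1%:R)^-1 < Num.min d1 d2.
  by apply: inv_natS_lt; rewrite lt_min d10.
rewrite lt_min in hN; case/andP : hN => hN1 hN2.
set K : R := N.+1%:R.
have K0 : 0 < K by rewrite ltr0n.
pose p (i : nat) (x : R * R) : R * R :=
  (i%:R / K * clamp (-1) 1 x.1, i%:R / K * clamp (-1) 1 x.2).
have cp i : continuous (p i).
  apply: cont_pair; apply: rcontM; try exact: rcont_cst; apply: cont_clamp.
    exact: cont_fst.
  exact: cont_snd.
have m1 : (-1 : R) <= 1 by lra.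
pose q i x := f (p i.+1 x) * (f (p i x))^*.
have q1 i x : nsq (q i x) = 1 by rewrite /q nsqM nsq_conj !f1 mulr1.
have qgt0 (i : nat) (x : R * R) : (i <= N)%N -> 0 < complex.Re (q i x).
  move=> iN.
  have bx1 := clamp_itv x.1 m1; have bx2 := clamp_itv x.2 m1.
  have iK : 0 <= (i.+1%:R : R) / K <= 1.
    apply/andP; split; first by rewrite divr_ge0 // ltW.
    by rewrite ler_pdivrMr // mul1r ler_nat ltnS.
  have box c : -1 <= c <= 1 -> -1 <= i.+1%:R / K * c <= 1.
    move: iK; set u := _ / K => /andP[? ?] /andP[? ?]; apply/andP; split; nra.
  have diff (c d : R) : -1 <= c <= 1 -> K^-1 < d ->
      `|i.+1%:R / K * c - i%:R / K * c| < d.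
    move=> /andP[c1 c2] Kd; rewrite -mulrBl -mulrBl -natrB // subSnn mul1r.
    rewrite normrM gtr0_norm ?invr_gt0 //.
    have : `|c| <= 1 by rewrite ler_norml c1.
    have : 0 < K^-1 by rewrite invr_gt0.
    move: (normr_ge0 c) Kd; move: (K^-1) (`|c|) => u v; nra.
  apply: Re_close_gt0 => //.
    by apply: hd1; [exact: box|exact: box|exact: diff|exact: diff].
  by apply: hd2; [exact: box|exact: box|exact: diff|exact: diff].
have [t0 ht0] := cis_surj (f1 (0, 0)).
pose phi x := t0 + \sum_(i < N.+1) arg (q i x).
have cphi : continuous phi.
  rewrite /phi; apply: rcontD; first exact: rcont_cst.
  have : forall n, (n <= N.+1)%N -> continuous (fun x => \sum_(i < n) arg (q i x)).
    elim=> [|n IH] nN.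
      by under eq_fun do rewrite big_ord0; exact: rcont_cst.
    under eq_fun do rewrite big_ord_recr /=.
    apply: rcontD; first by apply: IH; exact: ltnW.
    apply: cont_arg => //.
      by apply: ccontM; [exact: ccont_comp|apply: ccont_conj; exact: ccont_comp].
    by move=> x; exact: qgt0.
  exact.
exists phi; split=> // x b1 b2.
have tel : forall n, (n <= N.+1)%N -> cis (t0 + \sum_(i < n) arg (q i x)) = f (p n x).
  elim=> [|n IH] nN.
    by rewrite big_ord0 addr0 ht0 /p !mul0r.
  rewrite big_ord_recr /= addrA cisD (IH (ltnW nN)) (cis_arg (q1 n x) (qgt0 n x nN)).
  by rewrite /q mulrCA (conj_inv_unit (f1 _)) mulr1.
rewrite /phi (tel _ (leqnn _)) /p divff ?gt_eqF //.
by rewrite !mul1r (clamp_id b1) (clamp_id b2) -surjective_pairing.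
Qed.

(** Both end values are multiples of 2 pi. If they differ, they are at least 2 pi apart, so the
    intermediate value theorem yields a point where the function is the smaller one plus pi, and
    there [cis] is -1. *)
Lemma cis_locally_constant (f : R -> R) (a b : R) : a <= b -> continuous f ->
  (forall t, a <= t <= b -> cis (f t) = 1) -> f a = f b.
Proof.
move=> ab cf f1.
have [n fa] : exists n : int, f a = (pi *+ 2) * n%:~R.
  by apply: cis_eq1; rewrite f1 ?lexx.
have [k fb] : exists k : int, f b = (pi *+ 2) * k%:~R.
  by apply: cis_eq1; rewrite f1 ?lexx ?ab.
have pg := pi_gt0 R.
have cfw : {within `[a, b], continuous f} by apply: continuous_subspaceT.
pose v : R := (Num.min (f a) (f b)) + pi.
have vcis : cis v = -1.
  have -> : cis v = cis pi.
    rewrite /v /Num.min cisD; case: ifP => _; rewrite (f1 _) ?mul1r ?lexx ?ab //.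
  by rewrite /cis cospi sinpi; apply/eqP; rewrite eq_complex /= oppr0 !eqxx.
have [//|fab] := eqVneq (f a) (f b).
have vle : v <= Num.max (f a) (f b).
  move: fab; rewrite /v fa fb.
  have I (p q : int) : (p < q)%R -> pi *+ 2 * p%:~R + pi <= (pi *+ 2 * q%:~R : R).
    by rewrite -lezD1 -(ler_int R) intrD mulr1z mulr2n; nra.
  have [->|] := eqVneq n k; first by rewrite eqxx.
  rewrite neq_lt => /orP[/I h|/I h] _.
    by rewrite min_l ?max_r //; lra.
  by rewrite min_r ?max_l //; lra.
have : Num.min (f a) (f b) <= v <= Num.max (f a) (f b).
  by rewrite vle andbT /v; lra.
move=> /(IVT ab cfw)[c]; rewrite in_itv /= => /f1 + fc.
rewrite fc vcis => /eqP; rewrite eq_complex /= => /andP[/eqP h _]; lra.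
Qed.

End Circle.

(** * Unitary matrices, hermitian products and reflections *)

Section Unitary.
Variable R : realType.
Local Notation C := R[i].

Definition dag m n (A : 'M[C]_(m, n)) : 'M[C]_(n, m) := map_mx conjc A^T.

Lemma dagE m n (A : 'M[C]_(m, n)) i j : dag A i j = (A j i)^*.
Proof. by rewrite !mxE. Qed.

Lemma dagK m n (A : 'M[C]_(m, n)) : dag (dag A) = A.
Proof. by apply/matrixP => i j; rewrite !dagE conjcK. Qed.

Lemma dagM m n p (A : 'M[C]_(m, n)) (B : 'M[C]_(n, p)) : dag (A *m B) = dag B *m dag A.
Proof. by rewrite /dag trmx_mul map_mxM. Qed.

Lemma dagD m n (A B : 'M[C]_(m, n)) : dag (A + B) = dag A + dag B.
Proof. by rewrite /dag linearD map_mxD. Qed.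

Lemma dagN m n (A : 'M[C]_(m, n)) : dag (- A) = - dag A.
Proof. by rewrite /dag linearN map_mxN. Qed.

Lemma dagB m n (A B : 'M[C]_(m, n)) : dag (A - B) = dag A - dag B.
Proof. by rewrite dagD dagN. Qed.

Lemma dagZ m n a (A : 'M[C]_(m, n)) : dag (a *: A) = a^* *: dag A.
Proof. by rewrite /dag linearZ map_mxZ. Qed.

Lemma dag_scalar n a : dag (a%:M : 'M[C]_n) = (a^*)%:M.
Proof. by rewrite /dag tr_scalar_mx map_scalar_mx. Qed.

Lemma dag1 n : dag (1%:M : 'M[C]_n) = 1%:M.
Proof. by rewrite dag_scalar rmorph1. Qed.

Lemma det_dag n (A : 'M[C]_n) : \det (dag A) = (\det A)^*.
Proof. by rewrite /dag det_map_mx det_tr. Qed.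

Lemma mcont_dag (T : topologicalType) m n (F : T -> 'M[C]_(m, n)) :
  mcont F -> mcont (fun x => dag (F x)).
Proof. by move=> cF i j; under eq_fun do rewrite dagE; exact: ccont_conj. Qed.

Definition unitary_mx n (A : 'M[C]_n) := dag A *m A = 1%:M.

Lemma unitaryC n (A : 'M[C]_n) : unitary_mx A -> A *m dag A = 1%:M.
Proof. exact: mulmx1C. Qed.

Lemma unitary1 n : unitary_mx (1%:M : 'M[C]_n).
Proof. by rewrite /unitary_mx dag1 mulmx1. Qed.

Lemma unitaryM n (A B : 'M[C]_n) : unitary_mx A -> unitary_mx B -> unitary_mx (A *m B).
Proof.
by move=> hA hB; rewrite /unitary_mx dagM mulmxA -(mulmxA (dag B)) hA mulmx1.
Qed.

Lemma unitary_dag n (A : 'M[C]_n) : unitary_mx A -> unitary_mx (dag A).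
Proof. by move=> hA; rewrite /unitary_mx dagK unitaryC. Qed.

Lemma unitaryZ n (A : 'M[C]_n) a : nsq a = 1 -> unitary_mx A -> unitary_mx (a *: A).
Proof.
move=> ha hA; rewrite /unitary_mx dagZ -scalemxAl -scalemxAr hA scalerA.
by rewrite mulrC conj_inv_unit // scale1r.
Qed.

Lemma unitary_det n (A : 'M[C]_n) : unitary_mx A -> nsq (\det A) = 1.
Proof.
move=> hA; apply: complexI; rewrite nsqE -det_dag -det_mulmx unitaryC //.
by rewrite det1.
Qed.

Definition SU n (A : 'M[C]_n) := unitary_mx A /\ \det A = 1.

Lemma SU1 n : SU (1%:M : 'M[C]_n).
Proof. by split; [exact: unitary1|exact: det1]. Qed.

Lemma SUM n (A B : 'M[C]_n) : SU A -> SU B -> SU (A *m B).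
Proof.
by move=> [uA dA] [uB dB]; split; [exact: unitaryM|rewrite det_mulmx dA dB mulr1].
Qed.

Lemma SU_dag n (A : 'M[C]_n) : SU A -> SU (dag A).
Proof.
by move=> [uA dA]; split; [exact: unitary_dag|rewrite det_dag dA rmorph1].
Qed.

Definition ip n (u v : 'cV[C]_n) : C := (dag u *m v) 0 0.

Lemma ip_mx n (u v : 'cV[C]_n) : dag u *m v = (ip u v)%:M.
Proof. exact: mx11_scalar. Qed.

Lemma ipC n (u v : 'cV[C]_n) : ip u v = (ip v u)^*.
Proof. by rewrite /ip -dagE dagM dagK. Qed.

Lemma ccont_ip (T : topologicalType) n (u v : T -> 'cV[C]_n) :
  mcont u -> mcont v -> ccont (fun x => ip (u x) (v x)).
Proof. by move=> cu cv; apply: mcontM => //; exact: mcont_dag. Qed.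

Definition sqn n (u : 'cV[C]_n) : R := \sum_i nsq (u i 0).

Lemma sqnE n (u : 'cV[C]_n) : (sqn u)%:C = ip u u.
Proof.
rewrite /sqn (raddf_sum (real_complex R)) /ip !mxE; apply: eq_bigr => i _.
by rewrite dagE mulrC -nsqE.
Qed.

Lemma sqn_ge0 n (u : 'cV[C]_n) : 0 <= sqn u.
Proof. by apply: sumr_ge0 => i _; exact: nsq_ge0. Qed.

Lemma sqn_eq0 n (u : 'cV[C]_n) : (sqn u == 0) = (u == 0).
Proof.
apply/idP/eqP => [|->]; last first.
  by rewrite /sqn big1 // => i _; rewrite mxE /nsq /= expr0n /= addr0.
rewrite psumr_eq0; last by move=> i _; exact: nsq_ge0.
move=> /allP h; apply/colP => i; rewrite mxE.
by apply/eqP; rewrite -nsq_eq0; apply: (implyP (h i (mem_index_enum i))).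
Qed.

Lemma cont_sqn (T : topologicalType) n (u : T -> 'cV[C]_n) :
  mcont u -> continuous (fun x => sqn (u x)).
Proof.
move=> cu; have [cr _] := ccont_ip cu cu; move: cr.
by under eq_fun do rewrite -sqnE.
Qed.

Definition normalize n (u : 'cV[C]_n) : 'cV[C]_n := ((Num.sqrt (sqn u))^-1)%:C *: u.

Lemma ipZ n a b (u v : 'cV[C]_n) : ip (a *: u) (b *: v) = a^* * b * ip u v.
Proof. by rewrite /ip dagZ -scalemxAl -scalemxAr scalerA !mxE. Qed.

Lemma ip_normalize n (u : 'cV[C]_n) : u != 0 -> ip (normalize u) (normalize u) = 1.
Proof.
rewrite -sqn_eq0 => u0; rewrite ipZ -sqnE conjc_real -!(rmorphM (real_complex R)) /=.
by rewrite -invfM -expr2 sqr_sqrtr ?sqn_ge0 // mulVf.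
Qed.

Lemma sqrt_sqn_gt0 n (u : 'cV[C]_n) : u != 0 -> 0 < (Num.sqrt (sqn u))^-1.
Proof. by rewrite -sqn_eq0 => u0; rewrite invr_gt0 sqrtr_gt0 lt_neqAle eq_sym u0 sqn_ge0. Qed.

Lemma mcont_normalize (T : topologicalType) n (u : T -> 'cV[C]_n) :
  (forall x, u x != 0) -> mcont u -> mcont (fun x => normalize (u x)).
Proof.
move=> u0 cu; apply: mcontZ => //; apply: ccont_real; apply: rcontV.
  by move=> x; rewrite gt_eqF // -invr_gt0 sqrt_sqn_gt0.
by apply: rcont_sqrt; exact: cont_sqn.
Qed.

(** A complex reflection along [u], which need not be a unit vector. The coefficient [k] may be
    non-real, which allows a vector to be sent to another one whose hermitian product with it is not
    real. *)
Definition refl n (k : C) (u : 'cV[C]_n) : 'M[C]_n := 1%:M - k *: (u *m dag u).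

Lemma refl_unitary n k (u : 'cV[C]_n) : k + k^* = k * k^* * ip u u -> unitary_mx (refl k u).
Proof.
move=> hk; rewrite /unitary_mx /refl.
have dP : dag (u *m dag u) = u *m dag u by rewrite dagM dagK.
have PP : (u *m dag u) *m (u *m dag u) = ip u u *: (u *m dag u).
  by rewrite mulmxA -(mulmxA u) ip_mx mul_mx_scalar -scalemxAl.
move: dP PP hk; move: (u *m dag u) (ip u u) => P c dP PP hk.
rewrite dagB dag1 dagZ dP mulmxBl mul1mx mulmxBr mulmx1 -scalemxAl -scalemxAr PP !scalerA.
have -> : k^* * k * c = k + k^* by rewrite hk; ring.
rewrite scalerDl; apply/matrixP => i j; rewrite !mxE; ring.
Qed.

Lemma refl_apply n k (u v : 'cV[C]_n) : refl k u *m v = v - (k * ip u v) *: u.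
Proof.
by rewrite /refl mulmxBl mul1mx -scalemxAl -mulmxA ip_mx mul_mx_scalar scalerA.
Qed.

(* The product of the complex reflections sending [a] to [- b] and [- b] to [b]; it is
   continuous in [a] and [b] as long as they are not antipodal, and trivial for [a = b]. *)
Definition rotmx n (a b : 'cV[C]_n) : 'M[C]_n :=
  refl 2 b *m refl (1 + ip b a)^-1 (a + b).

Lemma ipDl n (u v w : 'cV[C]_n) : ip (u + v) w = ip u w + ip v w.
Proof. by rewrite /ip dagD mulmxDl mxE. Qed.

Lemma ipDr n (u v w : 'cV[C]_n) : ip u (v + w) = ip u v + ip u w.
Proof. by rewrite /ip mulmxDr mxE. Qed.

Lemma ip_sym_neq0 n (a b : 'cV[C]_n) : (1 + ip a b == 0) = (1 + ip b a == 0).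
Proof. by rewrite -[RHS]conjc_eq0 (rmorphD conjc) rmorph1 /= -ipC. Qed.

(** With z = <b, a>, the vector a + b has square norm 2 + z + z^*, which is exactly the value that
    makes k = 1 / (1 + z) admissible for [refl_unitary]. *)
Lemma rot_unitary n (a b : 'cV[C]_n) : ip a a = 1 -> ip b b = 1 -> 1 + ip b a != 0 ->
  unitary_mx (rotmx a b).
Proof.
move=> ha hb hab; apply: unitaryM; apply: refl_unitary.
  by rewrite hb rmorph_nat; ring.
have hba : 1 + ip a b != 0 by rewrite ip_sym_neq0.
rewrite (fmorphV conjc) (rmorphD conjc) rmorph1 /= -ipC ipDl !ipDr ha hb.
by field; rewrite hab hba.
Qed.

Lemma rot_apply n (a b : 'cV[C]_n) : ip a a = 1 -> ip b b = 1 -> 1 + ip b a != 0 ->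
  rotmx a b *m a = b.
Proof.
move=> ha hb hab; rewrite /rotmx -mulmxA [refl (1 + _)^-1 _ *m _]refl_apply ipDl ha mulVf // scale1r.
rewrite opprD addNKr refl_apply.
have -> : ip b (- b) = -1 by rewrite -scaleN1r -[b in ip b _]scale1r ipZ hb rmorph1 mul1r mulr1.
by rewrite mulrN1 scaleNr opprK mulr2n scalerDl scale1r addKr.
Qed.

Lemma rot_id n (a : 'cV[C]_n) : ip a a = 1 -> rotmx a a = 1%:M.
Proof.
move=> ha; rewrite /rotmx ha.
have -> : refl (1 + 1)^-1 (a + a) = refl 2 a.
  have -> : a + a = (2 : C) *: a by rewrite scaler_nat mulr2n.
  rewrite /refl dagZ (rmorph_nat conjc) -scalemxAl -scalemxAr !scalerA.
  have -> : ((1 + 1)^-1 * 2 * 2%:R : C) = 2 by field.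
  by [].
rewrite /refl.
have PP : (a *m dag a) *m (a *m dag a) = a *m dag a.
  by rewrite mulmxA -(mulmxA a) ip_mx mul_mx_scalar ha scale1r.
move: PP; move: (a *m dag a) => P PP.
rewrite mulmxBl mul1mx mulmxBr mulmx1 -scalemxAl -scalemxAr PP !scalerA.
by apply/matrixP => i j; rewrite !mxE; ring.
Qed.

Lemma mcont_refl (T : topologicalType) n (k : T -> C) (u : T -> 'cV[C]_n) :
  ccont k -> mcont u -> mcont (fun x => refl (k x) (u x)).
Proof.
move=> ck cu; apply: mcontB; first exact: mcont_cst.
by apply: mcontZ => //; apply: mcontM => //; exact: mcont_dag.
Qed.

Lemma mcont_rot (T : topologicalType) n (a b : T -> 'cV[C]_n) :
  (forall x, 1 + ip (b x) (a x) != 0) -> mcont a -> mcont b ->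
  mcont (fun x => rotmx (a x) (b x)).
Proof.
move=> h ca cb; apply: mcontM; first by apply: mcont_refl => //; exact: ccont_cst.
apply: mcont_refl; last exact: mcontD.
by apply: ccontV => //; apply: ccontD; [exact: ccont_cst|exact: ccont_ip].
Qed.

(** The equality case of Cauchy-Schwarz: |a + b|^2 = (1 + <a, b>) + (1 + <b, a>) vanishes. *)
Lemma antipodal n (a b : 'cV[C]_n) : ip a a = 1 -> ip b b = 1 -> 1 + ip b a = 0 -> b = - a.
Proof.
move=> ha hb hab.
have hba : 1 + ip a b = 0.
  by apply/eqP; rewrite ip_sym_neq0 hab.
apply/eqP; rewrite -addr_eq0 -sqn_eq0; apply/eqP; apply: complexI.
rewrite sqnE ipDl !ipDr ha hb.
by rewrite hab add0r addrC hba.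
Qed.

End Unitary.

(** * General position: avoiding a ray by a piecewise linear approximation *)

Section GeneralPosition.
Variable R : realType.
Local Notation C := R[i].

Lemma box_uniform_mcont (a b : R) m n (F : R * R -> 'M[C]_(m, n)) e : mcont F -> 0 < e ->
  exists2 d, 0 < d & forall x y : R * R,
    a <= x.1 <= b -> a <= x.2 <= b ->
    `|x.1 - y.1| < d -> `|x.2 - y.2| < d -> forall i j,
    `|complex.Re (F x i j) - complex.Re (F y i j)| < e /\
    `|complex.Im (F x i j) - complex.Im (F y i j)| < e.
Proof.
move=> cF e0.
pose Q i j (d : R) := forall x y : R * R,
    a <= x.1 <= b -> a <= x.2 <= b ->
    `|x.1 - y.1| < d -> `|x.2 - y.2| < d ->
    `|complex.Re (F x i j) - complex.Re (F y i j)| < e /\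
    `|complex.Im (F x i j) - complex.Im (F y i j)| < e.
have q i j : \forall d \near 0^'+, Q i j d.
  have [d1 d10 h1] := box_uniform_continuity a b (cF i j).1 e0.
  have [d2 d20 h2] := box_uniform_continuity a b (cF i j).2 e0.
  have m0 : 0 < Num.min d1 d2 by rewrite lt_min d10.
  apply: filterS (nbhs_right_lt m0) => d; rewrite lt_min => /andP[l1 l2] x y b1 b2 c1 c2.
  split; [apply: (h1 x y b1 b2 (lt_trans c1 l1) (lt_trans c2 l1))|
          exact: (h2 x y b1 b2 (lt_trans c1 l2) (lt_trans c2 l2))].
have q' : \forall d \near 0^'+, forall i j, Q i j d.
  by apply: filter_forall => i; apply: filter_forall => j; exact: q.
have q0 : \forall d \near 0^'+, 0 < d :> R by exact: nbhs_right_gt.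
have /filter_ex[d [d0 hd]] : \forall d \near 0^'+, 0 < d /\ forall i j, Q i j d.
  by apply: filterS2 q0 q' => d.
by exists d => // x y b1 b2 c1 c2 i j; exact: hd.
Qed.

(** Otherwise there would be more roots than the degree allows. It serves twice: for a parameter of
    the moment curve and for a phase off the spectrum of a matrix. *)
Lemma nonroot (F : idomainType) (p : {poly F}) (f : nat -> F) :
  injective f -> p != 0 -> exists s, ~~ root p (f s).
Proof.
move=> fI p0; apply: contrapT => h.
have := @max_poly_roots _ p [seq f s | s <- iota 0 (size p)] p0.
rewrite size_map size_iota ltnn map_inj_uniq // iota_uniq.
suff -> : all (root p) [seq f s | s <- iota 0 (size p)] by move=> /(_ isT isT).
apply/allP => _ /mapP[s _ ->]; apply: contrapT => /negP hs; apply: h.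
by exists s.
Qed.

Lemma annihilator (A : 'M[R]_(4, 3)) : exists2 l : 'rV[R]_4, l != 0 & l *m A = 0.
Proof.
exists (nz_row (kermx A)); last by apply/sub_kermxP; exact: nz_row_sub.
rewrite nz_row_eq0 -mxrank_eq0 mxrank_ker subn_eq0 -ltnNge ltnS.
exact: rank_leq_col.
Qed.

(** The four real coordinates of the first two complex entries, which exist because the dimension is
    at least 2. *)
Definition rcoord n (u : 'cV[C]_n.+2) (k : 'I_4) : R :=
  let z := u (inord k./2) 0 in if odd k then complex.Im z else complex.Re z.

(** The point (1, s, s^2, s^3) of R^4 = C^2. Its first entry has real part 1, so it can be joined to
    the first basis vector without meeting 0. *)
Definition moment n (s : R) : 'cV[C]_n.+2 :=
  \col_i (if i == 0 :> nat then 1 +i* s else if i == 1 :> nat then (s ^+ 2) +i* (s ^+ 3) else 0).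

Lemma rcoord_moment n s (k : 'I_4) : rcoord (moment n s) k = s ^+ k.
Proof.
have k2 : (k./2 < n.+2)%N by case: k => [[|[|[|[|]]]]].
rewrite /rcoord mxE inordK //.
by case: k {k2} => [[|[|[|[|]]]]] //= _; rewrite ?expr0 ?expr1.
Qed.

Definition functional n (l : 'rV[R]_4) (u : 'cV[C]_n.+2) : R :=
  \sum_k l 0 k * rcoord u k.

Lemma rcoordD n (u v : 'cV[C]_n.+2) k : rcoord (u + v) k = rcoord u k + rcoord v k.
Proof. by rewrite /rcoord mxE; case: (u _ _) (v _ _) => [? ?] [? ?] /=; case: ifP. Qed.

Lemma rcoordZ n (a : R) (v : 'cV[C]_n.+2) k : rcoord (a%:C *: v) k = a * rcoord v k.
Proof.
rewrite /rcoord mxE; case: (v _ _) => [? ?] /=.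
by case: ifP => _; rewrite ?mul0r ?subr0 ?addr0.
Qed.

Lemma functionalD n l (u v : 'cV[C]_n.+2) :
  functional l (u + v) = functional l u + functional l v.
Proof.
by rewrite /functional -big_split /=; apply: eq_bigr => k _; rewrite rcoordD mulrDr.
Qed.

Lemma functionalZ n l a (v : 'cV[C]_n.+2) : functional l (a%:C *: v) = a * functional l v.
Proof.
by rewrite /functional mulr_sumr; apply: eq_bigr => k _; rewrite rcoordZ mulrCA.
Qed.

Lemma functional0 n l : functional l (0 : 'cV[C]_n.+2) = 0.
Proof. by rewrite -(scale0r 0) -[0 : C]/(0%:C) functionalZ mul0r. Qed.

Lemma functional_moment n l s : functional l (moment n s) = (rVpoly l).[s].
Proof.
rewrite (horner_coef_wide _ (size_poly _ _)); apply: eq_bigr => k _.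
by rewrite rcoord_moment coef_rVpoly_ord.
Qed.

(** For each triple of values some nonzero functional on R^4 kills all three; on the moment curve it
    is a nonzero polynomial in s. The product of these polynomials over the finitely many triples is
    nonzero, and an s that is not a root of it serves all triples at once. *)
Lemma generic_moment (I : finType) n (V : I -> 'cV[C]_n.+2) :
  exists s : R, forall a b c : I, exists l,
    [/\ functional l (V a) = 0, functional l (V b) = 0, functional l (V c) = 0
      & functional l (moment n s) != 0].
Proof.
pose A (t : I * I * I) : 'M[R]_(4, 3) :=
  \matrix_(k, j) rcoord (V (if j == 0 :> nat then t.1.1 else
                            if j == 1 :> nat then t.1.2 else t.2)) k.
have /choice[l hl] : forall t, exists l : 'rV[R]_4, l != 0 /\ l *m A t = 0.
  by move=> t; have [l l0 lA] := annihilator (A t); exists l.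
pose P := \prod_t rVpoly (l t).
have P0 : P != 0.
  apply/prodf_neq0 => t _; apply: contra (hl t).1 => /eqP h.
  by rewrite -(rVpolyK (l t)) h linear0.
have [s] := @nonroot _ P (fun k => k%:R) (fun x y => @mulrIn _ 1 (oner_neq0 R) x y) P0.
rewrite rootE /P horner_prod => /prodf_neq0 hs.
exists s%:R => a b c; exists (l (a, b, c)); rewrite functional_moment hs //.
have K (j : 'I_3) : \sum_k l (a, b, c) 0 k * A (a, b, c) k j = 0.
  by have /matrixP/(_ 0 j) := (hl (a, b, c)).2; rewrite !mxE.
split=> //.
- by rewrite -[RHS](K 0); apply: eq_bigr => k _; rewrite mxE.
- by rewrite -[RHS](K 1); apply: eq_bigr => k _; rewrite mxE.
- by rewrite -[RHS](K (inord 2)); apply: eq_bigr => k _; rewrite mxE inordK.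
Qed.

(* Courant's hat function for the triangulation of the plane by unit squares cut along
   their diagonals. *)
Definition hat (s t : R) : R :=
  Num.max 0 (1 - Num.max (Num.max `|s| `|t|) `|s - t|).

Lemma hat_ge0 s t : 0 <= hat s t.
Proof. by rewrite le_max lexx. Qed.

Lemma hat_gt0 s t : (0 < hat s t) = [&& `|s| < 1, `|t| < 1 & `|s - t| < 1].
Proof. by rewrite lt_max ltxx /= subr_gt0 !gt_max andbA. Qed.

Lemma cont_hat (T : topologicalType) (f g : T -> R) : continuous f -> continuous g ->
  continuous (fun x => hat (f x) (g x)).
Proof.
move=> cf cg; apply: rcont_max; first exact: rcont_cst.
apply: rcontB; first exact: rcont_cst.
apply: rcont_max; last by apply: rcont_norm; exact: rcontB.
by apply: rcont_max; exact: rcont_norm.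
Qed.

(** The point lies in the unit square with lower corner (i, j). Besides (i, j) and (i + 1, j + 1),
    only the corner on its side of the diagonal can be active: the term in s - t of [hat] switches
    off the opposite one. So at most three hats are positive anywhere. *)
Lemma hat_active (X Y : R) : 0 <= X -> 0 <= Y ->
  let i := Num.truncn X in let j := Num.truncn Y in
  0 < hat (X - i%:R) (Y - j%:R) /\
  exists c : nat * nat, (c.1 <= i.+1)%N /\ (c.2 <= j.+1)%N /\
    forall a b : nat, 0 < hat (X - a%:R) (Y - b%:R) ->
    (a, b) \in [:: (i, j); (i.+1, j.+1); c].
Proof.
move=> X0 Y0 i j.
have /andP[i1 i2] := truncn_itv X0; have /andP[j1 j2] := truncn_itv Y0.
rewrite -/i -/j -!natr1 in i1 i2 j1 j2 *.
split.
  by rewrite hat_gt0 !ltr_norml; apply/and3P; split; apply/andP; split; lra.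
have near (Z : R) (k a : nat) : k%:R <= Z -> Z < k%:R + 1 -> `|Z - a%:R| < 1 ->
    a = k \/ a = k.+1.
  move=> h1 h2; rewrite ltr_norml => /andP[h3 h4].
  have : (a < k.+2)%N by rewrite -(ltr_nat R) -!natr1; lra.
  have : (k < a.+1)%N by rewrite -(ltr_nat R) -!natr1; lra.
  rewrite ltnS leq_eqVlt => /orP[/eqP->|ka ak]; [by left|right].
  by apply/eqP; rewrite eqn_leq ka -ltnS ak.
exists (if Y - j%:R < X - i%:R then (i.+1, j) else (i, j.+1)).
do 2 (split; first by case: ifP => _ /=; rewrite ?leqnn ?leqnSn).
move=> a b; rewrite hat_gt0 => /and3P[h1 h2].
move=> h3.
have [ai|ai] := near X i a i1 i2 h1; have [bj|bj] := near Y j b j1 j2 h2;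
  move: h3; rewrite !inE ai bj; rewrite ?eqxx ?orbT // -natr1 ltr_norml => /andP[h3 h4];
  case: ltP => h5; rewrite ?eqxx ?orbT //; exfalso; lra.
Qed.

Lemma convex_close (I : finType) (lam y : I -> R) z e : (forall c, 0 <= lam c) ->
  0 < \sum_c lam c -> (forall c, 0 < lam c -> `|y c - z| <= e) ->
  `|(\sum_c lam c)^-1 * (\sum_c lam c * y c) - z| <= e.
Proof.
move=> l0 S0 h.
have -> : (\sum_c lam c)^-1 * (\sum_c lam c * y c) - z =
    (\sum_c lam c)^-1 * (\sum_c lam c * (y c - z)).
  have -> : \sum_c lam c * (y c - z) = \sum_c lam c * y c - (\sum_c lam c) * z.
    by rewrite mulr_suml -sumrB; apply: eq_bigr => c _; rewrite mulrBr.
  by rewrite mulrBr mulKf // gt_eqF.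
rewrite normrM gtr0_norm ?invr_gt0 // ler_pdivrMl // mulr_suml.
apply: (le_trans (ler_norm_sum _ _ _)); apply: ler_sum => c _.
rewrite normrM ger0_norm //.
have := l0 c; rewrite le_eqVlt => /orP[/eqP <-|lc]; first by rewrite !mul0r.
by rewrite ler_wpM2l // h.
Qed.

Lemma Re_realM (a : R) (z : C) : complex.Re (a%:C * z) = a * complex.Re z.
Proof. by rewrite Re_mulc /= mul0r subr0. Qed.

Lemma Im_realM (a : R) (z : C) : complex.Im (a%:C * z) = a * complex.Im z.
Proof. by rewrite Im_mulc /= mul0r addr0. Qed.

Definition clampx (x : R * R) : R * R := (clamp 0 1 x.1, clamp 0 1 x.2).

Lemma cont_clampx : continuous clampx.
Proof.
apply: cont_pair; apply: cont_clamp; [exact: cont_fst|exact: cont_snd].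
Qed.

Lemma clampxK x : clampx (clampx x) = clampx x.
Proof. by rewrite /clampx /= !(clamp_id (clamp_itv _ (@ler01 R))). Qed.

(* A piecewise linear approximation takes its values on finitely many three-dimensional real
   subspaces, which cannot cover the moment curve of R^4 = C^2. *)
Lemma general_position n (v : R * R -> 'cV[C]_n.+2) (e : R) : mcont v ->
  (forall x, v x = v (clampx x)) -> 0 < e ->
  exists w : R * R -> 'cV[C]_n.+2, exists s : R, [/\ mcont w,
    forall x, w x = w (clampx x),
    forall x i, `|complex.Re (w x i 0) - complex.Re (v x i 0)| <= e /\
                `|complex.Im (w x i 0) - complex.Im (v x i 0)| <= e &
    forall x (c : R), 0 < c -> w x + c%:C *: moment n s != 0].
Proof.
move=> cv vcl e0.
have [d d0 hd] := box_uniform_mcont 0 1 cv e0.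
have [N hN] := inv_natS_lt d0.
set K : R := N.+1%:R.
have K0 : 0 < K by rewrite ltr0n.
(* The scaled coordinate can equal N + 1; its truncation is then N + 1 and the upper corner of its
   square has index N + 2, hence N + 3 indices per axis. *)
pose I : finType := ('I_N.+3 * 'I_N.+3)%type.
pose V (c : I) := v (c.1%:R / K, c.2%:R / K).
have [s hs] := generic_moment V.
pose lam (c : I) (x : R * R) :=
  hat (K * (clampx x).1 - c.1%:R) (K * (clampx x).2 - c.2%:R).
have clam c : continuous (lam c).
  by apply: cont_hat; apply: rcontB; try exact: rcont_cst; apply: rcontM;
    try exact: rcont_cst; apply: cont_clamp; [exact: cont_fst|exact: cont_snd].
have lam0 c x : 0 <= lam c x by exact: hat_ge0.
have box x : [/\ 0 <= K * (clampx x).1, 0 <= K * (clampx x).2,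
    (Num.truncn (K * (clampx x).1) < N.+2)%N & (Num.truncn (K * (clampx x).2) < N.+2)%N].
  have /andP[a1 a2] := clamp_itv x.1 (@ler01 R).
  have /andP[b1 b2] := clamp_itv x.2 (@ler01 R).
  have p1 : 0 <= K * (clampx x).1 by rewrite mulr_ge0 // ltW.
  have p2 : 0 <= K * (clampx x).2 by rewrite mulr_ge0 // ltW.
  by split=> //; rewrite truncn_lt_nat // -natr1 -/K; rewrite (@le_lt_trans _ _ K) ?ltrDl //
    -[leRHS]mulr1 ler_wpM2l // ltW.
pose S x := \sum_c lam c x.
have S0 x : 0 < S x.
  have [p1 p2 t1 t2] := box x; have [h _] := hat_active p1 p2.
  pose c : I := (Ordinal (leqW t1), Ordinal (leqW t2)).
  by rewrite /S (bigD1 c) //= ltr_pwDl // sumr_ge0.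
pose w x := ((S x)^-1)%:C *: \sum_c (lam c x)%:C *: V c.
exists w, s; split.
- apply: mcontZ.
    apply: ccont_real; apply: rcontV; first by move=> x; rewrite gt_eqF.
    have : forall r : seq I, continuous (fun x => \sum_(c <- r) lam c x).
      elim=> [|c r IH]; first by under eq_fun do rewrite big_nil; exact: rcont_cst.
      by under eq_fun do rewrite big_cons; exact: rcontD.
    exact.
  move=> i j; under eq_fun do rewrite summxE.
  apply: ccont_sum => c; under eq_fun do rewrite mxE.
  by apply: ccontM; [exact: ccont_real|exact: ccont_cst].
- by move=> x; rewrite /w /S /lam clampxK.
- move=> x i.
  have close (c : I) : 0 < lam c x -> 
      `|complex.Re (V c i 0) - complex.Re (v x i 0)| <= e /\
      `|complex.Im (V c i 0) - complex.Im (v x i 0)| <= e.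
    rewrite /lam hat_gt0 => /and3P[h1 h2 _].
    have P (z : R) (k : nat) : `|K * z - k%:R| < 1 -> `|z - k%:R / K| < d.
      have Kn0 : K != 0 by rewrite gt_eqF.
      move=> h; have -> : z - k%:R / K = K^-1 * (K * z - k%:R).
        by rewrite mulrBr mulKf // [k%:R / K]mulrC.
      rewrite normrM gtr0_norm ?invr_gt0 //; apply: le_lt_trans hN.
      by rewrite -/K ger_pMr ?invr_gt0 // ltW.
    have [r1 r2] := hd (clampx x) (c.1%:R / K, c.2%:R / K)
      (clamp_itv _ (@ler01 R)) (clamp_itv _ (@ler01 R)) (P _ _ h1) (P _ _ h2) i 0.
    by rewrite vcl /V; split; rewrite distrC ltW.
  rewrite /w mxE summxE.
  have -> : \sum_c ((lam c x)%:C *: V c) i 0 = 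
      (\sum_c lam c x * complex.Re (V c i 0)) +i* (\sum_c lam c x * complex.Im (V c i 0)).
    apply/eqP; rewrite eq_complex /= (raddf_sum (@complex.Re R)) (raddf_sum (@complex.Im R)).
    apply/andP; split; apply/eqP; apply: eq_bigr => c _; rewrite mxE.
      exact: Re_realM.
    exact: Im_realM.
  split.
    by rewrite Re_realM; apply: convex_close (fun c => lam0 c x) (S0 x) _ => c /close[].
  by rewrite Im_realM; apply: convex_close (fun c => lam0 c x) (S0 x) _ => c /close[].
- move=> x c c0; apply/eqP => h.
  have [p1 p2 t1 t2] := box x; have [_ [[a b] /= [ha [hb act]]]] := hat_active p1 p2.
  pose c1 : I := (Ordinal (leqW t1), Ordinal (leqW t2)).
  pose c2 : I := (Ordinal (t1 : (_.+1 < N.+3)%N), Ordinal (t2 : (_.+1 < N.+3)%N)).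
  have ha' : (a < N.+3)%N by rewrite ltnS (leq_trans ha).
  have hb' : (b < N.+3)%N by rewrite ltnS (leq_trans hb).
  pose c3 : I := (Ordinal ha', Ordinal hb').
  have [l [l1 l2 l3 ls]] := hs c1 c2 c3.
  have : functional l (w x + c%:C *: moment n s) = 0 by rewrite h functional0.
  rewrite functionalD functionalZ /w functionalZ.
  have -> : functional l (\sum_c (lam c x)%:C *: V c) = 0.
    have -> : functional l (\sum_c (lam c x)%:C *: V c) = \sum_c lam c x * functional l (V c).
      rewrite (big_morph _ (functionalD l) (functional0 n l)).
      by apply: eq_bigr => k _; rewrite functionalZ.
    apply: big1 => k _.
    have := lam0 k x; rewrite le_eqVlt => /orP[/eqP <-|/act]; first by rewrite mul0r.
    rewrite !inE => /or3P[] /eqP[k1 k2].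
    + suff -> : k = c1 by rewrite l1 mulr0.
      by case: (k) k1 k2 => u1 u2 /= ? ?; congr pair; exact: val_inj.
    + suff -> : k = c2 by rewrite l2 mulr0.
      by case: (k) k1 k2 => u1 u2 /= ? ?; congr pair; exact: val_inj.
    + suff -> : k = c3 by rewrite l3 mulr0.
      by case: (k) k1 k2 => u1 u2 /= ? ?; congr pair; exact: val_inj.
  rewrite mulr0 add0r => /eqP; rewrite mulf_eq0 (negPf ls) orbF.
  by rewrite gt_eqF.
Qed.

End GeneralPosition.

(** * Contractibility of maps from the square to SU(n) *)

Section Contraction.
Variable R : realType.
Local Notation C := R[i].

(** The parameter ranges over the whole line, with values in SU(n) throughout, and the homotopy
    stays at 1 on [L] at all times; in particular [g] and [g'] are 1 on [L]. *)
Definition relhom (T : topologicalType) n (L : T -> Prop) (g g' : T -> 'M[C]_n) :=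
  exists G : R * T -> 'M[C]_n, [/\ mcont G, forall p, SU (G p),
    forall x, G (0, x) = g x, forall x, G (1, x) = g' x &
    forall t x, L x -> G (t, x) = 1%:M].

Lemma relhom_trans (T : topologicalType) n (L : T -> Prop) (f g h : T -> 'M[C]_n) :
  relhom L f g -> relhom L g h -> relhom L f h.
Proof.
move=> [F [cF sF F0 F1 FL]] [G [cG sG G0 G1 GL]].
exists (fun p => if 0 <= 1 / 2 - p.1 then F (2 * p.1, p.2) else G (2 * p.1 - 1, p.2)).
split=> /=.
- apply: mcont_glue.
  + by apply: rcontB; [exact: rcont_cst|exact: cont_fst].
  + apply: (mcont_comp cF); apply: cont_pair; last exact: cont_snd.
    by apply: rcontM; [exact: rcont_cst|exact: cont_fst].
  + apply: (mcont_comp cG); apply: cont_pair; last exact: cont_snd.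
    apply: rcontB; last exact: rcont_cst.
    by apply: rcontM; [exact: rcont_cst|exact: cont_fst].
  + move=> [t x] /= ht; have -> : t = 1 / 2 by lra.
    have -> : 2 * (1 / 2) = 1 :> R by lra.
    by rewrite subrr F1 G0.
- by move=> p; case: ifP.
- by move=> x; rewrite subr0 divr_ge0 // mulr0 F0.
- move=> x; have -> : (0 <= 1 / 2 - 1 :> R) = false by apply/negP; lra.
  by have -> : 2 * 1 - 1 = 1 :> R by lra.
- by move=> t x Lx; case: ifP => _; [exact: FL|exact: GL].
Qed.

Lemma relhom_comp (T : topologicalType) n (L : T -> Prop) (f g : T -> 'M[C]_n) (h : T -> T) :
  continuous h -> (forall x, L x -> L (h x)) ->
  relhom L f g -> relhom L (fun x => f (h x)) (fun x => g (h x)).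
Proof.
move=> ch hL [F [cF sF F0 F1 FL]]; exists (fun p => F (p.1, h p.2)); split=> //=.
- apply: (mcont_comp cF); apply: cont_pair; first exact: cont_fst.
  by apply: (cont_comp ch); exact: cont_snd.
- by move=> t x /hL; exact: FL.
Qed.

(** A diagonal factor that repairs a determinant. In the last place, and in dimension at least 2, it
    fixes the first basis vector, so that multiplying by it on the right leaves the first column
    alone. *)
Definition diag_at n (j0 : 'I_n) (c : C) : 'M[C]_n :=
  diag_mx (\row_j if j == j0 then c else 1).

Lemma diag_at1 n (j0 : 'I_n) : diag_at j0 1 = 1%:M.
Proof.
apply/matrixP => i j; rewrite !mxE; case: (i =P j) => [->|//] /=.
by case: ifP.
Qed.

Lemma det_diag_at n (j0 : 'I_n) c : \det (diag_at j0 c) = c.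
Proof.
rewrite det_diag (bigD1 j0) //= mxE eqxx big1 ?mulr1 // => i.
by rewrite mxE => /negPf ->.
Qed.

Lemma diag_at_unitary n (j0 : 'I_n) c : nsq c = 1 -> unitary_mx (diag_at j0 c).
Proof.
move=> hc; rewrite /unitary_mx /diag_at.
have -> : dag (diag_mx (\row_j if j == j0 then c else 1)) =
    diag_mx (\row_j if j == j0 then c^* else 1) :> 'M_n.
  apply/matrixP => i j; rewrite dagE !mxE; have [->|ij] := eqVneq i j.
    by rewrite !mulr1n; case: ifP => _; rewrite ?conjc1.
  by rewrite !mulr0n conjc0.
rewrite mulmx_diag -[RHS](diag_at1 j0); congr diag_mx; apply/rowP => j; rewrite !mxE.
by case: ifP => _; rewrite ?mulr1 // mulrC conj_inv_unit.
Qed.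

Lemma diag_at_e0 n c : diag_at ord_max c *m delta_mx 0 0 = delta_mx 0 0 :> 'cV_n.+2.
Proof.
apply/colP => i; rewrite mul_diag_mx !mxE.
by case: (i =P ord_max) => [->|_]; rewrite ?mul1r //= mulr0.
Qed.

Lemma mcont_diag_at (T : topologicalType) n (j0 : 'I_n) (c : T -> C) :
  ccont c -> mcont (fun x => diag_at j0 (c x)).
Proof.
move=> cc i j; under eq_fun do rewrite !mxE.
case: (i == j); last by under eq_fun do rewrite mulr0n; exact: ccont_cst.
under eq_fun do rewrite mulr1n.
by case: (i == j0) => //; exact: ccont_cst.
Qed.

Lemma ip_e0 n : ip (delta_mx 0 0) (delta_mx 0 0 : 'cV[C]_n.+1) = 1.
Proof.
rewrite -sqnE /sqn (bigD1 0) //= big1 ?addr0; first by rewrite mxE /nsq /= expr0n /= addr0 expr1n.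
by move=> i /negPf i0; rewrite mxE i0 /nsq /= expr0n /= addr0.
Qed.

Lemma ip_unitary n (A : 'M[C]_n) u v : unitary_mx A -> ip (A *m u) (A *m v) = ip u v.
Proof. by move=> hA; rewrite /ip dagM mulmxA -(mulmxA (dag u)) hA mulmx1. Qed.

Lemma ip_col n (A : 'M[C]_n.+1) : unitary_mx A -> ip (A *m delta_mx 0 0) (A *m delta_mx 0 0) = 1.
Proof. by move=> hA; rewrite ip_unitary // ip_e0. Qed.

Lemma normalize_unit n (u : 'cV[C]_n) : ip u u = 1 -> normalize u = u.
Proof.
move=> hu; have -> : normalize u = (1 : C) *: u; last by rewrite scale1r.
congr (_ *: _); have -> : sqn u = 1 by apply: complexI; rewrite sqnE.
by rewrite sqrtr1 invr1.
Qed.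

(** The normalised segment from the first column of [g x] to [w x] is a path on the sphere, and
    [rotmx] from its start to its current point carries [g] along. The rotation from a vector to
    itself is trivial, so nothing moves on [L]. *)
Lemma line_step (T : topologicalType) n (L : T -> Prop) (g : T -> 'M[C]_n.+2)
    (w : T -> 'cV[C]_n.+2) :
  mcont g -> (forall x, SU (g x)) -> mcont w ->
  (forall x (t : R), 0 <= t <= 1 -> (1 - t)%:C *: (g x *m delta_mx 0 0) + t%:C *: w x != 0) ->
  (forall x, L x -> g x = 1%:M /\ w x = delta_mx 0 0) ->
  exists g', [/\ mcont g', forall x, SU (g' x), relhom L g g' &
    forall x, g' x *m delta_mx 0 0 = normalize (w x)].
Proof.
move=> cg sg cw h hL.
pose f x := g x *m delta_mx 0 0 : 'cV[C]_n.+2.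
pose z (p : R * T) := (1 - clamp 0 1 p.1)%:C *: f p.2 + (clamp 0 1 p.1)%:C *: w p.2.
have m01 := @clamp_itv R 0 1 _ ler01.
have z0 p : z p != 0 by apply: h; exact: m01.
have cf : mcont f by apply: mcontM => //; exact: mcont_cst.
have cf2 : mcont (fun p : R * T => f p.2) by apply: (mcont_comp cf); exact: cont_snd.
have cz : mcont z.
  have cc : continuous (fun p : R * T => clamp 0 1 p.1) by apply: cont_clamp; exact: cont_fst.
  apply: mcontD; apply: mcontZ => //.
  - by apply: ccont_real; apply: rcontB => //; exact: rcont_cst.
  - exact: ccont_real.
  - by apply: (mcont_comp cw); exact: cont_snd.
pose u p := normalize (z p).
have cu : mcont u by exact: mcont_normalize.
have uu p : ip (u p) (u p) = 1 by exact: ip_normalize.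
have ff x : ip (f x) (f x) = 1 by apply: ip_col; case: (sg x).
have uf (p : R * T) : 1 + ip (u p) (f p.2) != 0.
  (* If the normalised point were opposite to [f], then [k z + f = 0] for some k > 0. Dividing by 1
     + k exhibits 0 on the segment from [f] to [w], at the parameter k c / (1 + k). *)
  apply/eqP => /(antipodal (ff _) (uu p)) hu.
  set k := (Num.sqrt (sqn (z p)))^-1.
  have k0 : 0 < k by exact: sqrt_sqn_gt0.
  have /andP[c0 c1] := m01 p.1; set c := clamp 0 1 p.1 in c0 c1.
  have {}hu : k%:C *: z p + f p.2 = 0 by rewrite -/(normalize (z p)) -/(u p) hu addNr.
  pose s := 1 + k.
  have s0 : 0 < s by rewrite addr_gt0.
  pose t := k * c / s.
  have t01 : 0 <= t <= 1.
    rewrite divr_ge0 ?mulr_ge0 ?(ltW k0) ?(ltW s0) //= ler_pdivrMr // mul1r /s; nra.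
  have := h p.2 t t01; rewrite -/(f p.2).
  have -> : (1 - t)%:C *: f p.2 + t%:C *: w p.2 = s^-1%:C *: (k%:C *: z p + f p.2).
    have sn0 : s != 0 by rewrite gt_eqF.
    have -> : 1 - t = s^-1 * (k * (1 - c)) + s^-1.
      by move: sn0; rewrite /t /s => sn0; field.
    have -> : t = s^-1 * (k * c) by rewrite mulrC.
    rewrite /z -/c !(rmorphD (real_complex R)) !(rmorphM (real_complex R)) /=.
    by apply/colP => i; rewrite !mxE; ring.
  by rewrite hu scaler0 eqxx.
pose r (p : R * T) := rotmx (f p.2) (u p).
have cr : mcont r by exact: (@mcont_rot _ _ _ (fun p => f p.2) u uf cf2 cu).
have ru p : unitary_mx (r p) by exact: rot_unitary.
(* [rotmx] is unitary but its determinant need not be 1; the factor on the right restores it without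
   touching the first column. *)
pose G (p : R * T) := r p *m g p.2 *m diag_at ord_max (\det (r p))^*.
have cG : mcont G.
  apply: mcontM; last by apply: mcont_diag_at; apply: ccont_conj; exact: ccont_det.
  by apply: mcontM => //; apply: (mcont_comp cg); exact: cont_snd.
have sG p : SU (G p).
  have [ug dg] := sg p.2; have dr := unitary_det (ru p); split.
    apply: unitaryM; first exact: unitaryM.
    by apply: diag_at_unitary; rewrite nsq_conj.
  by rewrite det_mulmx (det_mulmx (r p)) dg mulr1 det_diag_at (conj_inv_unit dr).
have G1 p : u p = f p.2 -> G p = g p.2.
  by move=> h'; rewrite /G /r h' rot_id // mul1mx det1 rmorph1 diag_at1 mulmx1.
exists (fun x => G (1, x)); split.
- by apply: (mcont_comp cG); apply: cont_pair; [exact: rcont_cst|move=> x; exact: cvg_id].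
- by [].
- exists G; split=> //.
    move=> x; rewrite G1 // /u /z /= clamp_id ?lexx ?ler01 //.
    by rewrite subr0 scale1r scale0r addr0 normalize_unit.
  move=> t x /hL[gx wx]; rewrite G1 ?gx //= /u /z /= /f gx wx mul1mx.
  by rewrite -scalerDl -(rmorphD (real_complex R)) /= subrK scale1r normalize_unit // ip_e0.
- move=> x; rewrite /G -mulmxA diag_at_e0 -mulmxA /r rot_apply //.
  rewrite /u /z /= clamp_id ?lexx ?ler01 //.
  by rewrite subrr scale0r scale1r add0r.
Qed.

Lemma mcont_block (T : topologicalType) n (F : T -> 'M[C]_n) :
  mcont F -> mcont (fun x => block_mx (1%:M : 'M_1) 0 0 (F x)).
Proof.
move=> cF i j.
case: (split_ordP i) => k ->; case: (split_ordP j) => l ->.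
- by under eq_fun do rewrite block_mxEul; exact: ccont_cst.
- by under eq_fun do rewrite block_mxEur; exact: ccont_cst.
- by under eq_fun do rewrite block_mxEdl; exact: ccont_cst.
- by under eq_fun do rewrite block_mxEdr.
Qed.

Lemma SU_block n (B : 'M[C]_n) : SU B -> SU (block_mx (1%:M : 'M_1) 0 0 B).
Proof.
move=> [uB dB]; split; last by rewrite det_ublock dB det1 mulr1.
rewrite /unitary_mx /dag tr_block_mx map_block_mx !trmx0 !map_mx0 mulmx_block.
rewrite !mulmx0 !mul0mx !addr0 !add0r uB tr_scalar_mx map_scalar_mx rmorph1 mulmx1.
by rewrite -scalar_mx_block.
Qed.

(** The adjoint of a unitary matrix that fixes e_0 fixes it too, so the first row as well as the
    first column is that of the identity. *)
Lemma SU_stabilizer n (A : 'M[C]_(1 + n)) : SU A -> A *m delta_mx 0 0 = delta_mx 0 0 :> 'cV__ ->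
  SU (drsubmx A) /\ A = block_mx 1%:M 0 0 (drsubmx A).
Proof.
move=> [uA dA] hA.
have hdA : dag A *m delta_mx 0 0 = delta_mx 0 0 :> 'cV__.
  by rewrite -[in LHS]hA mulmxA uA mul1mx.
have Ac i : A i 0 = (i == 0)%:R.
  by have /colP/(_ i) := hA; rewrite -colE !mxE eqxx andbT.
have Ar i : A 0 i = (i == 0)%:R.
  have /colP/(_ i) := hdA; rewrite -colE mxE dagE [in RHS]mxE eqxx andbT.
  by move=> /(congr1 conjc); rewrite conjcK => ->; case: (i == 0); rewrite ?rmorph1 ?rmorph0.
have eA : A = block_mx 1%:M 0 0 (drsubmx A).
  rewrite -[LHS]submxK; congr block_mx; apply/matrixP => i j; rewrite !mxE.
  - by rewrite !ord1 (_ : lshift n 0 = 0) ?Ac ?eqxx //; exact: val_inj.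
  - by rewrite !ord1 (_ : lshift n 0 = 0) ?Ar //; exact: val_inj.
  - by rewrite !ord1 (_ : lshift n 0 = 0) ?Ac //; exact: val_inj.
split=> //; split.
  have := uA; rewrite /unitary_mx {1 2}eA /dag tr_block_mx map_block_mx !trmx0 !map_mx0 mulmx_block.
  by rewrite !mulmx0 !mul0mx !addr0 !add0r -/(dag _) (scalar_mx_block _ _ 1) => /eq_block_mx[].
by have := dA; rewrite {1}eA det_ublock det1 mul1r.
Qed.

Lemma Re_addc (z w : C) : complex.Re (z + w) = complex.Re z + complex.Re w.
Proof. exact: raddfD. Qed.

Lemma Re_subc (z w : C) : complex.Re (z - w) = complex.Re z - complex.Re w.
Proof. exact: raddfB. Qed.

Lemma interpolate_interpolate n (u v : 'cV[C]_n) (t c : R) :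
  (1 - t)%:C *: u + t%:C *: (u + c%:C *: (v - u)) = u + (t * c)%:C *: (v - u).
Proof.
rewrite scalerDr addrA -scalerDl -(rmorphD (real_complex R)) /= subrK scale1r scalerA.
by rewrite -(rmorphM (real_complex R)).
Qed.

Lemma combination_neq0 n (u v : 'cV[C]_n.+1) (a b : R) : 0 <= a -> 0 <= b -> 0 < a + b ->
  0 < complex.Re (u 0 0) -> 0 < complex.Re (v 0 0) -> a%:C *: u + b%:C *: v != 0.
Proof.
move=> a0 b0 ab hu hv; apply/eqP => /colP/(_ 0); rewrite !mxE => /(congr1 (@complex.Re R)) /=.
rewrite raddfD /= !Re_realM => h.
have := mulr_ge0 a0 (ltW hu); have := mulr_ge0 b0 (ltW hv).
move: a0; rewrite le_eqVlt => /orP[/eqP za|/mulr_gt0/(_ hu)]; last by lra.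
have bp : 0 < b by lra.
by have := mulr_gt0 bp hv; rewrite -za mul0r in h; lra.
Qed.

(** If the sum vanished, then [v = - t (w - v)]: real and imaginary parts of each coordinate of [v]
    would be at most e in absolute value, and the unit vector [v] would have square norm at most 2 n
    e^2 < 1. *)
Lemma perturbation_neq0 n (v w : 'cV[C]_n) (t e : R) : sqn v = 1 -> 0 <= t <= 1 ->
  (forall i, `|complex.Re (w i 0) - complex.Re (v i 0)| <= e /\
             `|complex.Im (w i 0) - complex.Im (v i 0)| <= e) ->
  n%:R * (2 * e ^+ 2) < 1 -> v + t%:C *: (w - v) != 0.
Proof.
move=> vv /andP[t0 t1] hw he; apply/eqP => h.
suff : sqn v <= \sum_(i < n) (2 * e ^+ 2).
  by rewrite vv sumr_const card_ord -[_ *+ _]mulr_natl; lra.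
apply: ler_sum => i _; have [h1 h2] := hw i.
have /colP/(_ i) := h; rewrite !mxE => /eqP; rewrite eq_complex !raddfD /= => /andP[].
rewrite Re_realM Im_realM !raddfD !raddfN /= => /eqP e1 /eqP e2.
move: h1 h2 e1 e2; rewrite /nsq !ler_norml.
move: (complex.Re _) (complex.Im _) (complex.Re _) (complex.Im _) => a b c d.
have K (x y : R) : - e <= x - y <= e -> y + t * (x - y) = 0 -> y ^+ 2 <= e ^+ 2.
  move=> /andP[l1 l2] hy; have -> : y = - (t * (x - y)) by lra.
  have : `|t * (x - y)| <= e.
    rewrite normrM ger0_norm // (@le_trans _ _ (1 * `|x - y|)) ?ler_wpM2r //.
    by rewrite mul1r ler_norml l1.
  by rewrite ler_norml => /andP[? ?]; nra.
by move=> l1 l2 e1 e2; rewrite mulr2n mulrDl mul1r; apply: lerD; [exact: (K _ _ l1 e1)|exact: (K _ _ l2 e2)].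
Qed.

(** The first column is moved to a vector field in general position, then to a fixed vector of the
    moment curve, then to e_0; what remains is a map to the next smaller group. To stay put on [L],
    both intermediate targets are blended by [chi] with the value they must have there. Where [chi]
    is 1, general position applies; where it is less, the first entries have positive real part and
    no segment meets 0. *)
Theorem SU_contractible n (L : R * R -> Prop) (g : R * R -> 'M[C]_n) :
  mcont g -> (forall x, SU (g x)) -> (forall x, g x = g (clampx x)) ->
  (forall x, L x -> L (clampx x)) -> (forall x, L x -> g x = 1%:M) ->
  relhom L g (fun=> 1%:M).
Proof.
case: n g => [|n] g.
  move=> *; exists (fun=> 1%:M); split=> //; try by move=> x; rewrite [LHS]flatmx0 [RHS]flatmx0.
    exact: mcont_cst.
  by move=> ?; exact: SU1.
elim: n g => [|n IH] g cg sg gcl Lcl gL.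
  exists (fun=> 1%:M); split=> //; first exact: mcont_cst.
    by move=> ?; exact: SU1.
  by move=> x; have [_] := sg x; rewrite det_mx11 => h; rewrite [g x]mx11_scalar h.
have eg : g = fun x => g (clampx x) by apply/funext.
have [v ev] : exists v : R * R -> 'cV[C]_n.+2, v = fun x => g x *m delta_mx 0 0 by eexists.
have cv : mcont v by rewrite ev; apply: mcontM => //; exact: mcont_cst.
have vv x : sqn (v x) = 1.
  by rewrite ev; apply: complexI; rewrite sqnE ip_col //; case: (sg x).
have vcl x : v x = v (clampx x) by rewrite ev [in LHS]gcl.
(* Small enough for [perturbation_neq0], which asks for 2 (n + 2) e^2 < 1, and at most 1/4, so that
   an entry of real part above 1/2 keeps a positive real part after the perturbation. *)
pose e : R := (4 * n.+2%:R)^-1.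
have e0 : 0 < e by rewrite invr_gt0 mulr_gt0 // ltr0n.
have en : 4 * n.+2%:R * e = 1 by rewrite mulfV // mulf_neq0 // pnatr_eq0.
have N1 : 1 <= n.+2%:R :> R by rewrite ler1n.
have [w2 [s [cw2 w2cl w2v w2p]]] := general_position cv vcl e0.
pose p := moment n s.
have p0 : p 0 0 = 1 +i* s by rewrite mxE.
(* Vanishes where the first column is e_0, hence on [L], and equals 1 as soon as its first entry has
   real part at most 1/2. *)
pose chi x := Num.min 1 (2 * (1 - complex.Re (v x 0 0))).
have cchi : continuous chi.
  apply: rcont_min; first exact: rcont_cst.
  apply: rcontM; first exact: rcont_cst.
  by apply: rcontB; [exact: rcont_cst|exact: (cv 0 0).1].
have chicl x : chi x = chi (clampx x) by rewrite /chi vcl.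
have v01 x : complex.Re (v x 0 0) <= 1.
  have : nsq (v x 0 0) <= 1.
    by rewrite -(vv x) /sqn (bigD1 0) //= lerDl sumr_ge0 // => i _; exact: nsq_ge0.
  rewrite /nsq; nra.
have chi01 x : 0 <= chi x <= 1.
  rewrite ge_min lexx /= andbT le_min ler01 /= mulr_ge0 // subr_ge0 //.
have chi0 x : L x -> chi x = 0.
  by move=> /gL h; rewrite /chi ev h mul1mx mxE /= subrr mulr0 min_r.
have vL x : L x -> v x = delta_mx 0 0 by move=> /gL h; rewrite ev h mul1mx.
pose w1 x := v x + (chi x)%:C *: (w2 x - v x).
pose q x := delta_mx 0 0 + (chi x)%:C *: (p - delta_mx 0 0) : 'cV[C]_n.+2.
have cw1 : mcont w1.
  by apply: mcontD => //; apply: mcontZ; [exact: ccont_real|exact: mcontB].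
have cq : mcont q.
  apply: mcontD; first exact: mcont_cst.
  by apply: mcontZ; [exact: ccont_real|exact: mcont_cst].
have near_v x (t : R) : 0 <= t <= 1 -> v x + t%:C *: (w2 x - v x) != 0.
  by move=> t01; apply: (perturbation_neq0 (vv x) t01 (w2v x)); nra.
have w1_0 x : w1 x != 0 by exact: near_v.
have Re_w1 x : chi x < 1 -> 0 < complex.Re (w1 x 0 0).
  rewrite /chi gt_min ltxx /= => hx.
  have /andP[c0 c1] := chi01 x; have [h1 _] := w2v x 0.
  rewrite /w1 !mxE Re_addc Re_realM Re_subc.
  move: h1; rewrite ler_norml => /andP[h1 h2].
  have : e <= 1 / 4 by nra.
  move: (chi x) c0 c1 => k c0 c1.
  move: (complex.Re (v x 0 0)) (complex.Re (w2 x 0 0)) hx h1 h2 => a b; nra.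
have Re_q x : complex.Re (q x 0 0) = 1.
  by rewrite /q !mxE Re_addc Re_realM Re_subc /= subrr mulr0 addr0.
(* All nonnegative combinations are treated, not only segments, because the column met in the second
   move is a normalised multiple of [w1]. *)
have w1q x (a b : R) : 0 <= a -> 0 <= b -> 0 < a + b -> a%:C *: w1 x + b%:C *: q x != 0.
  move=> a0 b0 ab; have /andP[_] := chi01 x; rewrite le_eqVlt => /orP[/eqP c1|c1]; last first.
    by apply: combination_neq0 => //; [exact: Re_w1|rewrite Re_q].
  have -> : w1 x = w2 x by rewrite /w1 c1 scale1r addrC subrK.
  have -> : q x = p by rewrite /q c1 scale1r addrC subrK.
  have := a0; rewrite le_eqVlt => /orP[/eqP za|ap].
    rewrite -za scale0r add0r scaler_eq0 negb_or; apply/andP; split.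
      by rewrite eq_complex /= eqxx andbT gt_eqF //; lra.
    by apply/eqP => /colP/(_ 0); rewrite p0 mxE => /eqP; rewrite eq_complex /= oner_eq0.
  have := b0; rewrite le_eqVlt => /orP[/eqP zb|bp].
    rewrite -zb scale0r addr0 scaler_eq0 negb_or; apply/andP; split.
      by rewrite eq_complex /= eqxx andbT gt_eqF.
    by have := w1_0 x; rewrite /w1 c1 scale1r addrC subrK.
  have := w2p x (b / a) (divr_gt0 bp ap); apply: contra => /eqP h.
  have : (a^-1)%:C *: (a%:C *: w2 x + b%:C *: p) = 0 by rewrite h scaler0.
  rewrite scalerDr !scalerA -!(rmorphM (real_complex R)) /= mulVf ?gt_eqF // scale1r.
  by rewrite mulrC => ->.
(* Each stage is precomposed with the retraction [clampx], so that it again depends only on the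
   point of the square, as the next stage and the induction hypothesis require. *)
have step (f f' : R * R -> 'M[C]_n.+2) : (forall x, f x = f (clampx x)) -> mcont f' -> (forall x, SU (f' x)) ->
    relhom L f f' -> [/\ mcont (fun x => f' (clampx x)), forall x, SU (f' (clampx x)),
      relhom L f (fun x => f' (clampx x)) & forall x, L x -> f' (clampx x) = 1%:M].
  move=> fcl cf' sf' rf; split=> //; first by apply: (mcont_comp cf'); exact: cont_clampx.
    have -> : f = fun x => f (clampx x) by apply/funext.
    by apply: relhom_comp => //; exact: cont_clampx.
  by case: rf => [F [_ _ _ F1 FL]] x /Lcl Lx; rewrite -F1 FL.
have e0D x : w1 x = w1 (clampx x) by rewrite /w1 vcl w2cl chicl.
have q0D x : q x = q (clampx x) by rewrite /q chicl.
have w1L x : L x -> w1 x = delta_mx 0 0.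
  by move=> Lx; rewrite /w1 chi0 // scale0r addr0 vL.
have qL x : L x -> q x = delta_mx 0 0.
  by move=> Lx; rewrite /q chi0 // scale0r addr0.
have [x t t01||g1 [cg1 sg1 r1 col1]] := @line_step _ _ L g w1 cg sg cw1.
- have -> : (1 - t)%:C *: (g x *m delta_mx 0 0) + t%:C *: w1 x =
      v x + (t * chi x)%:C *: (w2 x - v x).
    have -> : g x *m delta_mx 0 0 = v x by rewrite ev.
    exact: interpolate_interpolate.
  by apply: near_v; have := chi01 x; nra.
- by move=> x Lx; rewrite gL // w1L.
have [{}cg1 {}sg1 {}r1 g1L] := step _ _ gcl cg1 sg1 r1.
have pos_normalize (u : 'cV[C]_n.+2) : u != 0 ->
    exists2 k : R, 0 < k & normalize u = k%:C *: u.
  by move=> u0; exists (Num.sqrt (sqn u))^-1 => //; exact: sqrt_sqn_gt0.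
have [x t /andP[t0 t1]||g2 [cg2 sg2 r2 col2]] := @line_step _ _ L _ q cg1 sg1 cq.
- have [k k0 hk] := pos_normalize _ (w1_0 (clampx x)).
  rewrite col1 hk -e0D scalerA -(rmorphM (real_complex R)) /=.
  by apply: w1q => //; nra.
- by move=> x Lx; rewrite g1L // qL.
have [|{}cg2 {}sg2 {}r2 g2L] := step _ _ _ cg2 sg2 r2; first by move=> x; rewrite clampxK.
have q_0 x : q x != 0.
  have := w1q x 0 1 (lexx _) ler01; rewrite add0r ltr01 scale0r add0r scale1r.
  exact.
have [|x t /andP[t0 t1]||g3 [cg3 sg3 r3 col3]] := @line_step _ _ L _ (fun=> delta_mx 0 0) cg2 sg2.
- exact: mcont_cst.
- have [k k0 hk] := pos_normalize _ (q_0 (clampx x)).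
  rewrite col2 hk -q0D scalerA -(rmorphM (real_complex R)) /=.
  apply: combination_neq0 => //; [by nra|by nra|by rewrite Re_q|].
  by rewrite mxE /= ltr01.
- by move=> x Lx; rewrite g2L.
have [|{}cg3 {}sg3 {}r3 g3L] := step _ _ _ cg3 sg3 r3; first by move=> x; rewrite clampxK.
apply: (relhom_trans r1); apply: (relhom_trans r2); apply: (relhom_trans r3).
have col3' x : g3 (clampx x) *m delta_mx 0 0 = delta_mx 0 0 :> 'cV[C]_(1 + n.+1).
  by rewrite col3 normalize_unit // ip_e0.
have st x := SU_stabilizer (sg3 x) (col3' x).
pose B x : 'M[C]_n.+1 := drsubmx (g3 (clampx x) : 'M_(1 + n.+1)).
have [||x|//|x Lx|H [cH sH H0 H1 HL]] := IH B.
- by move=> i j; rewrite /B; under eq_fun do rewrite !mxE; exact: cg3.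
- by move=> x; case: (st x).
- by rewrite /B clampxK.
- have -> : B x = drsubmx (1%:M : 'M[C]_(1 + n.+1)) by rewrite /B g3L.
  by rewrite (scalar_mx_block 1 n.+1 1) block_mxKdr.
exists (fun p => block_mx (1%:M : 'M_1) 0 0 (H p)); split.
- exact: mcont_block.
- by move=> y; exact: SU_block.
- by move=> x; rewrite H0; case: (st x).
- by move=> x; rewrite H1 -scalar_mx_block.
- by move=> t x Lx; rewrite HL // -scalar_mx_block.
Qed.

End Contraction.

(** * Folding the torus by periods and the reflection k |-> - k *)

Section Folding.
Variable R : realType.
Implicit Types x y u : R.

(** The distance to the nearest integer: the quotient of the line by integer translations and the
    reflection, with values in the fundamental domain [0, 1/2]. *)
Definition fold x : R := `|x - (Num.floor (x + 1 / 2))%:~R|.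

Lemma floor_half_close x : - (1 / 2) <= x - (Num.floor (x + 1 / 2))%:~R <= 1 / 2.
Proof.
have /andP[] := floor_itv (x + 1 / 2); rewrite intrD mulr1z => h1 h2.
by apply/andP; split; lra.
Qed.

Lemma fold_le x (n : int) : fold x <= `|x - n%:~R|.
Proof.
rewrite /fold; have := floor_half_close x; set k := Num.floor _ => /andP[h1 h2].
have [->//|] := eqVneq n k; rewrite neq_lt => /orP[]; rewrite -lezD1 -(ler_int R) intrD mulr1z => h.
  by rewrite [leRHS]ger0_norm ?ler_norml; [apply/andP; split|]; lra.
by rewrite [leRHS]ler0_norm ?ler_norml; [apply/andP; split|]; lra.
Qed.

Lemma foldE (n : int) u : - (1 / 2) <= u <= 1 / 2 -> fold (n%:~R + u) = `|u|.
Proof.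
move=> hu; apply/eqP; rewrite eq_le; apply/andP; split.
  by rewrite (le_trans (fold_le _ n)) // addrAC subrr add0r.
rewrite /fold; set k := Num.floor _.
have -> : n%:~R + u - k%:~R = u - (k - n)%:~R by rewrite rmorphB /=; ring.
move: (k - n) => j; have [->|] := eqVneq j 0; first by rewrite subr0.
move: hu => /andP[h1 h2].
rewrite neq_lt => /orP[]; rewrite -lezD1 -(ler_int R) ?intrD ?mulr1z ?rmorph0 ?add0r => h.
  by rewrite [leRHS]ger0_norm ?ler_norml; [apply/andP; split|]; lra.
by rewrite [leRHS]ler0_norm ?ler_norml; [apply/andP; split|]; lra.
Qed.

Lemma fold_decomp x : exists (n : int) u, - (1 / 2) <= u <= 1 / 2 /\ x = n%:~R + u.
Proof.
exists (Num.floor (x + 1 / 2)), (x - (Num.floor (x + 1 / 2))%:~R).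
by split; [exact: floor_half_close|rewrite addrC subrK].
Qed.

Lemma fold_itv x : 0 <= fold x <= 1 / 2.
Proof.
by have [n [u [hu ->]]] := fold_decomp x; rewrite foldE // normr_ge0 ler_norml.
Qed.

Lemma foldD1 x : fold (x + 1) = fold x.
Proof.
have [n [u [hu ->]]] := fold_decomp x; rewrite foldE //.
have -> : n%:~R + u + 1 = (n + 1)%:~R + u by rewrite intrD mulr1z; ring.
exact: foldE.
Qed.

Lemma foldN x : fold (- x) = fold x.
Proof.
have [n [u [hu ->]]] := fold_decomp x; rewrite foldE //.
have -> : - (n%:~R + u) = (- n)%:~R + (- u) by rewrite rmorphN /= opprD.
by rewrite foldE ?normrN //; move: hu => /andP[h1 h2]; apply/andP; split; lra.
Qed.

Lemma fold_id u : 0 <= u <= 1 / 2 -> fold u = u.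
Proof.
move=> /andP[h1 h2]; rewrite -[u in LHS]add0r -[0 in LHS]/((0 : int)%:~R).
by rewrite foldE ?ger0_norm //; apply/andP; split; lra.
Qed.

Lemma foldD_half x : fold (x + 1 / 2) = 1 / 2 - fold x.
Proof.
have [n [u [/andP[h1 h2] ->]]] := fold_decomp x; rewrite foldE ?h1 //.
have [u0|u0] := leP 0 u.
  have -> : n%:~R + u + 1 / 2 = (n + 1)%:~R + (u - 1 / 2) by rewrite intrD mulr1z; lra.
  rewrite foldE; last by apply/andP; split; lra.
  have -> : `|u - 1 / 2| = - (u - 1 / 2) by rewrite ler0_norm //; lra.
  by rewrite ger0_norm //; lra.
rewrite -addrA foldE; last by apply/andP; split; lra.
have -> : `|u + 1 / 2| = u + 1 / 2 by rewrite ger0_norm //; lra.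
by rewrite ltr0_norm //; lra.
Qed.

Lemma fold_lipschitz x y : `|fold x - fold y| <= `|x - y|.
Proof.
have H a b : fold a - fold b <= `|a - b|.
  have := fold_le a (Num.floor (b + 1 / 2)); set n := Num.floor _ => h.
  have hb : fold b = `|b - n%:~R| by [].
  have := ler_normD (a - b) (b - n%:~R); rewrite subrKA -hb; lra.
by rewrite ler_norml H andbT; have := H y x; rewrite distrC; lra.
Qed.

Lemma cont_fold (T : topologicalType) (f : T -> R) : continuous f ->
  continuous (fun t => fold (f t)).
Proof.
move=> cf; apply: (cont_comp _ cf) => x; apply/cvgrPdist_lt => e e0.
near=> y; apply: (le_lt_trans (fold_lipschitz _ _)).
by near: y; apply: (@cvgr_dist_lt _ _ _ (nbhs x) _ idfun x) => //; exact: cvg_id.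
Unshelve. all: by end_near. Qed.

(** A triangle wave in the role of sin (2 pi x): odd, periodic, nonnegative on [0, 1/2] and zero
    exactly at the multiples of 1/2. Its sign tells x from - x, which [fold] identifies. *)
Definition swave x : R := 1 / 4 - fold (x - 1 / 4).

Lemma cont_swave (T : topologicalType) (f : T -> R) : continuous f ->
  continuous (fun t => swave (f t)).
Proof.
move=> cf; apply: rcontB; first exact: rcont_cst.
by apply: cont_fold; apply: rcontB => //; exact: rcont_cst.
Qed.

Lemma swaveD1 x : swave (x + 1) = swave x.
Proof. by rewrite /swave addrAC foldD1. Qed.

Lemma swaveN x : swave (- x) = - swave x.
Proof.
rewrite /swave -opprD foldN.
have -> : x + 1 / 4 = (x - 1 / 4) + 1 / 2 by lra.
rewrite foldD_half; lra.
Qed.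

Lemma swaveE (n : int) u : 0 <= u <= 1 / 2 -> swave (n%:~R + u) = Num.min u (1 / 2 - u).
Proof.
move=> /andP[h1 h2]; rewrite /swave -addrA foldE; last by apply/andP; split; lra.
by rewrite /Num.min; case: ltP => h; [rewrite ler0_norm|rewrite ger0_norm]; lra.
Qed.

Lemma swave_decomp x :
  (0 <= swave x /\ exists n : int, x = n%:~R + fold x) \/
  (swave x <= 0 /\ exists n : int, x = n%:~R - fold x).
Proof.
have [n [u [hu ->]]] := fold_decomp x; rewrite foldE //.
move: hu => /andP[h1 h2]; have [u0|u0] := leP 0 u; [left|right].
  by rewrite swaveE ?u0 // ger0_norm // le_min u0; split; [lra|exists n].
rewrite ltr0_norm // opprK; split; last by exists n.
have -> : n%:~R + u = - ((- n)%:~R + (- u)) by rewrite rmorphN /=; ring.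
rewrite swaveN oppr_le0 swaveE ?le_min; lra.
Qed.

Lemma swave_eq0 x : swave x = 0 -> fold x = 0 \/ fold x = 1 / 2.
Proof.
have [n [u [/andP[h1 h2] ->]]] := fold_decomp x; rewrite foldE ?h1 //.
have [u0|u0] := leP 0 u.
  rewrite swaveE ?u0 // ger0_norm // /Num.min; case: ifP => _ ?; [left|right]; lra.
have -> : n%:~R + u = - ((- n)%:~R + (- u)) by rewrite rmorphN /=; ring.
rewrite swaveN swaveE ?ltr0_norm //; last by lra.
by rewrite /Num.min; case: ifP => _ ?; [left|right]; lra.
Qed.

Lemma swave_ge0 u : 0 <= u <= 1 / 2 -> 0 <= swave u.
Proof.
move=> /andP[h1 h2]; rewrite -[u]add0r -[0 + u]/((0 : int)%:~R + u) swaveE ?h1 //.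
by rewrite le_min h1; lra.
Qed.

Lemma periodic_int (X : Type) (f : R -> X) (n : int) x :
  (forall x, f (x + 1) = f x) -> f (n%:~R + x) = f x.
Proof.
move=> h; have P (k : nat) y : f (k%:R + y) = f y.
  elim: k => [|k IH]; first by rewrite add0r.
  by rewrite -natr1 addrAC h IH.
case: n => n; first exact: P.
by rewrite NegzE rmorphN /= -(P n.+1 (_ + x)) addNKr.
Qed.

Definition periodic2 (X : Type) (f : R * R -> X) :=
  (forall x y, f (x + 1, y) = f (x, y)) /\ (forall x y, f (x, y + 1) = f (x, y)).

Definition opp2 (k : R * R) : R * R := (- k.1, - k.2).

Lemma opp2K k : opp2 (opp2 k) = k.
Proof. by case: k => x y; rewrite /opp2 /= !opprK. Qed.

Lemma cont_opp2 : continuous opp2.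
Proof. by apply: cont_pair; apply: rcontN; [exact: cont_fst|exact: cont_snd]. Qed.

Lemma periodic2_int (X : Type) (f : R * R -> X) (n m : int) x y : periodic2 f ->
  f (n%:~R + x, m%:~R + y) = f (x, y).
Proof.
move=> [h1 h2]; rewrite (@periodic_int _ (fun a => f (a, _))) //.
exact: (@periodic_int _ (fun a => f (x, a))).
Qed.

(* Every point of the plane is congruent, up to sign, to a point of one of the two cells
   [0,1/2] x [0,1/2] and [0,1/2] x [-1/2,0]; [swave] tells which signs to take. *)
Lemma fold2_decomp (X : Type) (f : R * R -> X) k : periodic2 f ->
  (0 <= swave k.1 /\ 0 <= swave k.2 /\ f k = f (fold k.1, fold k.2)) \/
  (swave k.1 <= 0 /\ swave k.2 <= 0 /\ f k = f (- fold k.1, - fold k.2)) \/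
  (0 <= swave k.1 /\ swave k.2 <= 0 /\ f k = f (fold k.1, - fold k.2)) \/
  (swave k.1 <= 0 /\ 0 <= swave k.2 /\ f k = f (- fold k.1, fold k.2)).
Proof.
move=> pf; have E := periodic2_int _ _ _ _ pf.
have [[s1 [n e1]]|[s1 [n e1]]] := swave_decomp k.1;
have [[s2 [m e2]]|[s2 [m e2]]] := swave_decomp k.2.
- by left; split => //; split => //; rewrite [k in LHS]surjective_pairing {1}e1 {1}e2 E.
- by do 2 right; left; split => //; split => //; rewrite [k in LHS]surjective_pairing {1}e1 {1}e2 E.
- by do 3 right; split => //; split => //; rewrite [k in LHS]surjective_pairing {1}e1 {1}e2 E.
- by right; left; split => //; split => //; rewrite [k in LHS]surjective_pairing {1}e1 {1}e2 E.
Qed.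

End Folding.

(** * Families of matching matrices and moves that preserve them *)

Section Families.
Variable R : realType.
Local Notation C := R[i].
Variables (m : nat) (eps : 'M[C]_m).

(** What 1 and J have in common: a real orthogonal matrix that is symmetric or antisymmetric, [c]
    being the sign. The sign cancels in [tauK], so both statistics become one case. *)
Definition matching_form :=
  [/\ eps^T *m eps = 1%:M, dag eps = eps^T & exists2 c : C, eps^T = c *: eps & c * c = 1].

Hypothesis eps_form : matching_form.

(** The transpose twisted by [eps], an involution that reverses products. The matching relation
    reads [tau (a (- k)) = a k], so the values at fixed points are the [tau]-symmetric matrices. *)
Definition tau (A : 'M[C]_m) := eps^T *m A^T *m eps.

Let epsV : eps *m eps^T = 1%:M.
Proof. by apply: mulmx1C; case: eps_form. Qed.

Lemma tauM A B : tau (A *m B) = tau B *m tau A.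
Proof.
rewrite /tau trmx_mul; move: epsV; move: (eps^T) (A^T) (B^T) => E A' B' h.
by rewrite -!mulmxA (mulmxA eps E) h mul1mx.
Qed.

Lemma tau1 : tau 1%:M = 1%:M.
Proof. by rewrite /tau trmx1 mulmx1; case: eps_form. Qed.

Lemma tauZ a A : tau (a *: A) = a *: tau A.
Proof. by rewrite /tau linearZ /= -scalemxAr -scalemxAl. Qed.

Lemma tauD A B : tau (A + B) = tau A + tau B.
Proof. by rewrite /tau linearD /= mulmxDr mulmxDl. Qed.

Lemma tauN A : tau (- A) = - tau A.
Proof. by rewrite -scaleN1r tauZ scaleN1r. Qed.

Lemma tauB A B : tau (A - B) = tau A - tau B.
Proof. by rewrite tauD tauN. Qed.

Lemma tauK A : tau (tau A) = A.
Proof.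
have [e1 _ [c ec cc]] := eps_form.
rewrite /tau !trmx_mul !trmxK.
have ee : eps *m eps = c%:M.
  by rewrite -[eps in eps *m _]scale1r -cc -scalerA -ec -scalemxAl e1 scalemx1.
have ee' : eps^T *m eps^T = c%:M.
  by rewrite {2}ec -scalemxAr e1 scalemx1.
rewrite !mulmxA ee' -!mulmxA ee mul_scalar_mx mul_mx_scalar scalerA cc scale1r //.
Qed.

Lemma tau_dag A : tau (dag A) = dag (tau A).
Proof.
have [_ de _] := eps_form.
rewrite /tau !dagM de -de dagK de mulmxA; congr (_ *m _ *m _).
by apply/matrixP => i j; rewrite !mxE.
Qed.

Lemma det_tau A : \det (tau A) = \det A.
Proof.
have [e1 _ _] := eps_form.
rewrite /tau !det_mulmx (det_tr A) mulrAC -det_mulmx e1 det1 mul1r //.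
Qed.

Lemma unitary_tau A : unitary_mx A -> unitary_mx (tau A).
Proof. by move=> hA; rewrite /unitary_mx -tau_dag -tauM unitaryC // tau1. Qed.

Lemma mcont_tau (T : topologicalType) (F : T -> 'M[C]_m) : mcont F -> mcont (fun x => tau (F x)).
Proof.
move=> cF; apply: mcontM; last exact: mcont_cst.
by apply: mcontM; [exact: mcont_cst|exact: mcont_tr].
Qed.

Definition mfamily (a : R * R -> 'M[C]_m) :=
  [/\ mcont a, periodic2 a, forall k, unitary_mx (a k) & forall k, tau (a (opp2 k)) = a k].

Definition SUfamily a := mfamily a /\ forall k, \det (a k) = 1.

Definition homot (a b : R * R -> 'M[C]_m) :=
  exists H : R * (R * R) -> 'M[C]_m, [/\ mcont H, forall t, mfamily (fun k => H (t, k)),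
    forall k, H (0, k) = a k & forall k, H (1, k) = b k].

Lemma homot_refl a : mfamily a -> homot a a.
Proof.
move=> fa; exists (fun p => a p.2); split=> //.
by case: fa => ca _ _ _; apply: (mcont_comp ca); exact: cont_snd.
Qed.

Lemma homot_sym a b : homot a b -> homot b a.
Proof.
move=> [H [cH fH H0 H1]]; exists (fun p => H (1 - p.1, p.2)); split=> //= [|k|k].
- apply: (mcont_comp cH); apply: cont_pair; last exact: cont_snd.
  by apply: rcontB; [exact: rcont_cst|exact: cont_fst].
- by rewrite subr0.
- by rewrite subrr.
Qed.

Lemma homot_trans b a c : homot a b -> homot b c -> homot a c.
Proof.
move=> [F [cF sF F0 F1]] [G [cG sG G0 G1]].
exists (fun p => if 0 <= 1 / 2 - p.1 then F (2 * p.1, p.2) else G (2 * p.1 - 1, p.2)).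
split=> /=.
- apply: mcont_glue.
  + by apply: rcontB; [exact: rcont_cst|exact: cont_fst].
  + apply: (mcont_comp cF); apply: cont_pair; last exact: cont_snd.
    by apply: rcontM; [exact: rcont_cst|exact: cont_fst].
  + apply: (mcont_comp cG); apply: cont_pair; last exact: cont_snd.
    apply: rcontB; last exact: rcont_cst.
    by apply: rcontM; [exact: rcont_cst|exact: cont_fst].
  + move=> [t x] /= ht; have -> : t = 1 / 2 by lra.
    have -> : 2 * (1 / 2) = 1 :> R by lra.
    by rewrite subrr F1 G0.
- by move=> t; case: (0 <= _).
- by move=> x; rewrite subr0 divr_ge0 // mulr0 F0.
- move=> x; have -> : (0 <= 1 / 2 - 1 :> R) = false by apply/negP; lra.
  by have -> : 2 * 1 - 1 = 1 :> R by lra.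
Qed.

Lemma periodic2_opp (X : Type) (f : R * R -> X) : periodic2 f -> periodic2 (fun k => f (opp2 k)).
Proof.
move=> [h1 h2]; split=> x y; rewrite /opp2 /=.
- by rewrite opprD -(h1 (- x - 1)) subrK.
- by rewrite opprD -(h2 _ (- y - 1)) subrK.
Qed.

(** [tau] reverses the product and exchanges the outer factors belonging to k and - k, so the
    matching relation is inherited from [a]. *)
Lemma congruence_family a V : mfamily a -> mcont V -> (forall k, unitary_mx (V k)) -> periodic2 V ->
  mfamily (fun k => tau (V (opp2 k)) *m a k *m V k).
Proof.
move=> [ca pa ua ta] cV uV pV; have pV' := periodic2_opp pV; split.
- apply: mcontM => //; apply: mcontM => //; apply: mcont_tau.
  by apply: (mcont_comp cV); exact: cont_opp2.
- by split=> x y; rewrite ?pV.1 ?pV.2 ?pV'.1 ?pV'.2 ?pa.1 ?pa.2.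
- by move=> k; apply: unitaryM => //; apply: unitaryM => //; exact: unitary_tau.
- by move=> k; rewrite tauM (tauM _ (a _)) tauK ta opp2K mulmxA.
Qed.

Lemma modification a (W : R * (R * R) -> 'M[C]_m) : SUfamily a -> mcont W ->
  (forall p, SU (W p)) -> (forall t, periodic2 (fun k => W (t, k))) ->
  (forall k, W (0, k) = 1%:M) ->
  let b k := tau (W (1, opp2 k)) *m a k *m W (1, k) in SUfamily b /\ homot a b.
Proof.
move=> [fa da] cW sW pW W0 b.
have cWt t : mcont (fun k => W (t, k)).
  by apply: (mcont_comp cW); apply: cont_pair; [exact: rcont_cst|move=> x; exact: cvg_id].
have fW t : mfamily (fun k => tau (W (t, opp2 k)) *m a k *m W (t, k)).
  by apply: (@congruence_family a (fun k => W (t, k))) => // k; case: (sW (t, k)).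
split; first split.
- exact: fW.
- move=> k; rewrite det_mulmx (det_mulmx (tau _)) det_tau da.
  by case: (sW (1, opp2 k)) => _ ->; case: (sW (1, k)) => _ ->; rewrite !mulr1.
exists (fun p => tau (W (p.1, opp2 p.2)) *m a p.2 *m W p); split.
- have [ca _ _ _] := fa.
  apply: mcontM => //; apply: mcontM.
    apply: mcont_tau; apply: (mcont_comp cW); apply: cont_pair; first exact: cont_fst.
    by apply: (cont_comp (@cont_opp2 R)); exact: cont_snd.
  by apply: (mcont_comp ca); exact: cont_snd.
- exact: fW.
- by move=> k /=; rewrite !W0 tau1 mul1mx mulmx1.
- by [].
Qed.

Lemma phase_family a (phi : R * R -> R) : mfamily a -> continuous phi -> periodic2 phi ->
  (forall k, phi (opp2 k) = phi k) -> mfamily (fun k => cis (phi k) *: a k).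
Proof.
move=> [ca pa ua ta] cphi pphi ephi; split.
- by apply: mcontZ => //; exact: ccont_cis.
- by split=> x y; rewrite ?pphi.1 ?pphi.2 ?pa.1 ?pa.2.
- by move=> k; apply: unitaryZ => //; exact: nsq_cis.
- by move=> k; rewrite tauZ ta ephi.
Qed.

Lemma phase_homot a (phi : R * R -> R) : mfamily a -> continuous phi -> periodic2 phi ->
  (forall k, phi (opp2 k) = phi k) -> homot a (fun k => cis (phi k) *: a k).
Proof.
move=> fa cphi pphi ephi; exists (fun p => cis (p.1 * phi p.2) *: a p.2); split.
- have [ca _ _ _] := fa.
  apply: mcontZ; last by apply: (mcont_comp ca); exact: cont_snd.
  apply: ccont_cis; apply: rcontM; first exact: cont_fst.
  by apply: (cont_comp cphi); exact: cont_snd.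
- move=> t; apply: (@phase_family a (fun k => t * phi k)) => //=.
  + by apply: rcontM => //; exact: rcont_cst.
  + by split=> x y; rewrite ?pphi.1 ?pphi.2.
  + by move=> k; rewrite ephi.
- by move=> k /=; rewrite mul0r cis0 scale1r.
- by move=> k /=; rewrite mul1r.
Qed.

(** An even map does not wind around the torus. A logarithm [phi] on the square is even, because its
    odd part vanishes at the origin and is locally constant; so it agrees at (1/2, 0) and (- 1/2,
    0), hence along opposite edges. Folding then extends it by periodicity. *)
Lemma even_periodic_lift (f : R * R -> C) : ccont f -> (forall k, nsq (f k) = 1) ->
  periodic2 f -> (forall k, f (opp2 k) = f k) ->
  exists phi : R * R -> R, [/\ continuous phi, periodic2 phi,
    forall k, phi (opp2 k) = phi k & forall k, cis (phi k) = f k].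
Proof.
move=> cf f1 pf ef; have [phi [cphi hphi]] := circle_lift cf f1.
have cis_eq (x y : R) : cis x = cis y -> cis (x - y) = 1.
  by move=> h; rewrite cisD cisN h cis_conj.
have even x y : -1 <= x <= 1 -> -1 <= y <= 1 -> phi (- x, - y) = phi (x, y).
  move=> /andP[x1 x2] /andP[y1 y2].
  pose g t := phi (t * x, t * y) - phi (t * - x, t * - y).
  have cg : continuous g.
    apply: rcontB; apply: (cont_comp cphi); apply: cont_pair;
      apply: rcontM; try exact: rcont_cst; move=> ?; exact: cvg_id.
  suff : g 0 = g 1 by rewrite /g !mul0r !mul1r subrr; lra.
  apply: cis_locally_constant => // t /andP[t0 t1]; apply: cis_eq.
  rewrite !hphi /=; try by apply/andP; split; nra.
  by rewrite -(ef (t * x, t * y)) /opp2 /= !mulrN.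
have half1 y : 0 <= y <= 1 -> phi (- (1 / 2), y) = phi (1 / 2, y).
  move=> /andP[y0 y1].
  pose g t := phi (1 / 2, t) - phi (- (1 / 2), t).
  have cg : continuous g.
    apply: rcontB; apply: (cont_comp cphi); apply: cont_pair;
      try exact: rcont_cst; move=> ?; exact: cvg_id.
  have g0 : g 0 = 0.
    rewrite /g -(even (1 / 2) 0) ?oppr0 ?subrr //; apply/andP; split; lra.
  suff : g 0 = g y by rewrite g0 /g; lra.
  apply: cis_locally_constant => // t /andP[t0 t1]; apply: cis_eq.
  rewrite !hphi /=; try by apply/andP; split; lra.
  by rewrite -(pf.1 (- (1 / 2))); congr (f (_, _)); lra.
have half2 x : 0 <= x <= 1 -> phi (x, - (1 / 2)) = phi (x, 1 / 2).
  move=> /andP[x0 x1].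
  pose g t := phi (t, 1 / 2) - phi (t, - (1 / 2)).
  have cg : continuous g.
    apply: rcontB; apply: (cont_comp cphi); apply: cont_pair;
      try exact: rcont_cst; move=> ?; exact: cvg_id.
  have g0 : g 0 = 0.
    rewrite /g -(even 0 (1 / 2)) ?oppr0 ?subrr //; apply/andP; split; lra.
  suff : g 0 = g x by rewrite g0 /g; lra.
  apply: cis_locally_constant => // t /andP[t0 t1]; apply: cis_eq.
  rewrite !hphi /=; try by apply/andP; split; lra.
  by rewrite -(pf.2 _ (- (1 / 2))); congr (f (_, _)); lra.
(* Up to k |-> - k the torus has two cells; the sign of the product of the waves tells which one
   contains k, and the branches agree on its zeros by [agree]. *)
pose psi (k : R * R) := if 0 <= swave k.1 * swave k.2 then phi (fold k.1, fold k.2)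
                         else phi (fold k.1, - fold k.2).
have fb (x : R) : -1 <= fold x <= 1 by have := fold_itv x; move=> /andP[? ?]; apply/andP; split; lra.
have fb' (x : R) : -1 <= - fold x <= 1 by have := fb x; move=> /andP[? ?]; apply/andP; split; lra.
have agree (x y : R) : swave x * swave y = 0 -> phi (fold x, fold y) = phi (fold x, - fold y).
  have f01 (z : R) : 0 <= fold z <= 1 by have := fold_itv z; move=> /andP[? ?]; apply/andP; split; lra.
  move=> /eqP; rewrite mulf_eq0 => /orP[] /eqP /swave_eq0[] h; rewrite h.
  - have z0 : -1 <= (0 : R) <= 1 by apply/andP; split; lra.
    by rewrite -(even 0 (fold y) z0 (fb y)) oppr0.
  - have z2 : -1 <= (1 / 2 : R) <= 1 by apply/andP; split; lra.
    by rewrite -(half1 _ (f01 y)) -(even (1 / 2) (- fold y) z2 (fb' y)) opprK.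
  - by rewrite oppr0.
  - by rewrite half2.
exists psi; split.
- apply: rcont_glue.
  + by apply: rcontM; apply: cont_swave; [exact: cont_fst|exact: cont_snd].
  + by apply: (cont_comp cphi); apply: cont_pair; apply: cont_fold; [exact: cont_fst|exact: cont_snd].
  + apply: (cont_comp cphi); apply: cont_pair; last apply: rcontN; apply: cont_fold;
      [exact: cont_fst|exact: cont_snd].
  + by move=> k; exact: agree.
- by split=> x y; rewrite /psi /= swaveD1 foldD1.
- by move=> k; rewrite /psi /= !swaveN !foldN mulrNN.
- move=> k; rewrite /psi.
  have ef' x y : f (- x, - y) = f (x, y) by exact: (ef (x, y)).
  have [[s1 [s2 ->]]|[[s1 [s2 ->]]|[[s1 [s2 ->]]|[s1 [s2 ->]]]]] := fold2_decomp k pf.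
  + by rewrite mulr_ge0 // hphi ?fb.
  + by rewrite mulr_le0 // hphi ?fb // ef'.
  + case: ifP => h; last by rewrite hphi ?fb ?fb'.
    rewrite agree ?hphi ?fb ?fb' //.
    by apply/eqP; rewrite eq_le h andbT mulr_ge0_le0.
  + rewrite -[f (- _, _)]ef' opprK; case: ifP => h; last by rewrite hphi ?fb ?fb'.
    rewrite agree ?hphi ?fb ?fb' //.
    by apply/eqP; rewrite eq_le h andbT mulr_le0_ge0.
Qed.

Lemma det_even_periodic a : mfamily a ->
  [/\ ccont (fun k => \det (a k)), forall k, nsq (\det (a k)) = 1,
    periodic2 (fun k => \det (a k)) & forall k, \det (a (opp2 k)) = \det (a k)].
Proof.
move=> [ca pa ua ta]; split.
- exact: ccont_det.
- by move=> k; exact: unitary_det.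
- by split=> x y; rewrite ?pa.1 ?pa.2.
- by move=> k; rewrite -[in RHS]ta det_tau.
Qed.

Lemma normalization a : (0 < m)%N -> mfamily a -> exists phi : R * R -> R,
  [/\ continuous phi, forall k, cis (phi k) = \det (a k),
    SUfamily (fun k => cis (- phi k / m%:R) *: a k) &
    homot a (fun k => cis (- phi k / m%:R) *: a k)].
Proof.
move=> m0 fa; have [cd d1 pd ed] := det_even_periodic fa.
have [phi [cphi pphi ephi hphi]] := even_periodic_lift cd d1 pd ed.
have cp : continuous (fun k => - phi k / m%:R).
  by apply: rcontM; [exact: rcontN|exact: rcont_cst].
have pp : periodic2 (fun k => - phi k / m%:R) by split=> x y; rewrite ?pphi.1 ?pphi.2.
have ep k : - phi (opp2 k) / m%:R = - phi k / m%:R by rewrite ephi.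
exists phi; split=> //; last exact: (phase_homot fa cp pp ep).
split; first exact: (phase_family fa cp pp ep).
move=> k; rewrite detZ -cisMn -[X in cis X]mulr_natr divfK ?pnatr_eq0 -?lt0n //.
by rewrite cisN -hphi mulrC cis_conj.
Qed.

End Families.

(** * The Cayley transform and norm estimates *)

Section Cayley.
Variable R : realType.
Local Notation C := R[i].

Lemma invmx_unique n (A B : 'M[C]_n) : A *m B = 1%:M -> invmx A = B.
Proof.
by move=> h; rewrite -[LHS]mulmx1 -h mulKmx //; have [] := mulmx1_unit h.
Qed.

Lemma unit_det n (A : 'M[C]_n) : \det A != 0 -> A \in unitmx.
Proof. by rewrite unitmxE unitfE. Qed.

(** A rational substitute for exponential and logarithm: it is its own inverse, exchanges
    antihermitian matrices with the unitary matrices without eigenvalue -1, and respects [tau] and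
    intertwining relations. *)
Definition cay n (X : 'M[C]_n) := (1%:M - X) *m invmx (1%:M + X).

Lemma cay0 n : cay (0 : 'M[C]_n) = 1%:M.
Proof. by rewrite /cay subr0 addr0 mul1mx (@invmx_unique _ _ 1%:M) ?mulmx1. Qed.

Lemma cay_intertwine n (A X Y : 'M[C]_n) : \det (1%:M + X) != 0 -> \det (1%:M + Y) != 0 ->
  Y *m A = A *m X -> cay Y *m A = A *m cay X.
Proof.
move=> /unit_det hX /unit_det hY h; rewrite /cay.
have h' : invmx (1%:M + Y) *m A = A *m invmx (1%:M + X).
  have E : (1%:M + Y) *m A = A *m (1%:M + X) by rewrite mulmxDl mulmxDr mul1mx mulmx1 h.
  by rewrite -[A in LHS](mulmxK hX) -E -(mulmxA _ A) mulKmx.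
by rewrite -mulmxA h' mulmxA mulmxBl mul1mx h mulmxA mulmxBr mulmx1.
Qed.

Lemma cayC n (X : 'M[C]_n) : \det (1%:M + X) != 0 ->
  cay X = invmx (1%:M + X) *m (1%:M - X).
Proof.
move=> hX; have hu := unit_det hX.
have h : (1%:M - X) *m (1%:M + X) = (1%:M + X) *m (1%:M - X).
  have -> : (1%:M - X) *m (1%:M + X) = 1%:M - X *m X.
    by rewrite mulmxBl mul1mx mulmxDr mulmx1 opprD addrA addrK.
  by rewrite mulmxDl mul1mx mulmxBr mulmx1 addrA subrK.
by rewrite /cay -[LHS](mulKmx hu) (mulmxA (1%:M + X)) -h mulmxK.
Qed.

Lemma antihermitian_det n (X : 'M[C]_n) : dag X = - X -> \det (1%:M + X) != 0.
Proof.
move=> hX; apply/negP => /det0P[v v0 hv].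
have hu : X *m dag v = dag v.
  have /(congr1 (@dag R _ _)) : v + v *m X = 0 by rewrite -[v in v + _]mulmx1 -mulmxDr.
  rewrite dagD dagM hX mulNmx => /eqP; rewrite /dag trmx0 map_mx0 subr_eq0 => /eqP.
  by move=> <-.
have h : dag (dag v) *m dag v = - (dag (dag v) *m dag v).
  by rewrite -{1}hu dagM hX mulmxN mulNmx -mulmxA hu.
have /eqP : sqn (dag v) = 0.
  have : (sqn (dag v))%:C = - (sqn (dag v))%:C by rewrite !sqnE /ip {1}h mxE.
  by move=> /(congr1 (@complex.Re R)) /=; lra.
rewrite sqn_eq0 => /eqP/(congr1 (@dag R _ _)); rewrite dagK /dag trmx0 map_mx0 => v00.
by rewrite v00 eqxx in v0.
Qed.

Lemma dag_invmx n (A : 'M[C]_n) : A \in unitmx -> dag (invmx A) = invmx (dag A).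
Proof.
by move=> hA; symmetry; apply: invmx_unique; rewrite -dagM mulVmx // dag1.
Qed.

Lemma cay_unitary n (X : 'M[C]_n) : dag X = - X -> unitary_mx (cay X).
Proof.
move=> hX; have h1 := unit_det (antihermitian_det hX).
have h2 : 1%:M - X \in unitmx.
  by apply: unit_det; apply: antihermitian_det; rewrite dagN hX.
rewrite /unitary_mx cayC ?antihermitian_det // dagM dag_invmx // dagB dagD dag1 hX opprK.
rewrite -[X in X *m _]/((1%:M + X) *m invmx (1%:M - X)).
rewrite -cayC ?antihermitian_det // /cay mulmxA mulmxKV //.
by rewrite mulmxV.
Qed.

Lemma cay_of_unitary n (U : 'M[C]_n) : unitary_mx U -> \det (1%:M + U) != 0 ->
  dag (cay U) = - cay U /\ cay (cay U) = U.
Proof.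
move=> hU hd; have hu := unit_det hd.
have UC := unitaryC hU.
split.
  rewrite {2}cayC // {1}/cay dagM dag_invmx // dagB dagD dag1.
  have -> : 1%:M - dag U = - (dag U *m (1%:M - U)).
    by rewrite mulmxBr mulmx1 hU opprB.
  have -> : invmx (1%:M + dag U) = invmx (1%:M + U) *m U.
    apply: invmx_unique; have -> : 1%:M + dag U = dag U *m (1%:M + U).
      by rewrite mulmxDr mulmx1 hU addrC.
    by rewrite mulmxA mulmxK // hU.
  by rewrite mulmxN -mulmxA (mulmxA U) UC mul1mx.
have two : (2 : C) != 0 by rewrite pnatr_eq0.
have e1 : 1%:M + cay U = 2 *: invmx (1%:M + U).
  rewrite -[1%:M in LHS](mulmxV hu) /cay -mulmxDl addrACA subrr addr0.
  by rewrite -[1%:M + 1%:M]mulr2n -scaler_nat -scalemxAl mul1mx.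
have e2 : 1%:M - cay U = 2 *: (U *m invmx (1%:M + U)).
  rewrite -[1%:M in LHS](mulmxV hu) /cay -mulmxBl scalemxAl; congr (_ *m _).
  by apply/matrixP => i j; rewrite !mxE; ring.
rewrite {1}/cay e1 e2 (@invmx_unique _ (2 *: invmx (1%:M + U)) (2^-1 *: (1%:M + U))).
  by rewrite -scalemxAl -scalemxAr scalerA mulfV // scale1r -mulmxA mulVmx // mulmx1.
by rewrite -scalemxAl -scalemxAr scalerA mulfV // scale1r mulVmx.
Qed.


(** The entrywise l^1 norm: submultiplicative, invariant under transposition and adjoint, and
    controlled by the entries. *)
Definition sumnorm m n (A : 'M[C]_(m, n)) : R := \sum_i \sum_j normc (A i j).

Lemma normc_ge0 (z : C) : 0 <= normc z.
Proof. by case: z => a b; exact: sqrtr_ge0. Qed.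

Lemma sumnorm_ge0 m n (A : 'M[C]_(m, n)) : 0 <= sumnorm A.
Proof. by apply: sumr_ge0 => i _; apply: sumr_ge0 => j _; exact: normc_ge0. Qed.

Lemma sumnormD m n (A B : 'M[C]_(m, n)) : sumnorm (A + B) <= sumnorm A + sumnorm B.
Proof.
rewrite /sumnorm -big_split /=; apply: ler_sum => i _.
rewrite -big_split /=; apply: ler_sum => j _.
by rewrite mxE le_normcD.
Qed.

Lemma sumnormZ m n a (A : 'M[C]_(m, n)) : sumnorm (a *: A) = normc a * sumnorm A.
Proof.
rewrite /sumnorm mulr_sumr; apply: eq_bigr => i _.
by rewrite mulr_sumr; apply: eq_bigr => j _; rewrite mxE normcM.
Qed.

Lemma sumnormM m n p (A : 'M[C]_(m, n)) (B : 'M[C]_(n, p)) :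
  sumnorm (A *m B) <= sumnorm A * sumnorm B.
Proof.
rewrite /sumnorm mulr_suml; apply: ler_sum => i _.
apply: (@le_trans _ _ (\sum_k \sum_j normc (A i j) * normc (B j k))).
  apply: ler_sum => k _; rewrite mxE.
  elim/big_ind2: _ => [|x1 y1 x2 y2 h1 h2|j _]; first by rewrite normc0.
    by apply: le_trans (le_normcD _ _) _; exact: lerD.
  by rewrite normcM.
rewrite exchange_big /= mulr_suml; apply: ler_sum => j _.
rewrite -mulr_sumr ler_wpM2l ?normc_ge0 //.
rewrite [leRHS](bigD1 j) //= lerDl; apply: sumr_ge0 => l _.
by apply: sumr_ge0 => k _; exact: normc_ge0.
Qed.

Lemma sumnorm_dag m n (A : 'M[C]_(m, n)) : sumnorm (dag A) = sumnorm A.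
Proof.
rewrite /sumnorm exchange_big /=; apply: eq_bigr => i _; apply: eq_bigr => j _.
by rewrite dagE; case: (A i j) => a b; rewrite /normc /= sqrrN.
Qed.

Lemma sumnorm_tr m n (A : 'M[C]_(m, n)) : sumnorm A^T = sumnorm A.
Proof.
by rewrite /sumnorm exchange_big /=; apply: eq_bigr => i _; apply: eq_bigr => j _; rewrite mxE.
Qed.

Lemma sumnorm_entry m n (A : 'M[C]_(m, n)) i j :
  `|complex.Re (A i j)| <= sumnorm A /\ `|complex.Im (A i j)| <= sumnorm A.
Proof.
have h : normc (A i j) <= sumnorm A.
  rewrite /sumnorm (bigD1 i) //= (bigD1 j) //= -addrA lerDl addr_ge0 //.
    by apply: sumr_ge0 => l _; exact: normc_ge0.
  by apply: sumr_ge0 => l _; apply: sumr_ge0 => k _; exact: normc_ge0.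
case: (A i j) h => a b; rewrite /normc /= => h.
have e : 0 <= a ^+ 2 + b ^+ 2 by rewrite addr_ge0 // sqr_ge0.
by split; apply: le_trans h; rewrite -sqrtr_sqr ler_sqrt // ?lerDl ?lerDr sqr_ge0.
Qed.

Lemma sumnorm_bound m n (A : 'M[C]_(m, n)) e :
  (forall i j, `|complex.Re (A i j)| <= e /\ `|complex.Im (A i j)| <= e) ->
  sumnorm A <= (m * n)%:R * (2 * e).
Proof.
move=> h; rewrite natrM -mulrA.
have -> : m%:R * (n%:R * (2 * e)) = \sum_(i < m) \sum_(j < n) (2 * e).
  by rewrite !sumr_const !card_ord -[RHS]mulr_natl -[X in _ = _ * X]mulr_natl.
apply: ler_sum => i _; apply: ler_sum => j _; have [h1 h2] := h i j.
rewrite [A i j]complexE; apply: le_trans (le_normcD _ _) _.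
rewrite normcM; case: (A i j) h1 h2 => a b /= h1 h2.
rewrite !expr0n /= !addr0 !add0r expr1n sqrtr1 mul1r !sqrtr_sqr mulr2n mulrDl mul1r.
exact: lerD.
Qed.

Lemma sumnorm_unitary n (A : 'M[C]_n) : unitary_mx A -> sumnorm A <= (n * n)%:R * 2.
Proof.
move=> uA; rewrite -[2]mulr1; apply: sumnorm_bound => i j.
have h : nsq (A i j) <= 1.
  have /matrixP/(_ j j) := uA; rewrite !mxE eqxx => /(congr1 (@complex.Re R)).
  have -> : \sum_k dag A j k * A k j = (\sum_k nsq (A k j))%:C.
    rewrite (raddf_sum (real_complex R)); apply: eq_bigr => k _.
    by rewrite dagE mulrC -nsqE.
  rewrite /= => <-; rewrite (bigD1 i) //= lerDl.
  by apply: sumr_ge0 => k _; exact: nsq_ge0.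
move: h; rewrite /nsq => h.
by split; rewrite ler_norml; apply/andP; split; nra.
Qed.

Lemma normc2 : normc (2 : C) = 2.
Proof.
rewrite -(rmorph_nat (real_complex R)) /normc /= expr0n addr0 sqrtr_sqr.
by rewrite ger0_norm.
Qed.

(** A row vector killed by 1 + U is doubled by 1 - U, which has norm less than 2. *)
Lemma near_one_det n (U : 'M[C]_n) : sumnorm (1%:M - U) < 2 -> \det (1%:M + U) != 0.
Proof.
move=> h; apply/negP => /det0P[v v0 hv].
have e : (2 : C) *: v = v *m (1%:M - U).
  have vU : v *m U = - v.
    by apply/eqP; rewrite -addr_eq0 addrC -[v in v + _]mulmx1 -mulmxDr hv.
  by rewrite mulmxBr mulmx1 vU opprK scaler_nat mulr2n.
have := sumnormM v (1%:M - U); rewrite -e sumnormZ.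
rewrite normc2.
have : 0 < sumnorm v.
  rewrite lt_neqAle sumnorm_ge0 andbT eq_sym; apply: contra v0 => /eqP sv.
  apply/eqP/matrixP => i j; rewrite mxE.
  have [] := sumnorm_entry v i j; rewrite sv !normr_le0 => /eqP h1 /eqP h2.
  by apply/eqP; rewrite eq_complex h1 h2 !eqxx.
nra.
Qed.

(** From [2 cay U = (1 - U) + cay U (1 - U)] and r = |1 - U| <= 1 one gets 2 |cay U| <= r + |cay
    U|. *)
Lemma cay_bound n (U : 'M[C]_n) : sumnorm (1%:M - U) <= 1 ->
  sumnorm (cay U) <= sumnorm (1%:M - U).
Proof.
move=> h; have hu : 1%:M + U \in unitmx by apply/unit_det/near_one_det; lra.
have e : (2 : C) *: cay U = (1%:M - U) + cay U *m (1%:M - U).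
  have : cay U *m (1%:M + U) = 1%:M - U by rewrite /cay mulmxKV.
  rewrite mulmxDr mulmxBr !mulmx1 scaler_nat mulr2n => <-.
  by rewrite addrACA subrr addr0.
have := sumnormD (1%:M - U) (cay U *m (1%:M - U)); rewrite -e sumnormZ.
rewrite normc2.
have := sumnormM (cay U) (1%:M - U); have := sumnorm_ge0 (cay U); have := sumnorm_ge0 (1%:M - U).
nra.
Qed.

Lemma mcont_cay (T : topologicalType) n (F : T -> 'M[C]_n) : mcont F ->
  (forall x, \det (1%:M + F x) != 0) -> mcont (fun x => cay (F x)).
Proof.
move=> cF hF; apply: mcontM; first by apply: mcontB => //; exact: mcont_cst.
by apply: mcontV => //; apply: mcontD => //; exact: mcont_cst.
Qed.

(** Continuity at X = 0, where the determinant is 1. Matrices are parametrised by their real and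
    imaginary parts and projected to the antihermitian ones, so that 1 + X is invertible everywhere.
    Positivity of the real part is what [arg] requires. *)
Lemma small_cay_det n : exists2 eta : R, 0 < eta & forall X : 'M[C]_n,
  dag X = - X -> sumnorm X < eta -> 0 < complex.Re (\det (cay X)).
Proof.
pose Z (p : 'M[R]_n * 'M[R]_n) : 'M[C]_n := \matrix_(i, j) (p.1 i j +i* p.2 i j).
pose Y p := (2^-1 : C) *: (Z p - dag (Z p)).
have cZ : mcont Z.
  move=> i j; under eq_fun do rewrite mxE.
  split=> /=.
    by apply: (@cont_comp _ _ _ fst (fun M : 'M[R]_n => M i j));
      [exact: coord_continuous|exact: cont_fst].
  by apply: (@cont_comp _ _ _ snd (fun M : 'M[R]_n => M i j));
      [exact: coord_continuous|exact: cont_snd].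
have cY : mcont Y.
  apply: mcontZ; first exact: ccont_cst.
  by apply: mcontB => //; exact: mcont_dag.
have aY p : dag (Y p) = - Y p.
  by rewrite /Y dagZ dagB dagK fmorphV rmorph_nat -scalerN opprB.
have [cd _] := ccont_det (mcont_cay cY (fun p => antihermitian_det (aY p))).
have [f fE] : exists f, f = fun p => complex.Re (\det (cay (Y p))) by eexists.
rewrite -fE in cd.
have d0 : f (0, 0) = 1.
  rewrite fE.
  have -> : Y (0, 0) = 0.
    have Z0 : Z (0, 0) = 0 by apply/matrixP => i j; rewrite !mxE.
    by rewrite /Y Z0 /dag trmx0 map_mx0 subr0 scaler0.
  by rewrite cay0 det1.
have /cvgrPdist_lt/(_ 1 ltr01)/nbhs_ballP[eta /= eta0 heta] := cd (0, 0).
exists eta => // X aX sX.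
pose P : 'M[R]_n * 'M[R]_n := (\matrix_(i, j) complex.Re (X i j), \matrix_(i, j) complex.Im (X i j)).
have eX : Y P = X.
  have -> : Y P =
      (2^-1 : C) *: (X - dag X).
    rewrite /Y; congr (_ *: (_ - dag _)); apply/matrixP => i j; rewrite !mxE;
      by case: (X i j).
  have -> : X - dag X = (2 : C) *: X by rewrite aX opprK scaler_nat mulr2n.
  by rewrite scalerA mulVf ?scale1r // pnatr_eq0.
have hP : ball (0 : 'M[R]_n, 0 : 'M[R]_n) eta P.
  split=> /=.
    split=> // i j; rewrite !mxE /ball /= sub0r normrN.
    by apply: le_lt_trans sX; have [] := sumnorm_entry X i j.
  split=> // i j; rewrite !mxE /ball /= sub0r normrN.
  by apply: le_lt_trans sX; have [] := sumnorm_entry X i j.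
have {hP} := heta P hP; rewrite d0.
have -> : complex.Re (\det (cay X)) = f P by rewrite fE eX.
by rewrite ltr_norml; lra.
Qed.

End Cayley.

(** * Moving a family at one fixed point of the reflection *)

Section VertexStep.
Variable R : realType.
Local Notation C := R[i].
Variables (m : nat) (eps : 'M[C]_m).
Hypothesis eps_form : matching_form eps.
Local Notation tau := (tau eps).
Local Notation mfamily := (mfamily eps).
Local Notation SUfamily := (SUfamily eps).
Local Notation homot := (homot eps).

Lemma arg1 : arg (1 : C) = 0.
Proof.
rewrite /arg /= -[X in asin X](@sin0 R) sinK // in_itv /=.
by have := pi_ge0 R => p0; apply/andP; split; lra.
Qed.

Lemma tau_invmx A : A \in unitmx -> tau (invmx A) = invmx (tau A).
Proof.
by move=> hA; symmetry; apply: invmx_unique; rewrite -tauM // mulVmx // tau1.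
Qed.

Lemma tau_cay X : \det (1%:M + X) != 0 -> tau (cay X) = cay (tau X).
Proof.
move=> hX; have hX' : \det (1%:M + tau X) != 0 by rewrite -(tau1 eps_form) -tauD det_tau.
rewrite [RHS](cayC hX') /cay (tauM eps_form) (tau_invmx (unit_det hX)).
by rewrite tauB tauD (tau1 eps_form).
Qed.

Lemma antihermitian_tau X : dag X = - X -> dag (tau X) = - tau X.
Proof. by move=> hX; rewrite -tau_dag // hX tauN. Qed.

Lemma cayley_family a X : mfamily a -> mcont X -> (forall k, dag (X k) = - X k) -> periodic2 X ->
  (forall k, tau (X (opp2 k)) *m a k = a k *m X k) -> mfamily (fun k => a k *m cay (X k)).
Proof.
move=> [ca pa ua ta] cX aX pX tX; split.
- by apply: mcontM => //; apply: mcont_cay => // k; exact: antihermitian_det.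
- by split=> x y; rewrite ?pa.1 ?pa.2 ?pX.1 ?pX.2.
- by move=> k; apply: unitaryM => //; exact: cay_unitary.
- move=> k; rewrite tauM // ta tau_cay ?antihermitian_det //.
  by apply: cay_intertwine; rewrite ?antihermitian_det //; exact: antihermitian_tau.
Qed.

(** With [Y = tau X], adding to [X] its image under [tau] and conjugation by [B] yields the relation
    that [cayley_family] asks for; this lets one constant matrix be spread over the torus. *)
Lemma intertwining_average (B X Y : 'M[C]_m) : unitary_mx B ->
  (Y + B *m (X *m dag B)) *m B = B *m (X + dag B *m Y *m B).
Proof.
move=> uB; rewrite mulmxDl mulmxDr addrC; congr (_ + _).
  by rewrite -mulmxA -(mulmxA X) uB mulmx1.
by rewrite -(mulmxA (dag B)) mulmxA (unitaryC uB) mul1mx.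
Qed.

(** Representatives in [0, 1/2] of the solutions of x = - x modulo 1. *)
Definition half_integer (c : R) := c = 0 \/ c = 1 / 2.
Definition vertex (v : R * R) := half_integer v.1 /\ half_integer v.2.

Definition bump1 (c x : R) : R := 1 - 2 * `|fold x - c|.
Definition vbump (v k : R * R) : R := bump1 v.1 k.1 * bump1 v.2 k.2.

Lemma bump1_itv c x : half_integer c -> 0 <= bump1 c x <= 1.
Proof.
move=> hc; rewrite /bump1; have /andP[f0 f1] := fold_itv x.
by case: hc => ->; [rewrite ger0_norm|rewrite ler0_norm]; try lra; apply/andP; split; lra.
Qed.

Lemma bump_itv v k : vertex v -> 0 <= vbump v k <= 1.
Proof.
move=> [h1 h2]; have /andP[a b] := bump1_itv k.1 h1; have /andP[c d] := bump1_itv k.2 h2.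
by rewrite /vbump mulr_ge0 //= mulr_ile1.
Qed.

Lemma fold_half_integer c : half_integer c -> fold c = c.
Proof. by case=> ->; apply: fold_id; apply/andP; split; lra. Qed.

Lemma bump_vertex v w : vertex v -> vertex w -> vbump v w = if v == w then 1 else 0.
Proof.
have H (c d : R) : half_integer c -> half_integer d -> bump1 c d = if c == d then 1 else 0.
  move=> hc hd; rewrite /bump1 fold_half_integer //.
  have h0 : (0 == 1 / 2 :> R) = false by apply/eqP; lra.
  have hn : 2 * `|1 / 2| = 1 :> R by rewrite ger0_norm; lra.
  case: hc hd => -> [] ->; rewrite ?eqxx ?subrr ?normr0 ?mulr0 ?subr0 //.
    by rewrite h0 hn subrr.
  by rewrite eq_sym h0 sub0r normrN hn subrr.
case: v w => [v1 v2] [w1 w2] [h1 h2] [h3 h4]; rewrite /vbump /= !H // xpair_eqE.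
by case: (v1 == w1); case: (v2 == w2); rewrite ?mulr1 ?mulr0.
Qed.

Lemma cont_bump1 (T : topologicalType) (f : T -> R) c : continuous f ->
  continuous (fun t => bump1 c (f t)).
Proof.
move=> cf; apply: rcontB; first exact: rcont_cst.
apply: rcontM; first exact: rcont_cst.
by apply: rcont_norm; apply: rcontB; [exact: cont_fold|exact: rcont_cst].
Qed.

Lemma cont_bump v : continuous (vbump v).
Proof.
by apply: rcontM; apply: cont_bump1; [exact: cont_fst|exact: cont_snd].
Qed.

Lemma bump_periodic v : periodic2 (vbump v).
Proof. by split=> x y; rewrite /vbump /bump1 /= foldD1. Qed.

Lemma bump_even v k : vbump v (opp2 k) = vbump v k.
Proof. by rewrite /vbump /bump1 /= !foldN. Qed.

Lemma vertex_opp (X : Type) (f : R * R -> X) v : periodic2 f -> vertex v -> f (opp2 v) = f v.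
Proof.
case: v => x y [h1 h2] [/= hx hy]; rewrite /opp2 /=.
have E1 z : f (- x, z) = f (x, z).
  by case: hx => ->; rewrite ?oppr0 // -(h1 (- (1 / 2))); congr (f (_, _)); lra.
have E2 z : f (z, - y) = f (z, y).
  by case: hy => ->; rewrite ?oppr0 // -(h2 _ (- (1 / 2))); congr (f (_, _)); lra.
by rewrite E1 E2.
Qed.

(** The Cayley transform of A^-1 S, with A the value at v, is an antihermitian X0 that leads from A
    to S; symmetrised over the torus and weighted by a bump, it alters no other vertex. The bound
    [d] is the same for all b, v and S, so that a path can be followed in finitely many steps. *)
Lemma vertex_step : exists2 d : R, 0 < d & forall b v S, SUfamily b -> vertex v ->
  SU S -> tau S = S -> sumnorm (S - b v) < d ->
  exists b', [/\ SUfamily b', homot b b', b' v = S &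
    forall w, vertex w -> w != v -> b' w = b w].
Proof.
have [eta eta0 heta] := small_cay_det R m.
pose M : R := (m * m)%:R * 2.
pose E : R := sumnorm eps.
have M0 : 0 <= M by rewrite mulr_ge0.
have E0 : 0 <= E by exact: sumnorm_ge0.
(* [M] bounds a unitary matrix and [E] bounds [eps]; [tau] costs a factor E^2 and conjugation by
   [b k] a factor M^2, so K bounds the growth caused by the symmetrisation. *)
pose K := 1 + (M * E) * (M * E).
have ME0 : 0 <= M * E by exact: mulr_ge0.
have K1 : 1 <= K by rewrite lerDl mulr_ge0.
(* The bound by 1 keeps 1 + U invertible, the one by [eta] keeps the determinant of [cay (X k)] in
   the right half plane; the factor 1/2 in [X] makes the latter strict. *)
pose d := Num.min 1 eta / (K * (M + 1)).
have KM : 0 < K * (M + 1) by rewrite mulr_gt0; lra.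
have d0 : 0 < d by rewrite divr_gt0 // lt_min ltr01.
have hd : d * (K * (M + 1)) = Num.min 1 eta by rewrite divfK // gt_eqF.
have [d1 d2] : d * (K * (M + 1)) <= 1 /\ d * (K * (M + 1)) <= eta.
  by rewrite hd !ge_min !lexx orbT.
exists d => // b v S [fb db] hv sS tS hS.
have [cb pb ub tb] := fb.
set A := b v in hS.
have tA : tau A = A by rewrite /A -[in LHS](vertex_opp pb hv) tb.
pose U := dag A *m S.
have uA : unitary_mx A by exact: ub.
have uU : unitary_mx U by apply: unitaryM; [exact: unitary_dag|case: sS].
have AU : A *m U = S by rewrite /U mulmxA unitaryC // mul1mx.
have tU : tau U *m A = A *m U.
  by rewrite AU /U tauM // tS tau_dag // tA -mulmxA ub mulmx1.
have nU : sumnorm (1%:M - U) <= M * d.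
  have -> : 1%:M - U = dag A *m (A - S) by rewrite mulmxBr ub.
  apply: le_trans (sumnormM _ _) _; apply: ler_pM; rewrite ?sumnorm_ge0 //.
    by apply: sumnorm_unitary; apply: unitary_dag; exact: ub.
  by rewrite -opprB -scaleN1r sumnormZ normcN normc1 mul1r ltW.
have Md1 : M * d <= 1 by nra.
have nU1 : sumnorm (1%:M - U) <= 1 by exact: le_trans nU Md1.
have hU : \det (1%:M + U) != 0 by apply: near_one_det; apply: le_lt_trans nU1 _; lra.
have [aX0 cX0] := cay_of_unitary uU hU.
have [X0 eX0] : exists X0, X0 = cay U by eexists.
rewrite -eX0 in aX0 cX0.
have nX0 : sumnorm X0 <= M * d by rewrite eX0; exact: le_trans (cay_bound nU1) nU.
have tX0 : tau X0 *m A = A *m X0.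
  rewrite eX0 tau_cay //; apply: cay_intertwine => //.
  by rewrite -(tau1 eps_form) -tauD det_tau.
pose X k := (2^-1 * vbump v k)%:C *: (X0 + dag (b k) *m tau X0 *m b k).
have cX : mcont X.
  apply: mcontZ.
    by apply: ccont_real; apply: rcontM; [exact: rcont_cst|exact: cont_bump].
  apply: mcontD; first exact: mcont_cst.
  by apply: mcontM => //; apply: mcontM; [exact: mcont_dag|exact: mcont_cst].
have aX k : dag (X k) = - X k.
  have aY := antihermitian_tau aX0.
  rewrite /X dagZ dagD conjc_real aX0 -mulmxA dagM (dagM (tau X0)) dagK aY.
  by rewrite mulmxN mulNmx -opprD scalerN mulmxA.
have pX : periodic2 X.
  by split=> x y; rewrite /X ?(bump_periodic v).1 ?(bump_periodic v).2 ?pb.1 ?pb.2.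
have tX k : tau (X (opp2 k)) *m b k = b k *m X k.
  rewrite /X tauZ bump_even tauD (tauM eps_form) (tauM eps_form (dag _)) (tauK eps_form)
    (tau_dag eps_form) tb.
  by rewrite -scalemxAl -scalemxAr intertwining_average.
have nX k : sumnorm (X k) < eta.
  have n1 : sumnorm (dag (b k) *m tau X0 *m b k) <= M * (E * sumnorm X0 * E) * M.
    have nb : sumnorm (b k) <= M by exact: sumnorm_unitary.
    apply: le_trans (sumnormM _ _) _; apply: ler_pM; rewrite ?sumnorm_ge0 //.
    apply: le_trans (sumnormM _ _) _; apply: ler_pM; rewrite ?sumnorm_ge0 ?sumnorm_dag //.
    apply: le_trans (sumnormM _ _) _; apply: ler_pM; rewrite ?sumnorm_ge0 //.
    apply: le_trans (sumnormM _ _) _; apply: ler_pM; rewrite ?sumnorm_ge0 ?sumnorm_tr //.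
  have n2 : sumnorm (X0 + dag (b k) *m tau X0 *m b k) <= K * sumnorm X0.
    apply: le_trans (sumnormD _ _) _; rewrite /K mulrDl mul1r lerD2l.
    by apply: le_trans n1 _; rewrite le_eqVlt; apply/orP; left; apply/eqP; ring.
  have /andP[r0 r1] := bump_itv k hv.
  have h : sumnorm (X k) <= 2^-1 * (K * sumnorm X0).
    rewrite /X sumnormZ; have -> : normc (2^-1 * vbump v k)%:C = 2^-1 * vbump v k.
      by rewrite /normc /= expr0n addr0 sqrtr_sqr ger0_norm // mulr_ge0 // invr_ge0.
    apply: ler_pM; [|exact: sumnorm_ge0| |exact: n2].
      by rewrite mulr_ge0 // invr_ge0.
    by rewrite ler_piMr // invr_ge0.
  have : K * sumnorm X0 <= K * (M * d) by apply: ler_wpM2l => //; lra.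
  have : K * (M * d) <= d * (K * (M + 1)) by nra.
  lra.
pose D k := \det (cay (X k)).
have D1 k : nsq (D k) = 1 by apply: unitary_det; exact: cay_unitary.
have D0 k : 0 < complex.Re (D k) by exact: heta.
have cD : ccont D by apply: ccont_det; apply: mcont_cay => // k; exact: antihermitian_det.
have pD : periodic2 D by split=> x y; rewrite /D ?pX.1 ?pX.2.
have eD k : D (opp2 k) = D k.
  have h : tau (cay (X (opp2 k))) *m b k = b k *m cay (X k).
    rewrite (tau_cay (antihermitian_det (aX _))).
    apply: (cay_intertwine (antihermitian_det (aX k)) _ (tX k)).
    exact: antihermitian_det (antihermitian_tau (aX _)).
  have := congr1 (@determinant _ _) h.
  by rewrite (det_mulmx (tau _)) (det_tau eps_form) (det_mulmx (b k)) !db mulr1 mul1r.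
(* As D has positive real part, its principal logarithm is continuous, and it inherits periodicity
   and evenness; its m-th part is the phase that restores determinant 1. *)
pose th k := - arg (D k) / m%:R.
have cth : continuous th.
  by apply: rcontM; last exact: rcont_cst; apply: rcontN; exact: cont_arg.
have pth : periodic2 th by split=> x y; rewrite /th ?pD.1 ?pD.2.
have eth k : th (opp2 k) = th k by rewrite /th eD.
have fam t : mfamily (fun k => cis (t * th k) *: (b k *m cay (t%:C *: X k))).
  apply: (@phase_family R m eps (fun k => b k *m cay (t%:C *: X k)) (fun k => t * th k)).
  - apply: (@cayley_family b (fun k => t%:C *: X k) fb).
    + by apply: mcontZ; [exact: ccont_cst|exact: cX].
    + by move=> k; rewrite dagZ conjc_real aX scalerN.
    + by split=> x y; rewrite ?pX.1 ?pX.2.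
    + by move=> k; rewrite tauZ -scalemxAl tX scalemxAr.
  - by apply: rcontM => //; exact: rcont_cst.
  - by split=> x y; rewrite ?pth.1 ?pth.2.
  - by move=> k; rewrite eth.
have th0 k : D k = 1 -> th k = 0.
  by move=> h; rewrite /th h arg1 oppr0 mul0r.
exists (fun k => cis (th k) *: (b k *m cay (X k))); split.
- split.
    have -> : (fun k => cis (th k) *: (b k *m cay (X k))) =
        fun k => cis (1 * th k) *: (b k *m cay (1%:C *: X k)).
      by apply/funext => k; rewrite mul1r scale1r.
    exact: fam.
  move=> k; rewrite detZ det_mulmx db mul1r -/(D k) -cisMn.
  case: (posnP m) => [m00|mp].
    have -> : D k = 1 by rewrite /D; move: (cay (X k)); rewrite m00 => Z; rewrite det_mx00.
    by rewrite m00 mulr0n cis0 mul1r.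
  rewrite -[X in cis X]mulr_natr divfK ?pnatr_eq0 -?lt0n // cisN.
  by rewrite cis_arg // mulrC conj_inv_unit.
- exists (fun p => cis (p.1 * th p.2) *: (b p.2 *m cay (p.1%:C *: X p.2))); split.
  + apply: mcontZ.
      apply: ccont_cis; apply: rcontM; first exact: cont_fst.
      by apply: (cont_comp cth); exact: cont_snd.
    apply: mcontM; first by apply: (mcont_comp cb); exact: cont_snd.
    apply: mcont_cay.
      apply: mcontZ; first by apply: ccont_real; exact: cont_fst.
      by apply: (mcont_comp cX); exact: cont_snd.
    by move=> p; apply: antihermitian_det; rewrite dagZ conjc_real aX scalerN.
  + exact: fam.
  + by move=> k /=; rewrite mul0r cis0 scale1r scale0r cay0 mulmx1.
  + by move=> k /=; rewrite mul1r scale1r.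
- have Xv : X v = X0.
    rewrite /X bump_vertex // eqxx mulr1 -/A -mulmxA tX0 mulmxA ub mul1mx.
    have -> : X0 + X0 = (2 : C) *: X0 by rewrite scaler_nat mulr2n.
    by rewrite scalerA (fmorphV (real_complex R)) (rmorph_nat (real_complex R)) mulVf
      ?scale1r // pnatr_eq0.
  rewrite Xv cX0 -/A AU th0 ?cis0 ?scale1r // /D Xv cX0 /U det_mulmx det_dag db.
  by case: sS => _ ->; rewrite rmorph1 mulr1.
- move=> w hw wv; have Xw : X w = 0.
    by rewrite /X bump_vertex // eq_sym (negPf wv) mulr0 scale0r.
  by rewrite Xw cay0 mulmx1 th0 ?cis0 ?scale1r // /D Xw cay0 det1.
Qed.

End VertexStep.

(** * Paths of symmetric matrices in SU(m) *)

Section SymmetricPaths.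
Variable R : realType.
Local Notation C := R[i].
Variables (m : nat) (eps : 'M[C]_m).
Hypothesis eps_form : matching_form eps.
Local Notation tau := (tau eps).
Local Notation SUfamily := (SUfamily eps).
Local Notation homot := (homot eps).

Definition pathSU (A B : 'M[C]_m) := exists p : R -> 'M[C]_m,
  [/\ mcont p, forall t, SU (p t), forall t, tau (p t) = p t, p 0 = A & p 1 = B].

Lemma pathSU_sym A B : pathSU A B -> pathSU B A.
Proof.
move=> [p [cp sp tp p0 p1]]; exists (fun t => p (1 - t)); split=> //.
- apply: (mcont_comp cp); apply: rcontB; first exact: rcont_cst.
  by move=> x; exact: cvg_id.
- by rewrite subr0.
- by rewrite subrr.
Qed.

Lemma pathSU_trans B A D : pathSU A B -> pathSU B D -> pathSU A D.
Proof.
move=> [p [cp sp tp p0 p1]] [q [cq sq tq q0 q1]].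
have ci : continuous (fun t : R => t) by move=> x; exact: cvg_id.
exists (fun t => if 0 <= 1 / 2 - t then p (2 * t) else q (2 * t - 1)); split.
- apply: mcont_glue.
  + by apply: rcontB => //; exact: rcont_cst.
  + by apply: (mcont_comp cp); apply: rcontM => //; exact: rcont_cst.
  + apply: (mcont_comp cq); apply: rcontB; last exact: rcont_cst.
    by apply: rcontM => //; exact: rcont_cst.
  + move=> t ht; have -> : t = 1 / 2 by lra.
    have -> : 2 * (1 / 2) = 1 :> R by lra.
    by rewrite subrr p1 q0.
- by move=> t; case: ifP.
- by move=> t; case: ifP.
- by rewrite subr0 divr_ge0 // mulr0.
- have -> : (0 <= 1 / 2 - 1 :> R) = false by apply/negP; lra.
  by have -> : 2 * 1 - 1 = 1 :> R by lra.
Qed.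

Lemma pathSU_scale s A B : cis (s *+ m) = 1 -> pathSU A B -> pathSU (cis s *: A) (cis s *: B).
Proof.
move=> hs [p [cp sp tp p0 p1]]; exists (fun t => cis s *: p t); split.
- by apply: mcontZ => //; exact: ccont_cst.
- move=> t; have [u d] := sp t; split; first by apply: unitaryZ => //; exact: nsq_cis.
  by rewrite detZ d -cisMn hs mulr1.
- by move=> t; rewrite tauZ tp.
- by rewrite p0.
- by rewrite p1.
Qed.

(** By uniform continuity the path is cut into steps shorter than the uniform bound of
    [vertex_step]. *)
Lemma vertex_move b v S : SUfamily b -> vertex v -> pathSU (b v) S ->
  exists b', [/\ SUfamily b', homot b b', b' v = S &
    forall w, vertex w -> w != v -> b' w = b w].
Proof.
move=> fb hv [p [cp sp tp p0 p1]].
have [d d0 step] := vertex_step eps_form.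
(* [sumnorm_bound] turns entrywise closeness e into a norm of at most 2 m^2 e, which is less than
   d. *)
pose e := d / ((m * m)%:R * 2 + 1).
have K0 : 0 < (m * m)%:R * 2 + 1 :> R by rewrite ltr_wpDl // mulr_ge0.
have e0 : 0 < e by rewrite divr_gt0.
have cp2 : mcont (fun x : R * R => p x.1) by apply: (mcont_comp cp); exact: cont_fst.
have [r r0 hr] := box_uniform_mcont 0 1 cp2 e0.
have [N hN] := inv_natS_lt r0.
have claim n : (n <= N.+1)%N -> exists b', [/\ SUfamily b', homot b b',
    b' v = p (n%:R / N.+1%:R) & forall w, vertex w -> w != v -> b' w = b w].
  elim: n => [_|n IH nN].
    exists b; split=> //; last by rewrite mul0r p0.
    by apply: homot_refl; case: fb.
  have [b1 [fb1 hb1 bv bw]] := IH (ltnW nN).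
  have close : sumnorm (p (n.+1%:R / N.+1%:R) - b1 v) <= (m * m)%:R * (2 * e).
    apply: sumnorm_bound => i j; rewrite !mxE bv !raddfB /=.
    have b1' : 0 <= (n.+1%:R / N.+1%:R : R) <= 1.
      by rewrite divr_ge0 //= ler_pdivrMr ?ltr0n // mul1r ler_nat.
    have b2' : 0 <= (0 : R) <= 1 by rewrite lexx ler01.
    have b3' : `|n.+1%:R / N.+1%:R - n%:R / N.+1%:R| < r :> R.
      by rewrite -mulrBl -natrB // subSnn mul1r gtr0_norm ?invr_gt0 // ltr0n.
    have b4' : `|(0 : R) - (0 : R)| < r by rewrite subrr normr0.
    have [h1 h2] := hr (n.+1%:R / N.+1%:R, 0) (n%:R / N.+1%:R, 0) b1' b2' b3' b4' i j.
    by split; apply: ltW.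
  have lt_d : sumnorm (p (n.+1%:R / N.+1%:R) - b1 v) < d.
    apply: le_lt_trans close _.
    have : e * ((m * m)%:R * 2 + 1) = d by rewrite divfK // gt_eqF.
    move: e0; lra.
  have [b2 [fb2 hb2 b2v b2w]] := step b1 v _ fb1 hv (sp _) (tp _) lt_d.
  exists b2; split=> //; first exact: homot_trans hb1 hb2.
  by move=> w hw wv; rewrite b2w // bw.
have [b' [h1 h2 h3 h4]] := claim N.+1 (leqnn _).
by exists b'; split=> //; rewrite h3 divff ?p1 // pnatr_eq0.
Qed.

Lemma phase_injective : injective (fun j : nat => cis ((j.+1%:R : R)^-1)).
Proof.
move=> j k [h _]; have p2 := pi_ge2 R.
have I (n : nat) : (n.+1%:R : R)^-1 \in `[0, pi].
  rewrite in_itv /= invr_ge0 ler0n /= (@le_trans _ _ 1) //; last by lra.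
  by rewrite invf_le1 ?ltr0n // ler1n.
have := cos_inj (I j) (I k) h => /invr_inj/eqP; rewrite eqr_nat => /eqP[].
exact.
Qed.

(** Infinitely many phases against finitely many eigenvalues of - S. Rotating S by such a phase
    removes the eigenvalue -1, which makes the Cayley transform available. *)
Lemma phase_not_eigenvalue (S : 'M[C]_m) : exists t : R, \det (1%:M + cis (- t) *: S) != 0.
Proof.
have [j hj] := nonroot phase_injective (monic_neq0 (char_poly_monic (- S))).
exists (j.+1%:R^-1); apply: contra hj => /det0P[v v0 hv].
rewrite -eigenvalue_root_char; apply/eigenvalueP; exists v => //.
have : cis (j.+1%:R^-1) *: (v *m (1%:M + cis (- (j.+1%:R)^-1) *: S)) = 0 by rewrite hv scaler0.
rewrite mulmxDr mulmx1 -scalemxAr scalerDr scalerA cisN cis_conj scale1r => /eqP.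
by rewrite addr_eq0 mulmxN => /eqP ->.
Qed.

(* A Cayley path joins [S] to a scalar matrix within the symmetric unitary matrices; the
   determinant is then divided out. *)
Lemma pathSU_scalar S : (0 < m)%N -> SU S -> tau S = S ->
  exists c, pathSU S (cis c *: 1%:M).
Proof.
move=> m0 [uS dS] tS; have [t0 ht] := phase_not_eigenvalue S.
pose U := cis (- t0) *: S.
have uU : unitary_mx U by apply: unitaryZ => //; exact: nsq_cis.
have [X eX] : exists X, X = cay U by eexists.
have [aX cX] := cay_of_unitary uU ht; rewrite -/U -eX in aX cX.
have tX : tau X = X by rewrite eX tau_cay // tauZ tS.
pose q t := cis t0 *: cay (t%:C *: X).
have atX t : dag (t%:C *: X) = - (t%:C *: X) by rewrite dagZ conjc_real aX scalerN.
have cq (T : topologicalType) (f : T -> R) : continuous f -> mcont (fun x => q (f x)).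
  move=> cf; apply: mcontZ; first exact: ccont_cst.
  apply: mcont_cay; last by move=> x; exact: antihermitian_det.
  by apply: mcontZ; [exact: ccont_real|exact: mcont_cst].
have uq t : unitary_mx (q t) by apply: unitaryZ; [exact: nsq_cis|exact: cay_unitary].
have tq t : tau (q t) = q t.
  by rewrite /q tauZ (tau_cay eps_form (antihermitian_det (atX t))) tauZ tX.
have q0 : q 0 = cis t0 *: 1%:M by rewrite /q scale0r cay0.
have q1 : q 1 = S.
  by rewrite /q scale1r cX /U scalerA cisN cis_conj scale1r.
have cd : ccont (fun x : R * R => \det (q x.1)) by apply: ccont_det; apply: cq; exact: cont_fst.
have [phi [cphi hphi]] := circle_lift cd (fun x => unitary_det (uq x.1)).
have hp t : 0 <= t <= 1 -> cis (phi (t, 0)) = \det (q t).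
  move=> /andP[h1 h2]; rewrite hphi //=; apply/andP; split; lra.
pose c t := clamp 0 1 t : R.
have cc : continuous c by apply: cont_clamp => x; exact: cvg_id.
pose p t := cis (- phi (c t, 0) / m%:R) *: q (c t).
have mn (x : R) : (x / m%:R) *+ m = x.
  by rewrite -[LHS]mulr_natr divfK // pnatr_eq0 -lt0n.
have path : pathSU (p 0) (p 1).
  exists p; split=> //.
  - apply: mcontZ; last exact: cq.
    apply: ccont_cis; apply: rcontM; last exact: rcont_cst.
    apply: rcontN; apply: (cont_comp cphi); apply: cont_pair => //; exact: rcont_cst.
  - move=> t; split; first by apply: unitaryZ; [exact: nsq_cis|exact: uq].
    rewrite detZ -hp; last exact: clamp_itv ler01.
    by rewrite -cisMn mn cisN mulrC cis_conj.
  - by move=> t; rewrite tauZ tq.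
have c0 : c 0 = 0 by rewrite /c clamp_id ?lexx ?ler01.
have c1 : c 1 = 1 by rewrite /c clamp_id ?lexx ?ler01.
exists (phi (1, 0) / m%:R + (- phi (0, 0) / m%:R + t0)).
have h1 : cis (phi (1, 0)) = 1 by rewrite hp ?lexx ?ler01 // q1.
apply: pathSU_sym; have := @pathSU_scale (phi (1, 0) / m%:R) _ _ _ path.
rewrite mn => /(_ h1); rewrite /p c0 c1 q0 q1 !scalerA -!cisD.
by rewrite [- phi (1, 0) / _]mulNr subrr cis0 scale1r addrA.
Qed.

(** The angle of an m-th root of unity, the ambiguity left by dividing a logarithm of the
    determinant by m. *)
Definition phase_shift (n : int) : R := pi *+ 2 * n%:~R / m%:R.

Lemma phase_shift_root n : (0 < m)%N -> cis (phase_shift n *+ m) = 1.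
Proof.
by move=> m0; rewrite -mulr_natr /phase_shift divfK ?cis_int // pnatr_eq0 -lt0n.
Qed.

Lemma phase_shiftD n k : phase_shift (n + k) = phase_shift n + phase_shift k.
Proof. by rewrite /phase_shift intrD mulrDr mulrDl. Qed.

(* If the determinant of a loop [W] winds [n] times, that of the symmetric loop [tau W * W]
   winds [2 n] times; dividing by a continuous [m]-th root leaves a path in SU(m). *)
Lemma pathSU_even_one n : (0 < m)%N -> pathSU 1%:M (cis (phase_shift (n + n)) *: 1%:M).
Proof.
move=> m0; pose j0 := Ordinal m0.
pose W (t : R) := diag_at j0 (cis (pi *+ 2 * n%:~R * t)).
have uW t : unitary_mx (W t) by apply: diag_at_unitary; exact: nsq_cis.
have ci : continuous (fun t : R => t) by move=> x; exact: cvg_id.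
have cW : mcont W.
  apply: mcont_diag_at; apply: ccont_cis; apply: rcontM => //; exact: rcont_cst.
have mn (x : R) : (x / m%:R) *+ m = x.
  by rewrite -[LHS]mulr_natr divfK // pnatr_eq0 -lt0n.
pose f (t : R) := pi *+ 2 * n%:~R * t.
have path : pathSU (cis (- (f 0 + f 0) / m%:R) *: (tau (W 0) *m W 0))
                   (cis (- (f 1 + f 1) / m%:R) *: (tau (W 1) *m W 1)).
  exists (fun t => cis (- (f t + f t) / m%:R) *: (tau (W t) *m W t)); split=> //.
  - apply: mcontZ; last by apply: mcontM => //; exact: mcont_tau.
    apply: ccont_cis; apply: rcontM; last exact: rcont_cst.
    by apply: rcontN; apply: rcontD; apply: rcontM => //; exact: rcont_cst.
  - move=> t; split.
      apply: unitaryZ; first exact: nsq_cis.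
      by apply: unitaryM => //; exact: unitary_tau.
    rewrite detZ -cisMn mn det_mulmx (det_tau eps_form) /W det_diag_at -/(f t).
    by rewrite -cisD cisN mulrC cis_conj.
  - by move=> t; rewrite tauZ (tauM eps_form) (tauK eps_form).
have W0 : W 0 = 1%:M by rewrite /W mulr0 cis0 diag_at1.
have W1 : W 1 = 1%:M by rewrite /W mulr1 cis_int diag_at1.
rewrite W0 W1 (tau1 eps_form) mulmx1 /f mulr0 addr0 oppr0 mul0r cis0 scale1r mulr1 in path.
have := @pathSU_scale (phase_shift (n + n)) _ _ (phase_shift_root _ m0) path.
rewrite scalerA -cisD; have -> : phase_shift (n + n) + - (pi *+ 2 * n%:~R + pi *+ 2 * n%:~R) / m%:R = 0.
  by rewrite /phase_shift intrD mulrDr mulNr subrr.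
by rewrite cis0 scale1r => /pathSU_sym.
Qed.

Lemma pathSU_scalar_root S c : SU S -> pathSU S (cis c *: 1%:M) -> cis (c *+ m) = 1.
Proof.
move=> _ [p [_ sp _ _ p1]]; have [_] := sp 1.
by rewrite p1 detZ det1 mulr1 cisMn.
Qed.

(** Joining S to a scalar matrix reduces the question for S to that for 1, since multiplication by
    an m-th root of unity preserves paths; [pathSU_unshift] is the converse. So whether a given root
    can be absorbed does not depend on S. *)
Lemma pathSU_shift n S : (0 < m)%N -> SU S -> tau S = S ->
  pathSU 1%:M (cis (phase_shift n) *: 1%:M) -> pathSU S (cis (phase_shift n) *: S).
Proof.
move=> m0 sS tS h; have [c hc] := pathSU_scalar m0 sS tS.
have rc := pathSU_scalar_root sS hc.
apply: (pathSU_trans hc); apply: pathSU_sym.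
have := @pathSU_scale c _ _ rc h; rewrite scalerA mulrC -scalerA => h'.
exact: pathSU_trans (pathSU_scale (phase_shift_root n m0) hc) (pathSU_sym h').
Qed.

Lemma pathSU_even n S : (0 < m)%N -> SU S -> tau S = S ->
  pathSU S (cis (phase_shift (n + n)) *: S).
Proof. by move=> m0 sS tS; apply: pathSU_shift => //; exact: pathSU_even_one. Qed.

Lemma pathSU_unshift n S : (0 < m)%N -> SU S -> tau S = S ->
  pathSU S (cis (phase_shift n) *: S) -> pathSU 1%:M (cis (phase_shift n) *: 1%:M).
Proof.
move=> m0 sS tS h; have [c hc] := pathSU_scalar m0 sS tS.
have rc := pathSU_scalar_root sS hc.
have rc' : cis (- c *+ m) = 1 by rewrite mulNrn cisN rc rmorph1.
have h1 := pathSU_trans (pathSU_sym hc) h.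
have h2 := pathSU_trans h1 (pathSU_scale (phase_shift_root n m0) hc).
have := pathSU_scale rc' h2; rewrite !scalerA -!cisD.
have -> : - c + phase_shift n + c = phase_shift n by ring.
by rewrite addNr cis0 scale1r.
Qed.

End SymmetricPaths.

(** * Correcting a family along edges and cells *)

Section Cells.
Variable R : realType.
Local Notation C := R[i].
Variables (m : nat) (eps : 'M[C]_m).
Hypothesis eps_form : matching_form eps.
Local Notation tau := (tau eps).
Local Notation mfamily := (mfamily eps).
Local Notation SUfamily := (SUfamily eps).
Local Notation homot := (homot eps).

Lemma mfamily_opp a k : mfamily a -> a (opp2 k) = tau (a k).
Proof. by move=> [_ _ _ ta]; rewrite -[in RHS]ta tauK. Qed.

Lemma half_itv (c : R) : half_integer c -> 0 <= c <= 1 / 2.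
Proof. by case=> ->; apply/andP; split; lra. Qed.

(** A line through fixed points is stable under the reflection, which maps its half [0, 1/2] to the
    other half modulo periods. *)
Lemma line_ext f g c : mfamily f -> mfamily g -> half_integer c ->
  (forall y, 0 <= y <= 1 / 2 -> f (c, y) = g (c, y)) -> forall y, f (c, y) = g (c, y).
Proof.
move=> ff fg hc h y; have [_ pf _ _] := ff; have [_ pg _ _] := fg.
pose F (k : R * R) := (f k, g k).
have pF : periodic2 F by split=> x z; rewrite /F ?pf.1 ?pf.2 ?pg.1 ?pg.2.
have hF : (F (c, y)).1 = (F (c, y)).2; last exact: hF.
have vf z : f (- c, z) = f (c, z).
  by have := @vertex_opp _ _ (fun k => f (k.1, z)) (c, c) _ (conj hc hc) => /= -> //;
    split=> * /=; rewrite ?pf.1.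
have vg z : g (- c, z) = g (c, z).
  by have := @vertex_opp _ _ (fun k => g (k.1, z)) (c, c) _ (conj hc hc) => /= -> //;
    split=> * /=; rewrite ?pg.1.
have hy := fold_itv y.
have hneg z : 0 <= z <= 1 / 2 -> f (c, - z) = g (c, - z).
  move=> hz; rewrite -vf -vg.
  have := mfamily_opp (c, z) ff; have := mfamily_opp (c, z) fg; rewrite /opp2 /= => -> ->.
  by rewrite h.
have [[_ [n ->]]|[_ [n ->]]] := swave_decomp y;
  rewrite -[c]add0r -[0 + c]/((0 : int)%:~R + c) periodic2_int //= /F /=.
  exact: h.
exact: hneg.
Qed.

Lemma cells_ext f g : mfamily f -> mfamily g ->
  (forall x y, 0 <= x <= 1 / 2 -> 0 <= y <= 1 / 2 ->
     f (x, y) = g (x, y) /\ f (x, - y) = g (x, - y)) -> forall k, f k = g k.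
Proof.
move=> ff fg h k; have [_ pf _ _] := ff; have [_ pg _ _] := fg.
pose F (k : R * R) := (f k, g k).
have pF : periodic2 F by split=> x z; rewrite /F ?pf.1 ?pf.2 ?pg.1 ?pg.2.
have hF : (F k).1 = (F k).2; last exact: hF.
have [h1 h2] := h _ _ (fold_itv k.1) (fold_itv k.2).
have opp x y : f (x, y) = g (x, y) -> f (- x, - y) = g (- x, - y).
  by have := mfamily_opp (x, y) ff; have := mfamily_opp (x, y) fg; rewrite /opp2 /= => -> -> ->.
have [[_ [_ ->]]|[[_ [_ ->]]|[[_ [_ ->]]|[_ [_ ->]]]]] := fold2_decomp k pF; rewrite /F //=.
  exact: opp.
by rewrite -[fold k.2]opprK; apply: opp.
Qed.

Definition mismatch (f g : R * R -> 'M[C]_m) (x : R * R) := dag (f x) *m g x.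

Lemma mismatch_eq1 f g x : unitary_mx (f x) -> (mismatch f g x = 1%:M) <-> f x = g x.
Proof.
move=> uf; rewrite /mismatch; split=> [h|<-//].
by rewrite -[LHS]mulmx1 -h mulmxA unitaryC // mul1mx.
Qed.

(** The contraction of the mismatch is run backwards so that it starts at 1, as [modification]
    requires; [h] parametrises an edge or a cell by the unit square. *)
Lemma mismatch_contraction f g (h : R * R -> R * R) : SUfamily f -> SUfamily g ->
  continuous h -> exists G : R * (R * R) -> 'M[C]_m, [/\ mcont G, forall p, SU (G p),
    forall x, G (0, x) = 1%:M, forall x, G (1, x) = mismatch f g (h (clampx x)) &
    forall t x, f (h (clampx x)) = g (h (clampx x)) -> G (t, x) = 1%:M].
Proof.
move=> [ff df] [fg dg] ch.
have [cf _ uf _] := ff; have [cg _ ug _] := fg.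
pose gam x := mismatch f g (h (clampx x)).
have chc : continuous (fun x => h (clampx x)) by apply: (cont_comp ch); exact: cont_clampx.
have [||x|||G [cG sG G0 G1 GL]] := @SU_contractible R m (fun x => gam x = 1%:M) gam.
- by apply: mcontM; [apply: mcont_dag|]; exact: mcont_comp.
- by move=> x; apply: SUM; [apply: SU_dag|].
- by rewrite /gam clampxK.
- by move=> x; rewrite /gam clampxK.
- by [].
exists (fun p => G (1 - p.1, p.2)); split=> //=.
- apply: (mcont_comp cG); apply: cont_pair; last exact: cont_snd.
  by apply: rcontB; [exact: rcont_cst|exact: cont_fst].
- by move=> x; rewrite subr0.
- by move=> x; rewrite subrr G0.
- by move=> t x e; apply: GL; apply/mismatch_eq1.
Qed.

Lemma clamp_double (u : R) : 0 <= u <= 1 / 2 -> clamp 0 1 (2 * u) / 2 = u.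
Proof. by move=> /andP[h1 h2]; rewrite clamp_id; [lra|apply/andP; split; lra]. Qed.

(** The correction lives over 0 <= y <= 1/2, the other half of the line following by symmetry. It is
    trivial for y = 0 and y = 1/2 because the families agree at the ends of the edge, and the factor
    [bump1 c] in the time makes it fade out at the parallel line. Hence the three other lines are
    not disturbed. *)
Lemma edge_step b a c : SUfamily b -> SUfamily a -> half_integer c ->
  b (c, 0) = a (c, 0) -> b (c, 1 / 2) = a (c, 1 / 2) ->
  exists b', [/\ SUfamily b', homot b b', forall y, b' (c, y) = a (c, y),
    forall d y, half_integer d -> d <> c -> b' (d, y) = b (d, y) &
    forall x d, half_integer d -> b' (x, d) = b (x, d)].
Proof.
move=> fb fa hc e0 e1.
pose h (x : R * R) := (c, x.2 / 2).
have ch : continuous h.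
  apply: cont_pair; first exact: rcont_cst.
  by apply: rcontM; [exact: cont_snd|exact: rcont_cst].
have [G [cG sG G0 G1 GL]] := mismatch_contraction fb fa ch.
pose W (p : R * (R * R)) := if 0 <= swave p.2.2
  then G (p.1 * bump1 c p.2.1, (0, 2 * fold p.2.2)) else 1%:M.
have Gend t d : half_integer d -> G (t, (0, 2 * d)) = 1%:M.
  move=> hd; apply: GL; rewrite /h /= clamp_double ?half_itv //.
  by case: hd => ->.
have Gz t y : swave y = 0 -> G (t, (0, 2 * fold y)) = 1%:M.
  by move=> /swave_eq0 h'; apply: Gend.
have cW : mcont W.
  have c2 : continuous (fun p : R * (R * R) => p.2.2).
    by apply: (@cont_comp _ _ _ snd snd); [exact: cont_snd|exact: cont_snd].
  have c1 : continuous (fun p : R * (R * R) => p.2.1).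
    by apply: (@cont_comp _ _ _ snd fst); [exact: cont_fst|exact: cont_snd].
  apply: mcont_glue.
  - exact: cont_swave.
  - apply: (mcont_comp cG); apply: cont_pair.
      by apply: rcontM; [exact: cont_fst|exact: cont_bump1].
    apply: cont_pair; first exact: rcont_cst.
    by apply: rcontM; [exact: rcont_cst|exact: cont_fold].
  - exact: mcont_cst.
  - by move=> p; exact: Gz.
have W1 t x y : swave y <= 0 -> W (t, (x, y)) = 1%:M.
  by rewrite /W /=; case: ifP => // s1 s2; apply: Gz; apply/eqP; rewrite eq_le s1 s2.
have [|||fb' hb'] := modification eps_form fb cW.
- by move=> p; rewrite /W; case: ifP => // _; exact: SU1.
- by move=> t; split=> x y; rewrite /W /= ?swaveD1 ?foldD1 // /bump1 foldD1.
- by move=> k; rewrite /W; case: ifP => // _; rewrite mul0r G0.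
set b' := (fun k => _) in fb' hb'.
have bcc : bump1 c c = 1 by rewrite /bump1 fold_half_integer // subrr normr0 mulr0 subr0.
exists b'; split=> //.
- have [ff _] := fb'; have [fa1 _] := fa; apply: line_ext => // y hy.
  have sy := swave_ge0 hy.
  rewrite /b' /opp2 /= (W1 _ _ (- y)); last by rewrite swaveN oppr_le0.
  rewrite (tau1 eps_form) mul1mx /W /= sy.
  rewrite bcc mulr1 G1 /h /= (fold_id hy) clamp_double // /mismatch mulmxA.
  by have [[_ _ ub _] _] := fb; rewrite unitaryC // mul1mx.
- move=> d y hd dc.
  have z : bump1 c d = 0.
    have := @bump_vertex R (c, c) (d, c) (conj hc hc) (conj hd hc).
    by rewrite /vbump /= bcc mulr1 xpair_eqE eqxx andbT eq_sym (negPf (introN eqP dc)).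
  have zN : bump1 c (- d) = 0 by rewrite -z /bump1 foldN.
  have Wz x y' : bump1 c x = 0 -> W (1, (x, y')) = 1%:M.
    by move=> h0; rewrite /W /= h0 mulr0 G0; case: ifP.
  by rewrite /b' /opp2 /= !Wz // (tau1 eps_form) mul1mx mulmx1.
- move=> x d hd.
  have Wd x' z : fold z = d -> W (1, (x', z)) = 1%:M.
    by move=> hz; rewrite /W /= hz Gend //; case: ifP.
  by rewrite /b' /opp2 /= !Wd ?foldN ?fold_half_integer // (tau1 eps_form) mul1mx mulmx1.
Qed.

(** [s] selects one of two cells that represent the torus up to reflection. On the boundary of the
    cell b and a agree, so the correction is trivial there and extends by 1 over the reflected cell
    and over the other cell. *)
Lemma cell_step b a (s : R) : SUfamily b -> SUfamily a -> s = 1 \/ s = -1 ->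
  (forall c x, half_integer c -> b (c, x) = a (c, x) /\ b (x, c) = a (x, c)) ->
  exists b', [/\ SUfamily b', homot b b',
    forall x y, 0 <= x <= 1 / 2 -> 0 <= y <= 1 / 2 -> b' (x, s * y) = a (x, s * y) &
    forall x y, 0 <= x <= 1 / 2 -> 0 <= y <= 1 / 2 -> b' (x, - (s * y)) = b (x, - (s * y))].
Proof.
move=> fb fa hs lines.
pose h (x : R * R) := (x.1 / 2, s * (x.2 / 2)).
have ch : continuous h.
  apply: cont_pair; first by apply: rcontM; [exact: cont_fst|exact: rcont_cst].
  apply: rcontM; first exact: rcont_cst.
  by apply: rcontM; [exact: cont_snd|exact: rcont_cst].
have [G [cG sG G0 G1 GL]] := mismatch_contraction fb fa ch.
(* The minimum is nonnegative exactly on the integer translates of the chosen closed cell. *)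
pose W (p : R * (R * R)) := if 0 <= Num.min (swave p.2.1) (s * swave p.2.2)
  then G (p.1, (2 * fold p.2.1, 2 * fold p.2.2)) else 1%:M.
have [[[cb pb ub tb] db] [[ca pa ua ta] da]] := (fb, fa).
have s0 : s != 0 by case: hs => ->; rewrite ?oppr_eq0 oner_eq0.
have Gb t x y : half_integer (fold x) \/ half_integer (fold y) ->
    G (t, (2 * fold x, 2 * fold y)) = 1%:M.
  move=> hh; apply: GL; rewrite /h /= !clamp_double ?fold_itv //.
  case: hh => [/lines -/(_ (s * fold y))[]//|hy].
  have [_ e] := lines _ (fold x) hy.
  case: hs => ->; rewrite ?mul1r // mulN1r.
  have vb := @vertex_opp _ _ (fun k => b (fold x, k.2)) (fold y, fold y) _ (conj hy hy).
  have va := @vertex_opp _ _ (fun k => a (fold x, k.2)) (fold y, fold y) _ (conj hy hy).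
  rewrite /opp2 /= in va vb; rewrite va ?vb //; split=> * /=; rewrite ?pb.2 ?pa.2 //.
have Wle t x y : Num.min (swave x) (s * swave y) <= 0 -> W (t, (x, y)) = 1%:M.
  rewrite /W /=; case: ifP => // s1 s2; apply: Gb.
  have /eqP : Num.min (swave x) (s * swave y) == 0 by rewrite eq_le s1 s2.
  rewrite /Num.min; case: ifP => _ /eqP; first by move=> /eqP /swave_eq0; left.
  by rewrite mulf_eq0 (negPf s0) /= => /eqP /swave_eq0; right.
have cW : mcont W.
  have c2 : continuous (fun p : R * (R * R) => p.2.2).
    by apply: (@cont_comp _ _ _ snd snd); [exact: cont_snd|exact: cont_snd].
  have c1 : continuous (fun p : R * (R * R) => p.2.1).
    by apply: (@cont_comp _ _ _ snd fst); [exact: cont_fst|exact: cont_snd].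
  apply: mcont_glue.
  - apply: rcont_min; first exact: cont_swave.
    by apply: rcontM; [exact: rcont_cst|exact: cont_swave].
  - apply: (mcont_comp cG); apply: cont_pair; first exact: cont_fst.
    by apply: cont_pair; apply: rcontM; try exact: rcont_cst; exact: cont_fold.
  - exact: mcont_cst.
  - move=> [t [x y]] /= hz; have := Wle t x y; rewrite /W /= hz lexx => /(_ isT) <- //.
have [|||fb' hb'] := modification eps_form fb cW.
- by move=> p; rewrite /W; case: ifP => // _; exact: SU1.
- by move=> t; split=> x y; rewrite /W /= swaveD1 foldD1.
- by move=> k; rewrite /W; case: ifP => // _; rewrite G0.
set b' := (fun k => _) in fb' hb'.
have sw y : swave (s * y) = s * swave y.
  by case: hs => ->; rewrite ?mul1r // !mulN1r swaveN.
have ss y : s * (s * y) = y by case: hs => ->; rewrite ?mul1r // !mulN1r opprK.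
have fs y : fold (s * y) = fold y by case: hs => ->; rewrite ?mul1r // mulN1r foldN.
exists b'; split=> // x y hx hy; have sx := swave_ge0 hx; have sy := swave_ge0 hy.
- rewrite /b' /opp2 /= (Wle _ (- x)); last by rewrite (swaveN x) ge_min oppr_le0 sx.
  rewrite (tau1 eps_form) mul1mx /W /= sw ss le_min sx sy /= fs.
  rewrite G1 /h /= (fold_id hx) (fold_id hy) !clamp_double // /mismatch mulmxA.
  by rewrite unitaryC // mul1mx.
- rewrite /b' /opp2 /= opprK (Wle _ (- x)); last by rewrite (swaveN x) ge_min oppr_le0 sx.
  rewrite Wle ?(tau1 eps_form) ?mul1mx ?mulmx1 //.
  by rewrite swaveN sw mulrN ss ge_min orbC oppr_le0 sy.
Qed.

Definition swap2 (k : R * R) : R * R := (k.2, k.1).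

Lemma cont_swap2 : continuous swap2.
Proof. by apply: cont_pair; [exact: cont_snd|exact: cont_fst]. Qed.

Lemma mfamily_swap a : mfamily a -> mfamily (fun k => a (swap2 k)).
Proof.
move=> [ca pa ua ta]; split=> //.
- by apply: (mcont_comp ca); exact: cont_swap2.
- by split=> x y; rewrite /swap2 /= ?pa.1 ?pa.2.
- by move=> k; rewrite -[RHS]ta.
Qed.

Lemma SUfamily_swap a : SUfamily a -> SUfamily (fun k => a (swap2 k)).
Proof. by move=> [fa da]; split=> //; exact: mfamily_swap. Qed.

Lemma homot_swap a b : homot (fun k => a (swap2 k)) b -> homot a (fun k => b (swap2 k)).
Proof.
move=> [H [cH fH H0 H1]]; exists (fun p => H (p.1, swap2 p.2)); split=> //=.
- apply: (mcont_comp cH); apply: cont_pair; first exact: cont_fst.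
  by apply: (cont_comp cont_swap2); exact: cont_snd.
- by move=> t; exact: mfamily_swap (fH t).
- by move=> [x y]; rewrite H0.
Qed.

Theorem SU_homot b a : SUfamily b -> SUfamily a ->
  (forall v, vertex v -> pathSU eps (b v) (a v)) -> homot b a.
Proof.
move=> fb fa path.
have h0 : half_integer (0 : R) by left.
have h2 : half_integer (1 / 2 : R) by right.
have ne : (0 : R) <> 1 / 2 by lra.
have ne' : (1 / 2 : R) <> 0 by lra.
have V (x y : R) : half_integer x -> half_integer y -> vertex (x, y) by [].
have nz : (0 == 1 / 2 :> R) = false by apply/eqP.
have nz' : (1 / 2 == 0 :> R) = false by apply/eqP.
have [b1 [f1 r1 v1 k1]] := vertex_move eps_form fb (V _ _ h0 h0) (path _ (V _ _ h0 h0)).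
have [|b2 [f2 r2 v2 k2]] := @vertex_move _ _ _ eps_form b1 (0, 1 / 2) (a (0, 1 / 2)) f1 (V _ _ h0 h2).
  by rewrite k1 ?xpair_eqE ?nz' ?andbF //; exact: path.
have [|b3 [f3 r3 v3 k3]] := @vertex_move _ _ _ eps_form b2 (1 / 2, 0) (a (1 / 2, 0)) f2 (V _ _ h2 h0).
  by rewrite k2 ?k1 ?xpair_eqE ?nz' ?andbF //; exact: path.
have [|b4 [f4 r4 v4 k4]] :=
    @vertex_move _ _ _ eps_form b3 (1 / 2, 1 / 2) (a (1 / 2, 1 / 2)) f3 (V _ _ h2 h2).
  by rewrite k3 ?k2 ?k1 ?xpair_eqE ?nz' ?andbF //; exact: path.
have w00 : b4 (0, 0) = a (0, 0) by rewrite k4 ?k3 ?k2 ?v1 ?xpair_eqE ?nz ?andbF.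
have w02 : b4 (0, 1 / 2) = a (0, 1 / 2) by rewrite k4 ?k3 ?v2 ?xpair_eqE ?nz ?andbF.
have w20 : b4 (1 / 2, 0) = a (1 / 2, 0) by rewrite k4 ?v3 ?xpair_eqE ?nz ?andbF.
have [b5 [f5 r5 e5 c5 d5]] := edge_step f4 fa h0 w00 w02.
have [||b6 [f6 r6 e6 c6 d6]] := edge_step f5 fa h2; rewrite ?c5 //.
(* Exchanging the coordinates turns horizontal lines into vertical ones. [edge_step] leaves the
   transversal lines alone, which are here the two lines already corrected. *)
have [||b7 [f7 r7 e7 c7 d7]] := edge_step (SUfamily_swap f6) (SUfamily_swap fa) h0.
- by rewrite /swap2 /= c6 // e5.
- by rewrite /swap2 /= e6.
have [||b8 [f8 r8 e8 c8 d8]] := edge_step f7 (SUfamily_swap fa) h2.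
- by rewrite d7 // /swap2 /= c6 // e5.
- by rewrite d7 // /swap2 /= e6.
pose b9 k := b8 (swap2 k).
have f9 : SUfamily b9 by exact: SUfamily_swap.
have r9 : homot b6 b9 by apply: homot_swap; exact: homot_trans r7 r8.
have lines c x : half_integer c -> b9 (c, x) = a (c, x) /\ b9 (x, c) = a (x, c).
  move=> hc; rewrite /b9 /swap2 /=; split.
    rewrite d8 // d7 // /swap2 /=.
    by case: hc => ->; [rewrite c6 // e5|rewrite e6].
  by case: hc => ->; [rewrite c8 // e7|rewrite e8].
have [|b10 [f10 r10 e10 c10]] := @cell_step b9 a 1 f9 fa _ lines; first by left.
have cell1 x y : 0 <= x <= 1 / 2 -> 0 <= y <= 1 / 2 -> b10 (x, y) = a (x, y).
  by move=> hx hy; rewrite -[y]mul1r e10.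
(* The halves of the four lines with coordinate in [0, 1/2] bound the first cell, where the families
   now agree; the reflection takes care of the other halves. *)
have lines10 c x : half_integer c -> b10 (c, x) = a (c, x) /\ b10 (x, c) = a (x, c).
  have [[g10 _] [ga _]] := (f10, fa).
  move=> hc; split.
    by apply: line_ext => // y hy; apply: cell1 => //; exact: half_itv.
  apply: (@line_ext (fun k => b10 (swap2 k)) (fun k => a (swap2 k)) c) => //;
    try exact: mfamily_swap.
  by move=> y hy; rewrite /swap2 /=; apply: cell1 => //; exact: half_itv.
have [|b11 [f11 r11 e11 c11]] := @cell_step b10 a (-1) f10 fa _ lines10; first by right.
have fin : b11 = a.
  apply/funext; apply: cells_ext; [by case: f11|by case: fa|] => x y hx hy; split.
    by rewrite -[y]opprK -[- y]mulN1r c11 // mulN1r opprK cell1.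
  by rewrite -[- y]mulN1r e11.
rewrite -fin; apply: homot_trans r1 (homot_trans r2 (homot_trans r3 (homot_trans r4 _))).
exact: homot_trans r5 (homot_trans r6 (homot_trans r9 (homot_trans r10 r11))).
Qed.

End Cells.

(** * From homotopies along lines to a homotopy on the torus *)

Section Classification.
Variable R : realType.
Local Notation C := R[i].
Variables (m : nat) (eps : 'M[C]_m).
Hypothesis eps_form : matching_form eps.
Hypothesis m_gt0 : (0 < m)%N.
Local Notation tau := (tau eps).
Local Notation mfamily := (mfamily eps).
Local Notation SUfamily := (SUfamily eps).
Local Notation homot := (homot eps).
Local Notation pathSU := (pathSU eps).

Definition mfamily1 (a : R -> 'M[C]_m) :=
  [/\ mcont a, forall x, a (x + 1) = a x, forall x, unitary_mx (a x) & forall x, tau (a (- x)) = a x].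

Definition homot1 (a b : R -> 'M[C]_m) := exists H : R * R -> 'M[C]_m,
  [/\ mcont H, forall t, mfamily1 (fun x => H (t, x)), forall x, H (0, x) = a x &
    forall x, H (1, x) = b x].

Lemma cis_locally_constant_half (f g : R -> R) : continuous f -> continuous g ->
  (forall x, 0 <= x <= 1 / 2 -> cis (f x) = cis (g x)) ->
  exists n : int, forall v, half_integer v -> f v = g v + (pi *+ 2) * n%:~R.
Proof.
move=> cf cg h.
have h' x : 0 <= x <= 1 / 2 -> cis (f x - g x) = 1.
  by move=> hx; rewrite cisD cisN h // cis_conj.
have h0 : 0 <= (0 : R) <= 1 / 2 by apply/andP; split; lra.
have [n hn] := cis_eq1 (h' _ h0).
have e : f 0 - g 0 = f (1 / 2) - g (1 / 2).
  by apply: (@cis_locally_constant R (fun x => f x - g x)) => //; [lra|exact: rcontB].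
exists n => v [->|->]; lra.
Qed.

(** A logarithm of the determinant of the whole homotopy normalises it to a path in SU(m) at each
    vertex. At the two ends of the homotopy it differs from the given logarithms by 2 pi n0 and 2 pi
    n1, the same for both vertices of the line, and only n0 - n1 survives. *)
Lemma line_shift (f0 f1 : R -> 'M[C]_m) (phi0 phi1 : R -> R) : homot1 f0 f1 ->
  continuous phi0 -> continuous phi1 ->
  (forall x, cis (phi0 x) = \det (f0 x)) -> (forall x, cis (phi1 x) = \det (f1 x)) ->
  exists n, forall v, half_integer v ->
    pathSU (cis (- phi0 v / m%:R) *: f0 v) (cis (phase_shift R m n) *: (cis (- phi1 v / m%:R) *: f1 v)).
Proof.
move=> [H [cH fH H0 H1]] c0 c1 d0 d1.
have uH p : unitary_mx (H p) by case: p => t x; case: (fH t).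
have [psi [cpsi hpsi]] := circle_lift (ccont_det cH) (fun p => unitary_det (uH p)).
have ci : continuous (fun x : R => x) by move=> x; exact: cvg_id.
have cps t : continuous (fun x => psi (t, x)).
  by apply: (cont_comp cpsi); apply: cont_pair => //; exact: rcont_cst.
have lift t x : 0 <= t <= 1 -> 0 <= x <= 1 / 2 -> cis (psi (t, x)) = \det (H (t, x)).
  by move=> /andP[? ?] /andP[? ?]; rewrite hpsi //=; apply/andP; split; lra.
have z01 : 0 <= (0 : R) <= 1 by rewrite lexx ler01.
have o01 : 0 <= (1 : R) <= 1 by rewrite lexx ler01.
have [|n0 e0] := @cis_locally_constant_half (fun x => psi (0, x)) phi0 (cps 0) c0.
  by move=> x hx; rewrite lift // H0 d0.
have [|n1 e1] := @cis_locally_constant_half (fun x => psi (1, x)) phi1 (cps 1) c1.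
  by move=> x hx; rewrite lift // H1 d1.
have mn (x : R) : (x / m%:R) *+ m = x.
  by rewrite -[LHS]mulr_natr divfK // pnatr_eq0 -lt0n.
exists (n0 - n1) => v hv.
pose c t := clamp 0 1 t : R.
have cc : continuous c by apply: cont_clamp.
have cpair : continuous (fun t => (c t, v)) by apply: cont_pair => //; exact: rcont_cst.
pose p t := cis (- psi (c t, v) / m%:R) *: H (c t, v).
have path : pathSU (p 0) (p 1).
  exists p; split=> //.
  - apply: mcontZ; last exact: (mcont_comp cH).
    apply: ccont_cis; apply: rcontM; last exact: rcont_cst.
    by apply: rcontN; apply: (cont_comp cpsi).
  - move=> t; split; first by apply: unitaryZ => //; exact: nsq_cis.
    rewrite detZ -lift ?half_itv //; last exact: clamp_itv ler01.
    by rewrite -cisMn mn cisN mulrC cis_conj.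
  - move=> t; rewrite tauZ; congr (_ *: _).
    have [_ per _ tH] := fH (c t); rewrite -[RHS]tH.
    by case: hv => ->; rewrite ?oppr0 // -(per (- (1 / 2))) (_ : - (1 / 2) + 1 = 1 / 2 :> R) //; lra.
have c00 : c 0 = 0 by rewrite /c clamp_id.
have c11 : c 1 = 1 by rewrite /c clamp_id.
have := pathSU_scale (phase_shift_root R n0 m_gt0) path.
rewrite /p c00 c11 H0 H1 (e0 v hv) (e1 v hv) !scalerA -!cisD.
have -> : phase_shift R m n0 + - (phi0 v + pi *+ 2 * n0%:~R) / m%:R = - phi0 v / m%:R.
  by rewrite /phase_shift; field; rewrite pnatr_eq0 -lt0n.
have -> : phase_shift R m n0 + - (phi1 v + pi *+ 2 * n1%:~R) / m%:R =
    phase_shift R m (n0 - n1) + - phi1 v / m%:R.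
  by rewrite /phase_shift rmorphB /=; field; rewrite pnatr_eq0 -lt0n.
by [].
Qed.

Lemma half_dichotomy (n : int) : exists k : int, n = k + k \/ n = k + k + 1.
Proof.
exists (n %/ 2)%Z.
have := divz_eq n 2; have := modz_ge0 n (isT : (2 : int) != 0); have := ltz_mod n (isT : (2 : int) != 0).
set q := (n %/ 2)%Z; set r := (n %% 2)%Z; rewrite mulrDr mulr1 /=.
by case: r => [[|[|r]]|r] // _ _ ->; rewrite ?addr0; [left|right].
Qed.

(* Along a line of the torus the two determinants can be compared up to a common integer.  If two
   lines through a vertex give integers of different parity, then [1] is joined to
   [e^(2 i pi / m)] and the integers are irrelevant. *)
Lemma common_shift (f g : R * R -> 'M[C]_m) : SUfamily f -> SUfamily g ->
  (exists n, forall v, half_integer v -> pathSU (f (0, v)) (cis (phase_shift R m n) *: g (0, v))) ->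
  (exists n, forall v, half_integer v -> pathSU (f (1 / 2, v)) (cis (phase_shift R m n) *: g (1 / 2, v))) ->
  (exists n, forall v, half_integer v -> pathSU (f (v, 0)) (cis (phase_shift R m n) *: g (v, 0))) ->
  exists n, forall v, vertex v -> pathSU (f v) (cis (phase_shift R m n) *: g v).
Proof.
move=> [ff df] [fg dg] [n1 P1] [n2 P2] [n3 P3].
have h0 : half_integer (0 : R) by left.
have h2 : half_integer (1 / 2 : R) by right.
have sg v : SU (g v) by split=> //; case: fg.
have tg v : vertex v -> tau (g v) = g v.
  by move=> hv; have [_ pg _ t] := fg; rewrite -[in LHS](vertex_opp pg hv) t.
have V (x y : R) : half_integer x -> half_integer y -> vertex (x, y) by [].
have comp n k v : vertex v -> pathSU (g v) (cis (phase_shift R m k) *: g v) ->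
    pathSU (f v) (cis (phase_shift R m n) *: g v) -> pathSU (f v) (cis (phase_shift R m (n + k)) *: g v).
  move=> hv h1 h3; apply: (pathSU_trans h3).
  have := pathSU_scale (phase_shift_root R n m_gt0) h1.
  by rewrite scalerA -cisD -phase_shiftD.
have even_shift n k v : vertex v -> pathSU (f v) (cis (phase_shift R m n) *: g v) ->
    pathSU (f v) (cis (phase_shift R m (n + (k + k))) *: g v).
  by move=> hv; apply: comp => //; apply: pathSU_even => //; exact: tg.
have odd : pathSU 1%:M (cis (phase_shift R m 1) *: 1%:M) -> forall n k v, vertex v ->
    pathSU (f v) (cis (phase_shift R m n) *: g v) -> pathSU (f v) (cis (phase_shift R m (n + k)) *: g v).
  move=> h n k v hv hf; have [j [->|->]] := half_dichotomy k; first exact: even_shift.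
  rewrite addrA; apply: comp => //; last exact: even_shift.
  by apply: pathSU_shift => //; exact: tg.
have diff n k v : vertex v -> pathSU (f v) (cis (phase_shift R m n) *: g v) ->
    pathSU (f v) (cis (phase_shift R m k) *: g v) ->
    (exists j : int, k = n + (j + j)) \/ pathSU 1%:M (cis (phase_shift R m 1) *: 1%:M).
  move=> hv hn hk; have [j [e|e]] := half_dichotomy (k - n).
    by left; exists j; rewrite -e addrC subrK.
  right; have := pathSU_trans (pathSU_sym hn) hk.
  have r : cis (phase_shift R m (- n) *+ m) = 1 by exact: phase_shift_root.
  move=> /(pathSU_scale r); rewrite !scalerA -!cisD -!phase_shiftD addNr.
  have -> : - n + k = 1 + (j + j) by rewrite addrC e addrC.
  have -> : phase_shift R m 0 = 0 by rewrite /phase_shift mulr0 mul0r.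
  rewrite cis0 scale1r => hj.
  apply: (@pathSU_unshift _ _ _ eps_form _ (g v)) => //; first exact: tg.
  apply: (pathSU_trans hj); rewrite phase_shiftD cisD -scalerA.
  apply: pathSU_scale; first exact: phase_shift_root.
  by apply: pathSU_sym; apply: pathSU_even => //; exact: tg.
(* The third line meets the first at (0, 0) and the second at (1/2, 0), so the parities are compared
   through it. *)
exists n1 => -[x y] [/= hx hy].
have [[j e]|o] := diff n3 n1 (0, 0) (V _ _ h0 h0) (P3 _ h0) (P1 _ h0); last first.
  case: hx => ->; first exact: P1.
  have -> : n1 = n2 + (n1 - n2) by rewrite addrC subrK.
  by apply: odd => //; exact: P2.
have [[i e']|o] := diff n2 n3 (1 / 2, 0) (V _ _ h2 h0) (P2 _ h0) (P3 _ h2); last first.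
  case: hx => ->; first exact: P1.
  have -> : n1 = n2 + (n1 - n2) by rewrite addrC subrK.
  by apply: odd => //; exact: P2.
case: hx => ->; first exact: P1.
by rewrite e e'; apply: (even_shift) => //; apply: (even_shift) => //; exact: P2.
Qed.

Theorem line_criterion (a0 a1 : R * R -> 'M[C]_m) : mfamily a0 -> mfamily a1 ->
  homot1 (fun y => a0 (0, y)) (fun y => a1 (0, y)) ->
  homot1 (fun y => a0 (1 / 2, y)) (fun y => a1 (1 / 2, y)) ->
  homot1 (fun x => a0 (x, 0)) (fun x => a1 (x, 0)) ->
  homot a0 a1.
Proof.
move=> f0 f1 l1 l2 l3.
have [phi0 [c0 d0 s0 r0]] := normalization eps_form m_gt0 f0.
have [phi1 [c1 d1 s1 r1]] := normalization eps_form m_gt0 f1.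
have ci : continuous (fun x : R => x) by move=> x; exact: cvg_id.
have cl (c : R) : continuous (fun x : R => (c, x)) by apply: cont_pair => //; exact: rcont_cst.
have cr (c : R) : continuous (fun x : R => (x, c)) by apply: cont_pair => //; exact: rcont_cst.
have [|||n hn] := common_shift s0 s1.
- by apply: (@line_shift _ _ (fun y => phi0 (0, y)) (fun y => phi1 (0, y)) l1) => //;
    [exact: (cont_comp c0)|exact: (cont_comp c1)].
- by apply: (@line_shift _ _ (fun y => phi0 (1 / 2, y)) (fun y => phi1 (1 / 2, y)) l2) => //;
    [exact: (cont_comp c0)|exact: (cont_comp c1)].
- by apply: (@line_shift _ _ (fun y => phi0 (y, 0)) (fun y => phi1 (y, 0)) l3) => //;
    [exact: (cont_comp c0)|exact: (cont_comp c1)].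
(* The common root of unity is absorbed into [a1] as a constant phase, which a homotopy through U(m)
   turns off. *)
pose b k := cis (phase_shift R m n) *: (cis (- phi1 k / m%:R) *: a1 k).
have [fs1 ds1] := s1.
have cs : continuous (fun _ : R * R => phase_shift R m n) by exact: rcont_cst.
have fb : SUfamily b.
  split; first by apply: (phase_family fs1 cs).
  by move=> k; rewrite /b detZ ds1 mulr1 -cisMn phase_shift_root.
apply: (homot_trans r0); apply: (homot_trans (SU_homot eps_form s0 fb hn)).
by apply: homot_sym; apply: (homot_trans r1); apply: (phase_homot fs1 cs).
Qed.

End Classification.

(** * Epsilon-delta continuity and filters *)

Section EpsilonDelta.
Variable R : realType.

Definition epsilon_delta (X : Type) (dX : X -> X -> R) (D : X -> Prop) (f : X -> R) :=
  forall x, D x -> forall e, 0 < e -> exists2 del, 0 < del &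
    forall y, D y -> dX x y < del -> `|f y - f x| < e.

(** [h] reads the points of [X] in a space with a topology; the restriction to [D] disappears
    because [g] takes its values in [D]. *)
Lemma epsilon_delta_comp (X : Type) (dX : X -> X -> R) (D : X -> Prop) (f : X -> R)
    (Y : pseudoMetricType R) (T : topologicalType) (h : X -> Y) (g : T -> X) :
  (forall x y e, ball (h x) e (h y) -> dX x y < e) ->
  epsilon_delta dX D f -> continuous (fun t => h (g t)) -> (forall t, D (g t)) ->
  continuous (fun t => f (g t)).
Proof.
move=> hd cf cg Dg t; apply/cvgrPdist_lt => e e0.
have [del del0 hdel] := cf (g t) (Dg t) e e0.
have : \forall t' \near t, ball (h (g t)) del (h (g t')).
  by apply: (cg t (ball (h (g t)) del)); exact: nbhsx_ballx.
apply: filterS => t' ht'; rewrite distrC.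
by apply: hdel => //; exact: hd ht'.
Qed.

Lemma continuous_epsilon_delta (X : pseudoMetricType R) (dX : X -> X -> R) (D : X -> Prop)
    (f : X -> R) :
  (forall x y e, dX x y < e -> ball x e y) -> continuous f -> epsilon_delta dX D f.
Proof.
move=> hd cf x _ e e0.
have /cvgrPdist_lt/(_ e e0)/nbhs_ballP[del /= del0 hdel] := cf x.
exists del => // y _ hxy; rewrite distrC.
by apply: hdel; exact: hd.
Qed.

End EpsilonDelta.

(** * Translation to functions on natural indices and classical reals *)

Section Bridge.
Let R : realType := Rdefinitions.R.

Lemma cont_onP (X : Type) (dX : X -> X -> R) (D : X -> Prop) (f : X -> R) :
  cont_on dX D f <-> epsilon_delta dX D f.
Proof.
split=> h x Dx e /RltP e0; have [del] := h x Dx e e0.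
  move=> [/RltP del0 hdel]; exists del => // y Dy /RltP hxy.
  by apply/RltP; have := hdel y Dy hxy; rewrite RabsE.
move=> del0 hdel; exists del; split; first exact/RltP.
by move=> y Dy /RltP hxy; rewrite RabsE; apply/RltP; exact: hdel.
Qed.

Lemma Rmax_lt (a b e : R) : (Rmax a b < e) = (a < e) && (b < e).
Proof. by rewrite RmaxE gt_max. Qed.

Lemma dist2_ball (x y : R * R) e : (dist2 x y < e) <-> ball x e y.
Proof. by rewrite /dist2 Rmax_lt !RabsE; split=> [/andP[h1 h2]|[h1 h2]]; [split|apply/andP]. Qed.

Lemma dist3_ball (x y : R * (R * R)) e : (dist3 x y < e) <-> ball x e y.
Proof.
rewrite /dist3 Rmax_lt RabsE; split=> [/andP[h1 /dist2_ball h2]|[h1 h2]]; first by split.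
by apply/andP; split=> //; apply/dist2_ball.
Qed.

Definition toC (z : Defs.C) : R[i] := z.1 +i* z.2.
Definition ofC (z : R[i]) : Defs.C := (complex.Re z, complex.Im z).

Lemma toCK z : ofC (toC z) = z. Proof. by case: z. Qed.
Lemma ofCK z : toC (ofC z) = z. Proof. by case: z. Qed.

Variable n : nat.
Local Notation m := n.+1.

Definition toM (A : Mat) : 'M[R[i]]_m := \matrix_(i, j) toC (A i j).
(** Indices beyond the size are sent by [inord] to a default index; [mat_eq] does not see these
    entries. *)
Definition ofM (A : 'M[R[i]]_m) : Mat := fun i j => ofC (A (inord i) (inord j)).

Lemma ofMK A : toM (ofM A) = A.
Proof. by apply/matrixP => i j; rewrite mxE /ofM ofCK !inord_val. Qed.

Lemma toM_eq A B : mat_eq m A B <-> toM A = toM B.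
Proof.
split=> [h|/matrixP h i j /ssrnat.ltP hi /ssrnat.ltP hj].
  by apply/matrixP => i j; rewrite !mxE h //; apply/ssrnat.ltP.
have := h (Ordinal hi) (Ordinal hj); rewrite !mxE /= => /(congr1 ofC).
by rewrite !toCK.
Qed.

Lemma toC_sum k (f : nat -> Defs.C) : toC (Csum k f) = \sum_(i < k) toC (f i).
Proof.
elim: k => [|k IH]; first by rewrite big_ord0.
by rewrite big_ord_recr /= -IH.
Qed.

Lemma toM_mul A B : toM (mmul m A B) = toM A *m toM B.
Proof.
apply/matrixP => i j; rewrite !mxE toC_sum; apply: eq_bigr => k _; rewrite !mxE.
by apply/eqP; rewrite eq_complex /= !eqxx.
Qed.

Lemma toM_tr A : toM (mtr A) = (toM A)^T.
Proof. by apply/matrixP => i j; rewrite !mxE. Qed.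

Lemma toM_adj A : toM (madj A) = dag (toM A).
Proof. by apply/matrixP => i j; rewrite !mxE. Qed.

Lemma toM_id : toM mid = 1%:M.
Proof.
apply/matrixP => i j; rewrite !mxE /mid.
case: (i =P j) => [->|ij]; first by rewrite PeanoNat.Nat.eqb_refl.
have /PeanoNat.Nat.eqb_neq -> // : (i : nat) <> j by move=> /val_inj.
Qed.

Lemma toM_unitary A : Defs.unitary m A <-> unitary_mx (toM A).
Proof.
rewrite /Defs.unitary !toM_eq !toM_mul toM_adj toM_id; split=> [[]//|h]; split=> //.
exact: unitaryC.
Qed.

Lemma J_entry k (i j : 'I_m) : m = (k + k)%N ->
  toM (Jmat m) i j = (j == i + k :> nat)%N%:R - (i == j + k :> nat)%N%:R.
Proof.
move=> hk; have hi := ltn_ord i; have hj := ltn_ord j.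
rewrite mxE /Jmat.
have -> : Nat.div2 m = k by rewrite hk addnn -mul2n -multE PeanoNat.Nat.div2_double.
have eqbE (x y : nat) : Nat.eqb x y = (x == y).
  by apply/idP/eqP => /PeanoNat.Nat.eqb_eq.
have -> : Nat.ltb i k = (i < k)%N.
  by apply/idP/idP => [/PeanoNat.Nat.ltb_lt/ssrnat.ltP|/ssrnat.ltP/PeanoNat.Nat.ltb_lt].
rewrite !eqbE plusE; have [ik|ik] := ltnP i k.
  have -> : (i == j + k :> nat)%N = false by lia.
  by rewrite subr0; case: eqP.
have -> : (j == i + k :> nat)%N = false by lia.
rewrite sub0r; case: eqP => _; last by rewrite oppr0.
by apply/eqP; rewrite eq_complex /= oppr0 !eqxx.
Qed.

Lemma J_form : Nat.Even m -> matching_form (toM (Jmat m)).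
Proof.
move=> [k hk]; have hk' : m = (k + k)%N by rewrite hk multE mul2n addnn.
have Je i j := J_entry i j hk'; set J := toM _ in Je *.
have k0 : (0 < k)%N by lia.
have Jtr : J^T = - J by apply/matrixP => i j; rewrite mxE [RHS]mxE !Je opprB.
have Jre : dag J = J^T.
  apply/matrixP => i j; rewrite dagE [RHS]mxE Je rmorphB /=.
  by rewrite !(rmorph_nat conjc).
have JJ : J^T *m J = 1%:M.
  apply/matrixP => i j; rewrite [LHS]mxE [RHS]mxE.
  have hi := ltn_ord i; have hj := ltn_ord j.
  (* Column i of J has a single nonzero entry, in the row shifted by half the size; the sum in the
     matrix product collapses to it. *)
  have sig : ((if (i < k)%N then i + k else i - k) < m)%N by case: ifP; lia.
  have Jl l : l != Ordinal sig -> J l i = 0.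
    move=> lne; have {lne} : l <> (if (i < k)%N then i + k else i - k)%N :> nat.
      by move=> h; move/eqP : lne; apply; exact: val_inj.
    have hl := ltn_ord l; rewrite Je; case: ifP => h hne.
      have -> : (i == l + k :> nat)%N = false by lia.
      have -> : (l == i + k :> nat)%N = false by lia.
      by rewrite subrr.
    have -> : (i == l + k :> nat)%N = false by lia.
    have -> : (l == i + k :> nat)%N = false by lia.
    by rewrite subrr.
  rewrite (bigD1 (Ordinal sig)) //= big1 ?addr0; last by move=> l /Jl h; rewrite mxE h mul0r.
  rewrite mxE !Je /=.
  have -> : (i == j) = (i == j :> nat) by [].
  case: ifP => h.
    have -> : (i == i + k + k :> nat)%N = false by lia.
    have -> : (j == i + k + k :> nat)%N = false by lia.
    by rewrite eqxx eqn_add2r !sub0r mulrNN mul1r.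
  have -> : (i == i - k + k :> nat)%N by lia.
  have -> : (i - k == i + k :> nat)%N = false by lia.
  have -> : (i - k == j + k :> nat)%N = false by lia.
  have -> : (j == i - k + k :> nat)%N = (i == j :> nat) by lia.
  by rewrite !subr0 mul1r.
split=> //; exists (-1); last by rewrite mulrNN mulr1.
by rewrite scaleN1r.
Qed.

Lemma eps_matching_form s : admissible s m -> matching_form (toM (eps_mat s m)).
Proof.
case: s => -[_ h] /=; last by apply: J_form; exact: h.
by rewrite toM_id; split; rewrite ?dag1 trmx1 ?mulmx1 //; exists 1; rewrite ?scale1r ?mulr1.
Qed.

Lemma mat_cont_comp (X : Type) (dX : X -> X -> R) (D : X -> Prop) (F : X -> Mat)
    (Y : pseudoMetricType R) (T : topologicalType) (h : X -> Y) (g : T -> X) :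
  (forall x y e, ball (h x) e (h y) -> dX x y < e) ->
  mat_cont_on dX D m F -> continuous (fun t => h (g t)) -> (forall t, D (g t)) ->
  mcont (fun t => toM (F (g t))).
Proof.
move=> hd cF cg Dg i j; have /ssrnat.ltP hi := ltn_ord i; have /ssrnat.ltP hj := ltn_ord j.
have [/cont_onP c1 /cont_onP c2] := cF i j hi hj.
under eq_fun do rewrite mxE; split=> /=.
- exact: (epsilon_delta_comp hd c1 cg Dg).
- exact: (epsilon_delta_comp hd c2 cg Dg).
Qed.

Lemma mcont_mat_cont (X : pseudoMetricType R) (dX : X -> X -> R) (D : X -> Prop)
    (F : X -> 'M[R[i]]_m) :
  (forall x y e, dX x y < e -> ball x e y) -> mcont F ->
  mat_cont_on dX D m (fun x => ofM (F x)).
Proof.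
move=> hd cF i j _ _; have [c1 c2] := cF (inord i) (inord j).
by split; apply/cont_onP; apply: continuous_epsilon_delta.
Qed.

Lemma matching_relation (e A B : 'M[R[i]]_m) : matching_form e ->
  e *m A = B^T *m e <-> tau e B = A.
Proof.
move=> [e1 _ _]; have e2 := mulmx1C e1; rewrite /tau; split=> [h|<-].
  by rewrite -mulmxA -h mulmxA e1 mul1mx.
by rewrite !mulmxA e2 mul1mx.
Qed.

Lemma half_IZR : Rdiv (IZR 1) (IZR 2) = 1 / 2 :> R.
Proof. by rewrite RdivE. Qed.

Variable s : statistics.
Hypothesis adm : admissible s m.
Local Notation eps := (toM (eps_mat s m)).

Lemma family2_mfamily a : family2 s m a -> mfamily eps (fun k => toM (a k)).
Proof.
move=> [ca [p1 [p2 [ua ra]]]]; split.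
- apply: (@mat_cont_comp (R * R) dist2 allR a (R * R)%type (R * R)%type id id) => //.
    by move=> x y e /dist2_ball.
  by move=> x; exact: cvg_id.
- by split=> x y; apply/toM_eq; [exact: p1|exact: p2].
- by move=> k; apply/toM_unitary; exact: ua.
- move=> [x y]; apply/matching_relation; first exact: eps_matching_form.
  by rewrite -toM_mul -toM_tr -toM_mul; apply/toM_eq; exact: ra.
Qed.

Lemma family1_mfamily1 a : family1 s m a -> mfamily1 eps (fun k => toM (a k)).
Proof.
move=> [ca [p1 [ua ra]]]; split.
- apply: (@mat_cont_comp R dist1 allR a R R id id) => //.
  by move=> x U hU; exact: hU.
- by move=> x; apply/toM_eq; exact: p1.
- by move=> k; apply/toM_unitary; exact: ua.
- move=> x; apply/matching_relation; first exact: eps_matching_form.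
  by rewrite -toM_mul -toM_tr -toM_mul; apply/toM_eq; exact: ra.
Qed.

Lemma mfamily_family2 (a : R * R -> 'M[R[i]]_m) : mfamily eps a -> family2 s m (fun k => ofM (a k)).
Proof.
move=> [ca pa ua ta]; split; [|split; [|split; [|split]]].
- by apply: (@mcont_mat_cont (R * R)%type dist2 allR a) => // x y e /dist2_ball.
- by move=> x y; apply/toM_eq; rewrite !ofMK pa.1.
- by move=> x y; apply/toM_eq; rewrite !ofMK pa.2.
- by move=> k; apply/toM_unitary; rewrite ofMK.
- move=> x y; apply/toM_eq; rewrite !toM_mul toM_tr !ofMK.
  by apply/matching_relation; [exact: eps_matching_form|exact: (ta (x, y))].
Qed.

(** Clamping the time extends a homotopy given on [0, 1] to the whole line, constant beyond the
    ends. *)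
Lemma eq_homotopic1_homot1 a b : eq_homotopic1 s m a b ->
  homot1 eps (fun x => toM (a x)) (fun x => toM (b x)).
Proof.
move=> [H [cH [fH [H0 H1]]]].
have m01 := @clamp_itv _ 0 1 _ (@ler01 R).
have U t : unit_interval (clamp 0 1 t).
  by have /andP[h1 h2] := m01 t; split; apply/RleP.
exists (fun p => toM (H (clamp 0 1 p.1) p.2)); split.
- apply: (@mat_cont_comp (R * R) dist2 (fun p => unit_interval p.1) (fun p => H p.1 p.2) (R * R)%type (R * R)%type id
    (fun p : R * R => (clamp 0 1 p.1, p.2))) => //.
    by move=> x y e /dist2_ball.
    by apply: cont_pair; [apply: cont_clamp; exact: cont_fst|exact: cont_snd].
  by move=> t; exact: U.
- by move=> t; have h := family1_mfamily1 (fH _ (U t)); exact: h.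
- by move=> x /=; rewrite clamp_id ?lexx ?ler01 //; apply/toM_eq; exact: H0.
- by move=> x /=; rewrite clamp_id ?lexx ?ler01 //; apply/toM_eq; exact: H1.
Qed.

Lemma homot_eq_homotopic2 a b : homot eps (fun k => toM (a k)) (fun k => toM (b k)) ->
  eq_homotopic2 s m a b.
Proof.
move=> [H [cH fH H0 H1]]; exists (fun t k => ofM (H (t, k))); split; [|split; [|split]].
- have -> : (fun p : R * (R * R) => ofM (H (p.1, p.2))) = fun p => ofM (H p).
    by apply/funext => -[].
  by apply: (@mcont_mat_cont (R * (R * R))%type dist3 _ H) => // x y e /dist3_ball.
- by move=> t _; exact: mfamily_family2.
- by move=> k; apply/toM_eq; rewrite ofMK H0.
- by move=> k; apply/toM_eq; rewrite ofMK H1.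
Qed.

Lemma lines_homotopic2 a0 a1 : family2 s m a0 -> family2 s m a1 ->
  eq_homotopic1 s m (fun y => a0 (0, y)) (fun y => a1 (0, y)) ->
  eq_homotopic1 s m (fun y => a0 (1 / 2, y)) (fun y => a1 (1 / 2, y)) ->
  eq_homotopic1 s m (fun x => a0 (x, 0)) (fun x => a1 (x, 0)) ->
  eq_homotopic2 s m a0 a1.
Proof.
move=> f0 f1 l1 l2 l3; apply: homot_eq_homotopic2.
apply: line_criterion => //; try exact: family2_mfamily; try exact: eq_homotopic1_homot1.
exact: eps_matching_form.
Qed.

Lemma mat_cont_on_restrict (X Y : Type) (dX : X -> X -> R) (dY : Y -> Y -> R)
    (D : X -> Prop) (D' : Y -> Prop) (F : X -> Mat) (g : Y -> X) (k : nat) :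
  (forall x y e, 0 < e -> dY x y < e -> dX (g x) (g y) < e) -> (forall y, D' y -> D (g y)) ->
  mat_cont_on dX D k F -> mat_cont_on dY D' k (fun y => F (g y)).
Proof.
move=> hd hD cF i j hi hj.
have H f : cont_on dX D f -> cont_on dY D' (fun y => f (g y)).
  move=> /cont_onP cf; apply/cont_onP => x Dx e e0.
  have [del del0 hdel] := cf (g x) (hD _ Dx) e e0.
  by exists del => // y Dy hxy; apply: hdel; [exact: hD|exact: hd].
by have [c1 c2] := cF i j hi hj; split; [exact: (H _ c1)|exact: (H _ c2)].
Qed.

Lemma dist2_vertical (c x y e : R) : 0 < e -> dist1 x y < e -> dist2 (c, x) (c, y) < e.
Proof. by rewrite /dist1 /dist2 => e0 h; rewrite Rmax_lt /= h RabsE RminusE subrr normr0 e0. Qed.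

Lemma dist2_horizontal (c x y e : R) : 0 < e -> dist1 x y < e -> dist2 (x, c) (y, c) < e.
Proof. by rewrite /dist1 /dist2 => e0 h; rewrite Rmax_lt /= h RabsE RminusE subrr normr0 e0. Qed.

(** A half integer equals its opposite modulo a period; this is why the restriction to such a line
    is again a matching family. *)
Lemma family2_half_opp a (c x : R) : family2 s m a -> half_integer c ->
  toM (a (Ropp c, x)) = toM (a (c, x)) /\ toM (a (x, Ropp c)) = toM (a (x, c)).
Proof.
move=> [_ [p1 [p2 _]]] hc; rewrite RoppE.
have e : - (1 / 2) + 1 = 1 / 2 :> R by lra.
case: hc => ->; first by rewrite oppr0.
split; [have /toM_eq := p1 (- (1 / 2) : R) x|have /toM_eq := p2 x (- (1 / 2) : R)];
  by rewrite RplusE R1E e.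
Qed.

Lemma family2_vertical a (c : R) : family2 s m a -> half_integer c ->
  family1 s m (fun y => a (c, y)).
Proof.
move=> fa hc; have [ca [p1 [p2 [ua ra]]]] := fa; split; [|split; [|split]].
- by apply: (mat_cont_on_restrict (g := fun y => (c, y)) _ _ ca) => // x y e; exact: dist2_vertical.
- by move=> y; exact: p2.
- by move=> y; exact: ua.
- move=> y; apply/toM_eq; have [h _] := family2_half_opp (Ropp y) fa hc.
  by rewrite toM_mul toM_mul toM_tr -h -toM_mul -toM_tr -toM_mul; apply/toM_eq; exact: ra.
Qed.

Lemma family2_horizontal a (c : R) : family2 s m a -> half_integer c ->
  family1 s m (fun x => a (x, c)).
Proof.
move=> fa hc; have [ca [p1 [p2 [ua ra]]]] := fa; split; [|split; [|split]].
- by apply: (mat_cont_on_restrict (g := fun x => (x, c)) _ _ ca) => // x y e; exact: dist2_horizontal.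
- by move=> y; exact: p1.
- by move=> y; exact: ua.
- move=> x; apply/toM_eq; have [_ h] := family2_half_opp (Ropp x) fa hc.
  by rewrite toM_mul toM_mul toM_tr -h -toM_mul -toM_tr -toM_mul; apply/toM_eq; exact: ra.
Qed.

Lemma homotopic2_vertical a0 a1 (c : R) : half_integer c -> eq_homotopic2 s m a0 a1 ->
  eq_homotopic1 s m (fun y => a0 (c, y)) (fun y => a1 (c, y)).
Proof.
move=> hc [H [cH [fH [H0 H1]]]]; exists (fun t y => H t (c, y)); split; [|split; [|split]].
- apply: (mat_cont_on_restrict (g := fun p : R * R => (p.1, (c, p.2))) _ _ cH) => //.
  move=> x y e e0; rewrite /dist2 Rmax_lt /dist3 => /andP[h1 h2].
  by rewrite Rmax_lt h1 /=; exact: dist2_vertical.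
- by move=> t /fH ft; exact: family2_vertical.
- by move=> y; exact: H0.
- by move=> y; exact: H1.
Qed.

Lemma homotopic2_horizontal a0 a1 (c : R) : half_integer c -> eq_homotopic2 s m a0 a1 ->
  eq_homotopic1 s m (fun x => a0 (x, c)) (fun x => a1 (x, c)).
Proof.
move=> hc [H [cH [fH [H0 H1]]]]; exists (fun t x => H t (x, c)); split; [|split; [|split]].
- apply: (mat_cont_on_restrict (g := fun p : R * R => (p.1, (p.2, c))) _ _ cH) => //.
  move=> x y e e0; rewrite /dist2 Rmax_lt /dist3 => /andP[h1 h2].
  by rewrite Rmax_lt h1 /=; exact: dist2_horizontal.
- by move=> t /fH ft; exact: family2_horizontal.
- by move=> x; exact: H0.
- by move=> x; exact: H1.
Qed.

End Bridge.

Unset Implicit Arguments.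
Open Scope R_scope.

Theorem theorem2p10 (s : statistics) (m : nat) (a0 a1 : R * R -> Mat) :
  admissible s m ->
  family2 s m a0 -> family2 s m a1 ->
  (eq_homotopic2 s m a0 a1 <->
     (eq_homotopic1 s m (fun k2 => a0 (0, k2)) (fun k2 => a1 (0, k2)) /\
      eq_homotopic1 s m (fun k2 => a0 (1/2, k2)) (fun k2 => a1 (1/2, k2)) /\
      eq_homotopic1 s m (fun k1 => a0 (k1, 0)) (fun k1 => a1 (k1, 0)) /\
      eq_homotopic1 s m (fun k1 => a0 (k1, 1/2)) (fun k1 => a1 (k1, 1/2)))).
Proof.
(* Size 0 is excluded by [admissible]; the translation of matrices is set up for successors, as
   [inord] requires. *)
case: m => [|n] adm f0 f1; first by case: adm => /ssrnat.leP.
rewrite half_IZR; split=> [h|[l1 [l2 [l3 _]]]]; last exact: lines_homotopic2.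
split; [|split; [|split]].
- by apply: homotopic2_vertical h => //; left.
- by apply: homotopic2_vertical h => //; right.
- by apply: homotopic2_horizontal h => //; left.
- by apply: homotopic2_horizontal h => //; right.
Qed.
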